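(* Let $\mathbb{F}$ be a finite field and let $d\in\mathbb{N}$. The following two statements are equivalent. (i) For every function $\Psi:\mathbb{F}[X]\to[0,\infty)$: $\nu_d(W^{(d)}(\Psi))=1$ if and only if $\sum_{Q\text{ monic}}\nu_d(\mathcal{E}_Q(\Psi)^d)=\infty$. (ii) There exists a constant $C>0$ depending only on $d$ and the size of $\mathbb{F}$ such that for every function $\Psi:\mathbb{F}[X]\to[0,\infty)$, $$\nu_d\Big(\bigcup_{Q\text{ monic}}\mathcal{E}_Q(\Psi)^d\Big)\geq C\min\Big\{\sum_{Q\text{ monic}}\Big(\frac{\Psi(Q)\Phi(Q)}{|Q|}\Big)^d,\,1\Big\}.$$
   Context: $\mathbb{F}$ is a finite field with $q$ elements, $\mathbb{F}[X]$ its polynomial ring, $\mathbb{F}((X^{-1}))$ the field of formal Laurent series in $X^{-1}$. $\partial f$ denotes the degree of $f\in\mathbb{F}((X^{-1}))$ (with $\partial 0=-\infty$), and $|f|=q^{\partial f}$ (with $|0|=0$). $\mathbb{L}$ is the set of $f\in\mathbb{F}((X^{-1}))$ with $\partial f<0$. $\nu$ is the Haar measure on $\mathbb{F}((X^{-1}))$ with $\nu(\mathbb{L})=1$, and $\nu_d$ is the $d$-fold product measure on $\mathbb{F}((X^{-1}))^d$. For monic $Q\in\mathbb{F}[X]$, $$\mathcal{E}_Q(\Psi)=\bigcup_{P\in\mathbb{F}[X],\ \partial P<\partial Q,\ (P,Q)=1}\Big\{f\in\mathbb{L}:\Big|f-\frac{P}{Q}\Big|<\frac{\Psi(Q)}{|Q|}\Big\},$$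 $\mathcal{E}_Q(\Psi)^d$ is its $d$-fold Cartesian product, and $$W^{(d)}(\Psi)=\bigcap_{n=1}^{\infty}\ \bigcup_{Q\text{ monic},\ \partial Q\ge n}\mathcal{E}_Q(\Psi)^d.$$ $\Phi(Q)$ is the number of $P\in\mathbb{F}[X]$ with $\partial P<\partial Q$ and $(P,Q)=1$ (polynomial Euler function). *)

(* Defs.v *)
From HB Require Import structures.
From mathcomp Require Import all_boot all_order all_algebra.
From mathcomp Require Import qpoly zify.
From mathcomp Require Import all_classical all_reals all_analysis.

Set Implicit Arguments.
Unset Strict Implicit.
Unset Printing Implicit Defensive.

Import Order.TTheory GRing.Theory Num.Theory.

Local Open Scope classical_set_scope.
Local Open Scope ring_scope.

(* A formal Laurent series in X^-1 is its family of coefficients a : int -> F, where a n is the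
    coefficient of X^n; only finitely many positive powers of X may occur. *)

Section BoundedAbove.
Variable F : fieldType.

Definition bounded_above : {pred int -> F} :=
  fun a => `[< exists N : int, forall n, N < n -> a n = 0 >].

Lemma bounded_aboveP (a : int -> F) :
  reflect (exists N : int, forall n, N < n -> a n = 0) (a \in bounded_above).
Proof. exact: asboolP. Qed.

Lemma bounded_above_zmod_closed : zmod_closed bounded_above.
Proof.
split; first by apply/bounded_aboveP; exists 0.
move=> a b /bounded_aboveP[A hA] /bounded_aboveP[B hB].
apply/bounded_aboveP; exists (Num.max A B) => n; rewrite gt_max => /andP[An Bn].
by rewrite [LHS]/= (_ : (a - b) n = a n - b n)// hA// hB// subr0.
Qed.

HB.instance Definition _ :=
  GRing.isZmodClosed.Build (int -> F) bounded_above bounded_above_zmod_closed.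

Record laurent := Laurent { lcoef :> int -> F; _ : lcoef \in bounded_above }.

HB.instance Definition _ := [isSub for lcoef].
HB.instance Definition _ := [Choice of laurent by <:].
HB.instance Definition _ := [SubChoice_isSubZmodule of laurent by <:].

End BoundedAbove.

Section LaurentField.
Variable F : fieldType.
Implicit Types (a b c : int -> F) (f g h : laurent F) (A B C n : int) (k K : nat).

Definition mul_coef a b : int -> F :=
  fun n => \sum_(i \in [set: int]) a i * b (n - i).

Definition bounded_by A a := forall n, A < n -> a n = 0.

(* [trunc A a K] reads the top K coefficients of a, from X^A downwards. *)
Definition trunc A a K : {poly F} := \poly_(i < K) a (A - i%:Z).

Lemma mul_coef_gt A B a b :
  bounded_by A a -> bounded_by B b -> bounded_by (A + B) (mul_coef a b).
Proof.
move=> hA hB n ABn; apply: fsbig1 => i _.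
have [Ai|iA] := ltP A i; first by rewrite hA// mul0r.
by rewrite hB ?mulr0//; lia.
Qed.

Lemma mul_coefE A B a b k : bounded_by A a -> bounded_by B b ->
  mul_coef a b (A + B - k%:Z) =
  \sum_(i < k.+1) a (A - i%:Z) * b (B - (k - i)%N%:Z).
Proof.
move=> hA hB.
pose G (i : nat) := a (A - i%:Z) * b (B - (k - i)%N%:Z).
rewrite (fsbig_ord _ _ G).
have inj : set_inj `I_k.+1 (fun i : nat => A - i%:Z).
  by move=> i j _ _ /=; lia.
transitivity (\sum_(i \in `I_k.+1) a (A - i%:Z) * b (A + B - k%:Z - (A - i%:Z))).
  pose H (j : int) : F := a j * b (A + B - k%:Z - j).
  rewrite -(fsbig_image _ _ H inj).
  apply/esym/fsbig_widen => // j [_ /= nj]; rewrite /H.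
  have [Aj|jA] := ltP A j; first by rewrite hA// mul0r.
  rewrite [b _]hB ?mulr0//; rewrite ltNge; apply/negP => Bj; apply: nj.
  by exists `|A - j|%N => /=; lia.
apply: eq_fsbigr => i; rewrite inE /= /G => ik.
by congr (_ * b _); lia.
Qed.

Lemma trunc_mul A B a b k K : (k < K)%N -> bounded_by A a -> bounded_by B b ->
  mul_coef a b (A + B - k%:Z) = (trunc A a K * trunc B b K)`_k.
Proof.
move=> kK hA hB; rewrite (mul_coefE _ hA hB) coefM; apply: eq_bigr => i _.
have ik := ltn_ord i.
by rewrite !coef_poly !ifT //; lia.
Qed.

Lemma eq_bounded A a b : bounded_by A a -> bounded_by A b ->
  (forall k, a (A - k%:Z) = b (A - k%:Z)) -> a = b.
Proof.
move=> hA hB ab; apply/funext => n.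
have [An|nA] := ltP A n; first by rewrite hA// hB.
by rewrite (_ : n = A - `|A - n|%N%:Z) //; lia.
Qed.

Lemma mul_coef_bounded f g : mul_coef f g \in @bounded_above F.
Proof.
case: f g => [a ha] [b hb] /=.
have /bounded_aboveP[A hA] := ha; have /bounded_aboveP[B hB] := hb.
by apply/bounded_aboveP; exists (A + B); exact: mul_coef_gt.
Qed.

Definition lmul f g := Laurent (mul_coef_bounded f g).

Lemma laurent_bound f : exists A, bounded_by A f.
Proof. by case: f => a ha; have /bounded_aboveP[A hA] := ha; exists A. Qed.

Lemma bounded_byW A B a : A <= B -> bounded_by A a -> bounded_by B a.
Proof. by move=> AB hA n Bn; apply: hA; lia. Qed.

Lemma one_bounded :
  (fun n : int => if n == 0 then 1 else 0 : F) \in @bounded_above F.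
Proof.
by apply/bounded_aboveP; exists 0 => n n0; rewrite gt_eqF.
Qed.

Definition lone := Laurent one_bounded.

Lemma lone_bounded : bounded_by 0 lone.
Proof. by move=> n n0 /=; rewrite gt_eqF. Qed.

Lemma trunc_one K : (0 < K)%N -> trunc 0 lone K = 1.
Proof.
move=> K0; apply/polyP => i; rewrite coef_poly coef1 /=.
case: i => [|i]; first by rewrite K0 subr0 eqxx.
by case: ifP => // _; rewrite (_ : _ == _ = false)//; lia.
Qed.

Lemma truncD A a b K : trunc A (a + b) K = trunc A a K + trunc A b K.
Proof.
apply/polyP => i; rewrite coefD !coef_poly.
by case: ifP => // _; rewrite addr0.
Qed.

Lemma lmulC : commutative lmul.
Proof.
move=> f g; apply/val_inj => /=.
have [A hA] := laurent_bound f; have [B hB] := laurent_bound g.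
apply: (@eq_bounded (A + B)).
- exact: mul_coef_gt.
- by rewrite addrC; exact: mul_coef_gt.
- move=> k; rewrite (trunc_mul (ltnSn k))// mulrC.
  by rewrite [A + B]addrC (trunc_mul (ltnSn k)).
Qed.

Lemma lmulA : associative lmul.
Proof.
move=> f g h; apply/val_inj => /=.
have [A hA] := laurent_bound f; have [B hB] := laurent_bound g.
have [C hC] := laurent_bound h.
have hAB := mul_coef_gt hA hB; have hBC := mul_coef_gt hB hC.
apply: (@eq_bounded (A + (B + C))).
- exact: mul_coef_gt.
- by rewrite addrA; exact: mul_coef_gt.
- move=> k; rewrite (trunc_mul (ltnSn k))//.
  rewrite [in RHS]addrA (trunc_mul (ltnSn k))//.
  transitivity ((trunc A f k.+1 * (trunc B g k.+1 * trunc C h k.+1))`_k).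
    rewrite !coefM; apply: eq_bigr => i _; congr (_ * _).
    rewrite [LHS]coef_poly ifT; last by lia.
    by rewrite (@trunc_mul _ _ _ _ _ k.+1)//; lia.
  rewrite mulrA !coefM; apply: eq_bigr => i _; congr (_ * _).
  rewrite [RHS]coef_poly ltn_ord.
  by rewrite (@trunc_mul _ _ _ _ _ k.+1).
Qed.

Lemma lmul1 : left_id lone lmul.
Proof.
move=> f; apply/val_inj => /=; have [A hA] := laurent_bound f.
apply: (@eq_bounded A) => //.
  by rewrite -[A]add0r; exact: (mul_coef_gt lone_bounded).
move=> k; rewrite -[X in mul_coef _ _ (X - _)]add0r.
rewrite (trunc_mul (ltnSn k) lone_bounded)// trunc_one// mul1r.
by rewrite coef_poly ltnSn.
Qed.

Lemma lmulD : left_distributive lmul +%R.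
Proof.
move=> f g h; apply/val_inj => /=.
have [A0 hA0] := laurent_bound f; have [B0 hB0] := laurent_bound g.
have [C hC] := laurent_bound h.
pose A := Num.max A0 B0.
have hA : bounded_by A f by apply: bounded_byW hA0; rewrite le_max lexx.
have hB : bounded_by A g by apply: bounded_byW hB0; rewrite le_max lexx orbT.
have hAB : bounded_by A (val f + val g).
  by move=> n An; rewrite (_ : (val f + val g) n = f n + g n)// hA// hB// addr0.
rewrite [X in mul_coef X](_ : _ = val f + val g)//.
apply: (@eq_bounded (A + C)).
- exact: mul_coef_gt.
- move=> n ACn; rewrite (_ : (_ + _) n = mul_coef f h n + mul_coef g h n)//.
  by rewrite !(@mul_coef_gt A C)// addr0.
- move=> k; rewrite (_ : (mul_coef f h + mul_coef g h) _ =
    mul_coef f h (A + C - k%:Z) + mul_coef g h (A + C - k%:Z))//.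
  by rewrite !(trunc_mul (ltnSn k))// truncD mulrDl coefD.
Qed.

Lemma lone_neq0 : lone != 0.
Proof.
apply/eqP => /(congr1 (fun f : laurent F => f 0)) /= /eqP.
by rewrite [X in _ == X](_ : _ = 0)// oner_eq0.
Qed.

HB.instance Definition _ := GRing.Zmodule_isComNzRing.Build (laurent F)
  lmulA lmulC lmul1 lmulD lone_neq0.

(* The first n coefficients of the inverse of the power series of nonzero
   constant term with coefficients a 0, a 1, ... *)
Fixpoint inv_coefs (a : nat -> F) (n : nat) : seq F :=
  if n isn't m.+1 then [::] else
  let s := inv_coefs a m in
  rcons s ((a 0)^-1 * ((m == 0)%:R - \sum_(i < m) a i.+1 * s`_(m - i.+1))).

Lemma size_inv_coefs (a : nat -> F) (n : nat) : size (inv_coefs a n) = n.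
Proof. by elim: n => //= n IH; rewrite size_rcons IH. Qed.

Lemma nth_inv_coefs (a : nat -> F) (m n : nat) : (m < n)%N ->
  (inv_coefs a n)`_m = (inv_coefs a m.+1)`_m.
Proof.
elim: n => // n IH; rewrite ltnS leq_eqVlt => /orP[/eqP->//|mn].
by rewrite [LHS]/= nth_rcons size_inv_coefs mn IH.
Qed.

Lemma inv_coefsP (a : nat -> F) k : a 0 != 0 ->
  \sum_(i < k.+1) a i * (inv_coefs a (k - i).+1)`_(k - i) = (k == 0)%:R.
Proof.
move=> a0; rewrite big_ord_recl subn0 [inv_coefs _ _]/= nth_rcons.
rewrite size_inv_coefs ltnn eqxx mulrA divff// mul1r -[RHS]addr0 -addrA.
congr (_ + _); apply/eqP; rewrite addrC subr_eq0; apply/eqP.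
apply: eq_bigr => i _; rewrite lift0; congr (_ * _).
by rewrite [RHS]nth_inv_coefs//; have := ltn_ord i; lia.
Qed.

Lemma laurent_lead f : f != 0 ->
  exists A, f A != 0 /\ bounded_by A f.
Proof.
move=> f0; have [B hB] := laurent_bound f.
have ex : exists k : nat, f (B - k%:Z) != 0.
  apply: contrapT => nex; move/negP: f0; apply; apply/eqP/val_inj.
  apply: (@eq_bounded B) => // k.
  by apply/eqP; apply: contrapT => /negP h; apply: nex; exists k.
case: (ex_minnP ex) => k fk kmin; exists (B - k%:Z); split=> // n kn.
have [Bn|nB] := ltP B n; first exact: hB.
apply/eqP; apply: contrapT => /negP fn.
have := kmin `|B - n|%N; rewrite (_ : B - _ = n); last by lia.
by move=> /(_ fn); lia.
Qed.

Lemma laurent_inv_exists f : f != 0 -> exists g, g * f = 1.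
Proof.
move=> /laurent_lead[A [fA hA]].
pose a (i : nat) := f (A - i%:Z).
pose b n : F := if 0 <= - A - n then (inv_coefs a `|- A - n|.+1)`_`|- A - n| else 0.
have hB : bounded_by (- A) b by move=> n nA; rewrite /b ifF//; lia.
have bP : b \in @bounded_above F by apply/bounded_aboveP; exists (- A).
exists (Laurent bP); rewrite mulrC; apply/val_inj.
rewrite [LHS](_ : _ = mul_coef f b)//.
apply: (@eq_bounded (A - A)).
- exact: mul_coef_gt.
- by rewrite subrr; exact: lone_bounded.
move=> k; rewrite (mul_coefE _ hA hB).
have a0 : a 0%N != 0 by rewrite /a subr0.
transitivity ((k == 0%N)%:R : F).
  rewrite -(inv_coefsP k a0); apply: eq_bigr => i _; congr (_ * _).
  rewrite /b ifT; last by lia.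
  by rewrite (_ : `|_|%N = (k - i)%N); last by lia.
rewrite [RHS](_ : _ = if A - A - k%:Z == 0 then 1 else 0)//.
by rewrite (_ : (A - A - k%:Z == 0) = (k == 0%N)); [case: eqP|lia].
Qed.

Definition linv f : laurent F :=
  if f == 0 then 0 else xget 0 [set g | g * f = 1].

Lemma lmulVf f : f != 0 -> linv f * f = 1.
Proof.
move=> f0; rewrite /linv (negPf f0).
have [g gf] := laurent_inv_exists f0.
by case: xgetP => [h _ //|/(_ g)].
Qed.

Lemma linv0 : linv 0 = 0.
Proof. by rewrite /linv eqxx. Qed.

HB.instance Definition _ :=
  GRing.ComNzRing_isField.Build (laurent F) lmulVf linv0.

Lemma laurent_of_poly_subproof (P : {poly F}) :
  (fun n : int => if n is Posz m then P`_m else 0) \in @bounded_above F.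
Proof.
apply/bounded_aboveP; exists (size P)%:Z => -[m|//] Pm.
by rewrite nth_default// ltnW// -ltz_nat.
Qed.

Definition laurent_of_poly (P : {poly F}) : laurent F :=
  Laurent (laurent_of_poly_subproof P).

Lemma laurent_of_poly_is_zmod_morphism : zmod_morphism laurent_of_poly.
Proof.
move=> P Q; apply/val_inj/funext => n.
rewrite [RHS](_ : _ = laurent_of_poly P n - laurent_of_poly Q n)//.
by case: n => m /=; rewrite ?coefB ?subr0.
Qed.

Lemma laurent_of_poly_is_monoid_morphism : monoid_morphism laurent_of_poly.
Proof.
split=> [|P Q]; apply/val_inj/funext => n.
  by case: n => m //=; rewrite coef1; case: m.
rewrite [RHS](_ : _ = mul_coef (laurent_of_poly P) (laurent_of_poly Q) n)//.
rewrite /mul_coef; case: n => m /=; last first.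
  rewrite fsbig1//= => -[i|i] _; last by rewrite mul0r.
  case E: (_ - _) => [j|j]; last by rewrite mulr0.
  by exfalso; lia.
pose H (i : int) : F := laurent_of_poly P i * laurent_of_poly Q (m%:Z - i).
have inj : set_inj `I_m.+1 Posz by move=> i j _ _ [].
rewrite -(@fsbig_widen _ _ _ _ (Posz @` `I_m.+1) setT H)//; last first.
  move=> [i|i] [_ /= ni]; rewrite /H /=; last by rewrite mul0r.
  case E: (_ - _) => [j|j]; last by rewrite mulr0.
  by exfalso; apply: ni; exists i => //=; lia.
rewrite (fsbig_image _ _ H inj) -fsbig_ord coefM; apply: eq_bigr => i _.
rewrite /H /=; congr (_ * _).
by have im := ltn_ord i; case E: (_ - _) => [j|j];
  [congr (Q`_ _); lia|exfalso; lia].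
Qed.

HB.instance Definition _ := GRing.isZmodMorphism.Build _ _ laurent_of_poly
  laurent_of_poly_is_zmod_morphism.
HB.instance Definition _ := GRing.isMonoidMorphism.Build _ _ laurent_of_poly
  laurent_of_poly_is_monoid_morphism.

(* The degree, with value -oo at 0: otherwise the largest n such that the
   coefficient of X^n is nonzero. *)
Definition ldeg f : \bar int :=
  if f == 0 then -oo%E
  else (xget 0 [set n : int | f n != 0 /\ bounded_by n f])%:E.

Lemma ldegE f n : f n != 0 -> bounded_by n f -> ldeg f = n%:E.
Proof.
move=> fn hn; rewrite /ldeg ifF; last by apply: contraNF fn => /eqP->.
case: xgetP => [m -> [fm hm]|/(_ n)/=]; last by case.
congr EFin; apply/eqP; rewrite eq_le !leNgt; apply/andP; split.
  by apply: contra fm => /hn/eqP.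
by apply: contra fn => /hm/eqP.
Qed.

Lemma ldeg_poly (P : {poly F}) :
  P != 0 -> ldeg (laurent_of_poly P) = ((size P).-1%:Z)%:E.
Proof.
move=> P0; apply: ldegE; first by rewrite /= -lead_coefE lead_coef_eq0.
move=> [m|//] Pm /=; rewrite nth_default//.
by move: Pm; rewrite ltz_nat -size_poly_gt0 in P0 *; case: size P0.
Qed.

HB.instance Definition _ := isPointed.Build (laurent F) 0.

(* The sets [set g | (ldeg (g - f)%R < n%:E)%E] are the balls around f. *)
Definition laurent_open : set_system (laurent F) := fun U =>
  forall f, U f -> exists n : int, forall g, (ldeg (g - f)%R < n%:E)%E -> U g.

Lemma laurent_openT : laurent_open setT.
Proof. by move=> f _; exists 0. Qed.

Lemma laurent_openI : setI_closed laurent_open.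
Proof.
move=> U V oU oV f [/oU[m hm] /oV[n hn]]; exists (Num.min m n) => g fg.
by split; [apply: hm|apply: hn]; apply: (lt_le_trans fg);
  rewrite lee_fin ge_min lexx ?orbT.
Qed.

Lemma laurent_open_bigU (I : Type) (U : I -> set (laurent F)) :
  (forall i, laurent_open (U i)) -> laurent_open (\bigcup_i U i).
Proof.
move=> oU f [i _ /oU[n hn]]; exists n => g /hn Uig; by exists i.
Qed.

HB.instance Definition _ := isOpenTopological.Build (laurent F)
  laurent_openT laurent_openI laurent_open_bigU.

Definition laurent_display : measure_display. Proof. exact. Qed.

Definition laurent_borel : set_system (laurent F) :=
  <<s [set U : set (laurent F) | open U] >>.

Let laurent_borel0 : laurent_borel set0.
Proof. exact: sigma_algebra0. Qed.

Let laurent_borelC (U : set (laurent F)) : laurent_borel U -> laurent_borel (~` U).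
Proof. exact: sigma_algebraC. Qed.

Let laurent_borel_bigcup (U : (set (laurent F))^nat) :
  (forall i, laurent_borel (U i)) -> laurent_borel (\bigcup_i U i).
Proof. exact: sigma_algebra_bigcup. Qed.

HB.instance Definition _ := @isMeasurable.Build laurent_display (laurent F)
  laurent_borel laurent_borel0 laurent_borelC laurent_borel_bigcup.

End LaurentField.

Section LaurentMeasure.
Variables (R : realType) (F : finFieldType).

Definition labs (f : laurent F) : R :=
  if ldeg f is n%:E%E then (#|F|%:R : R) ^ n else 0.

Definition open_unit_ball : set (laurent F) := [set f | (ldeg f < 0%:E)%E].

(* Regularity is automatic here: laurent F is locally compact and second
   countable. *)
Definition haar_measure (nu : {measure set (laurent F) -> \bar R}) : Prop :=
  [/\ forall (f : laurent F) (A : set (laurent F)), measurable A ->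
        nu [set f + g | g in A] = nu A,
      forall K : set (laurent F), compact K -> (nu K < +oo)%E
    & nu setT != 0%E].

(* For sigma-finite nu, such as a Haar measure on laurent F, this determines
   nud uniquely. *)
Definition product_measure_of d (nu : {measure set (laurent F) -> \bar R})
    (nud : {measure set (d.-tuple (laurent F)) -> \bar R}) : Prop :=
  forall A : 'I_d -> set (laurent F), (forall i, measurable (A i)) ->
    nud [set x | forall i, A i (tnth x i)] = (\prod_(i < d) nu (A i))%E.

Implicit Types (Psi : {poly F} -> R) (Q : {poly F}).

Definition approx_set Psi Q : set (laurent F) :=
  \bigcup_(P in [set P : {poly F} | (size P < size Q)%N /\ coprimep P Q])
    [set f | open_unit_ball f /\
       labs (f - laurent_of_poly P / laurent_of_poly Q)
         < Psi Q / labs (laurent_of_poly Q)].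

Definition approx_pow d Psi Q : set (d.-tuple (laurent F)) :=
  [set x | forall i, approx_set Psi Q (tnth x i)].

Arguments approx_pow d Psi Q : clear implicits.

Definition limsup_approx d Psi : set (d.-tuple (laurent F)) :=
  \bigcap_(n in [set n | (1 <= n)%N])
    \bigcup_(Q in [set Q : {poly F} | Q \is monic /\ (n <= (size Q).-1)%N])
      approx_pow d Psi Q.

(* {poly_n F} is the finite type of polynomials of size at most n, that is, of
   degree less than n. *)
Definition poly_totient Q : nat :=
  #|[pred P : {poly_((size Q).-1) F} | coprimep (P : {poly F}) Q]|.

End LaurentMeasure.

Arguments approx_pow {R F} d Psi Q.
Arguments limsup_approx {R F} d Psi.

(* Main.v *)
(** Write t_Q for the weight (Psi(Q) Phi(Q) / |Q|)^d, v_Q for the measure of E_Q(Psi)^d, q for |F|.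

    Comparing t and v.  Counting balls gives v_Q <= q^d t_Q.  Conversely v_Q >= c min(t_Q, 1), also
    when Psi(Q) > 1 makes the balls of E_Q(Psi) overlap: this is a second moment estimate for the
    number of residues coprime to Q in a short block, which rests on bounding the number of P such
    that P and P + D are both coprime to Q by |Q| (Phi(Q)/|Q|)^2 s(D)^2, where s(D) is the sum of
    1/|E| over the common divisors E of Q and D; s(D)^2 is bounded on average.

    (i) implies (ii).  If (ii) fails there are finitely supported functions whose union has measure
    u much smaller than the sum s of their weights.  Moving Q to X^m Q multiplies weights by at least
    (1 - 1/q)^d and does not increase u, so about 1/s copies at disjoint degrees have total weight
    bounded below and union of arbitrarily small measure.  Putting such functions together at
    higher and higher degrees contradicts (i).

    (ii) implies (i).  One direction is the Borel-Cantelli lemma.  For the other one, (ii) applied to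
    the tails of a divergent sum gives a limsup set of positive measure, and a zero-one law is
    needed.  A subset A of L^d with nu(A) nu(B) <= nu(A & B) for all cylinders B has measure 0 or 1.
    Either the sum restricted to the Q of some fixed order a at X diverges; then divide Psi by a
    function eta tending to infinity slowly, so that the union V of all W(q^j Psi / eta) is contained
    in W(Psi), and V is mapped into itself by the expanding maps f |-> X^m f + X^-a modulo F[X].  Or
    the sum over the multiples of X^m diverges for all m; then the intersection of the limsup sets
    over these Q is invariant under translation by all A / X^m. *)

Require Import Defs.
From HB Require Import structures.
From mathcomp Require Import all_boot all_order all_algebra.
From mathcomp Require Import qpoly zify ring lra.
From mathcomp Require Import all_classical all_reals all_analysis.

Set Implicit Arguments.
Unset Strict Implicit.
Unset Printing Implicit Defensive.

Import Order.TTheory GRing.Theory Num.Theory.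

Local Open Scope ring_scope.

(** * Coprime residues and their correlations *)

Section PolyCount.
Variable F : finFieldType.
Implicit Types (P Q D A B p : {poly F}) (S T : pred {poly F}).

Definition pdeg P : nat := (size P).-1.

Lemma size_pdeg P : P != 0 -> size P = (pdeg P).+1.
Proof. exact: polySpred. Qed.

Lemma pdegM P Q : P != 0 -> Q != 0 -> pdeg (P * Q) = (pdeg P + pdeg Q)%N.
Proof. by move=> P0 Q0; rewrite {1}/pdeg size_mul// !size_pdeg// addnS. Qed.

Definition npcount n S : nat := #|[pred P : {poly_n F} | S (P : {poly F})]|.

Lemma eq_npcount n S T : S =1 T -> npcount n S = npcount n T.
Proof. by move=> ST; apply: eq_card => P; rewrite !inE ST. Qed.

(** As [n = m + k], source and target of [f] both have q^n elements, so the injection is a bijection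
    and the count over pairs factors. *)
Lemma npcount_inj_prod n m k (f : {poly_n F} -> {poly_m F} * {poly_k F}) S T U :
  injective f -> n = (m + k)%N ->
  (forall P : {poly_n F}, U (P : {poly F}) = S (f P).1 && T (f P).2) ->
  npcount n U = (npcount m S * npcount k T)%N.
Proof.
move=> f_inj nmk fU; rewrite /npcount -cardX.
have cfT : codom f =i predT.
  apply/subset_cardP; last exact/subset_predT.
  by rewrite card_codom// cardT/= -cardT card_prod !card_npoly nmk expnD.
rewrite (_ : #|[pred P : {poly_n F} | _]| = #|preim f [predX
    [pred P : {poly_m F} | S P] & [pred P : {poly_k F} | T P]]|); last first.
  by apply: eq_card => P; rewrite !inE fU.
by rewrite card_preim//; apply: eq_card => x; rewrite !inE cfT.
Qed.

Lemma size_modp_pred A P : A != 0 -> (size (P %% A)%R <= pdeg A)%N.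
Proof. by move=> A0; rewrite -ltnS -size_pdeg// ltn_modp. Qed.

(** Chinese remainder theorem. The pair of residues determines P because a difference divisible by
    [A * B] and of smaller degree vanishes. *)
Lemma npcount_crt A B S T : A != 0 -> B != 0 -> coprimep A B ->
  (forall P, S (P %% A) = S P) -> (forall P, T (P %% B) = T P) ->
  npcount (pdeg A + pdeg B) (fun P => S P && T P) =
  (npcount (pdeg A) S * npcount (pdeg B) T)%N.
Proof.
move=> A0 B0 AB SA TB.
pose n := (pdeg A + pdeg B)%N.
pose f (P : {poly_n F}) :=
  (npolyp (pdeg A) ((P : {poly F}) %% A), npolyp (pdeg B) ((P : {poly F}) %% B)).
have fE1 (P : {poly_n F}) : ((f P).1 : {poly F}) = (P : {poly F}) %% A.
  by rewrite npolypK// size_modp_pred.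
have fE2 (P : {poly_n F}) : ((f P).2 : {poly F}) = (P : {poly F}) %% B.
  by rewrite npolypK// size_modp_pred.
apply: (@npcount_inj_prod _ _ _ f) => //; last by move=> P; rewrite fE1 fE2 SA TB.
move=> P P' fPP'; apply/val_inj/eqP; rewrite -subr_eq0 /=.
have AP : A %| (P : {poly F}) - P'.
  by rewrite /dvdp modpD modpN -!fE1 fPP' subrr.
have BP : B %| (P : {poly F}) - P'.
  by rewrite /dvdp modpD modpN -!fE2 fPP' subrr.
have : A * B %| (P : {poly F}) - P' by rewrite Gauss_dvdp// AP BP.
apply: contraTT => PP'; apply/negP => /(dvdp_leq PP').
apply/negP; rewrite -ltnNge [X in (_ < X)%N]size_pdeg ?mulf_neq0// pdegM//.
exact: (leq_ltn_trans (size_npoly (P - P'))).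

Qed.

(** Division by [A]: the quotient is arbitrary among q^k polynomials, and the remainder alone
    decides membership in [S]. *)
Lemma npcount_mod A S k : A != 0 -> (forall P, S (P %% A) = S P) ->
  npcount (k + pdeg A) S = (#|F| ^ k * npcount (pdeg A) S)%N.
Proof.
move=> A0 SA.
have -> : (#|F| ^ k = npcount k xpredT)%N by rewrite -card_npoly.
pose n := (k + pdeg A)%N.
have sdiv (P : {poly_n F}) : (size ((P : {poly F}) %/ A)%R <= k)%N.
  rewrite size_divp// leq_subLR addnC.
  exact: size_npoly.
pose f (P : {poly_n F}) :=
  (npolyp k ((P : {poly F}) %/ A), npolyp (pdeg A) ((P : {poly F}) %% A)).
have fE2 (P : {poly_n F}) : ((f P).2 : {poly F}) = (P : {poly F}) %% A.
  by rewrite npolypK// size_modp_pred.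
have fE1 (P : {poly_n F}) : ((f P).1 : {poly F}) = (P : {poly F}) %/ A by rewrite npolypK.
apply: (@npcount_inj_prod _ _ _ f) => //; last by move=> P; rewrite fE2 SA.
move=> P P' fPP'; apply/val_inj => /=.
by rewrite [LHS](divp_eq _ A) [RHS](divp_eq _ A) -!fE1 -!fE2 fPP'.
Qed.

Definition cop2 Q D : pred {poly F} := fun P => coprimep P Q && coprimep (P + D) Q.

Definition ptotient2 Q D := npcount (pdeg Q) (cop2 Q D).
(** Convertible with [poly_totient Q]; later proofs pass between the two without a lemma. *)
Definition ptotient Q := npcount (pdeg Q) (fun P => coprimep P Q).

Lemma ptotient2_0 Q : ptotient2 Q 0 = ptotient Q.
Proof. by apply: eq_npcount => P; rewrite /cop2 addr0 andbb. Qed.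

Lemma coprimep_modpl Q P : coprimep (P %% Q) Q = coprimep P Q.
Proof. by rewrite coprimep_sym coprimep_modr coprimep_sym. Qed.

Lemma cop2_mod Q D P : cop2 Q D (P %% Q) = cop2 Q D P.
Proof.
rewrite /cop2 coprimep_modpl; congr (_ && _).
by rewrite -[RHS]coprimep_modpl -[LHS]coprimep_modpl !modpD modp_id.
Qed.

Lemma cop2_mul p Q D P : cop2 (p * Q) D P = cop2 p D P && cop2 Q D P.
Proof. by rewrite /cop2 !coprimepMr andbACA. Qed.

Lemma coprimep_dvd p Q P : p %| Q -> coprimep P Q -> coprimep P p.
Proof. by move=> pQ; apply: coprimep_dvdl. Qed.

(** When [p] divides [Q], coprimality to [p * Q] is coprimality to [Q]: a condition modulo [Q],
    which recurs |p| times. *)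
Lemma ptotient2_dvd p Q D : p != 0 -> Q != 0 -> p %| Q ->
  ptotient2 (p * Q) D = (#|F| ^ pdeg p * ptotient2 Q D)%N.
Proof.
move=> p0 Q0 pQ; rewrite /ptotient2 -npcount_mod//; last exact: cop2_mod.
rewrite pdegM//.
apply: eq_npcount => P; rewrite cop2_mul andb_idl// => /andP[].
by rewrite /cop2 => /(coprimep_dvd pQ)-> /(coprimep_dvd pQ)->.
Qed.

Lemma ptotient2_coprime p Q D : p != 0 -> Q != 0 -> coprimep p Q ->
  ptotient2 (p * Q) D = (ptotient2 p D * ptotient2 Q D)%N.
Proof.
move=> p0 Q0 pQ; rewrite /ptotient2 -npcount_crt//; try exact: cop2_mod.
rewrite pdegM//.
by apply: eq_npcount => P; rewrite cop2_mul.
Qed.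

(** The excluded residues modulo [p] are 0 and -D, which coincide exactly when [p] divides [D]. *)
Lemma ptotient2_irred p D : irreducible_poly p ->
  ptotient2 p D = (#|F| ^ pdeg p - (if (p %| D)%R then 1 else 2))%N.
Proof.
move=> p_irr; have p0 := irredp_neq0 p_irr.
set n := pdeg p.
have small0 (P : {poly F}) : (size P <= n)%N -> p %| P -> P = 0.
  move=> Pn; apply: contraTeq => P0; apply/negP => /(dvdp_leq P0).
  by rewrite size_pdeg// leqNgt ltnS Pn.
pose z := npolyp n (- D %% p).
have zE : (z : {poly F}) = (- D %% p) by rewrite npolypK// size_modp_pred.
have copE (P : {poly_n F}) :
    cop2 p D (P : {poly F}) = (P \notin [set (0 : {poly_n F}); z]).
  rewrite /cop2 ![coprimep _ p]coprimep_sym !irreducible_poly_coprime//.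
  rewrite !inE negb_or; congr (~~ _ && ~~ _).
    apply/idP/eqP => [/(small0 _ (size_npoly P)) P0|->]; last exact: dvdp0.
    exact/val_inj.
  apply/idP/eqP => [pPD|->]; last first.
    by rewrite zE /dvdp modpD modp_id modpN addNr.
  apply/val_inj/eqP; rewrite -subr_eq0; apply/eqP/small0 => /=.
    exact: (size_npoly (P - z)).
  by move: pPD; rewrite /dvdp zE !modpD !modpN modp_id opprK.
rewrite /ptotient2 /npcount.
rewrite (eq_card (B := [predC [set (0 : {poly_n F}); z]])); last first.
  by move=> P; rewrite !inE copE !inE.
have := cardC [set (0 : {poly_n F}); z]; rewrite card_npoly cards2 => <-.
have -> : (0 != z) = ~~ (p %| D).
  rewrite eq_sym -val_eqE/= zE /dvdp modpN oppr_eq0.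
  by [].
by case: ifP => _; rewrite addKn.
Qed.

(** A nonconstant divisor of least size is irreducible; dividing it by its leading coefficient makes
    it monic. *)
Lemma irreducible_factor Q : (0 < pdeg Q)%N ->
  exists p, [/\ irreducible_poly p, p \is monic & p %| Q].
Proof.
move=> Q_gt0; have Q0 : Q != 0 by apply: contraTneq Q_gt0 => ->; rewrite /pdeg size_poly0.
have ex : exists n, [exists p : {poly_n F}, (1 < size (p : {poly F}))%N && ((p : {poly F}) %| Q)].
  exists (size Q); apply/existsP; exists (NPoly (leqnn (size Q))) => /=.
  by rewrite dvdpp andbT size_pdeg.
case: (ex_minnP ex) => n /existsP[p /andP[p1 pQ]] n_min.
have p0 : (p : {poly F}) != 0 by apply: dvdpN0 pQ Q0.
have p_irr : irreducible_poly (p : {poly F}).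
  split=> // r r1 rp; have r0 : r != 0 by apply: dvdpN0 rp p0.
  rewrite -dvdp_size_eqp// eqn_leq dvdp_leq//=.
  apply: leq_trans (size_npoly p) _; apply: n_min; apply/existsP.
  exists (NPoly (leqnn (size r))) => /=; rewrite (dvdp_trans rp pQ) andbT.
  by rewrite ltn_neqAle eq_sym r1 size_poly_gt0.
exists ((lead_coef (p : {poly F}))^-1 *: (p : {poly F})).
have lc0 : (lead_coef (p : {poly F}))^-1 != 0 by rewrite invr_eq0 lead_coef_eq0.
split; last by rewrite dvdpZl.
- split; first by rewrite size_scale.
  move=> r r1; rewrite dvdpZr// => /(p_irr.2 _ r1) /eqp_trans; apply.
  by rewrite eqp_sym eqp_scale.
- by rewrite monicE lead_coefZ mulVf ?lead_coef_eq0.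
Qed.

(** * Divisor sums and the correlation bound *)

Section DivisorSum.
Variable R : rcfType.
Local Notation q := (#|F|%:R : R).

Lemma card_field_gt1 : (1 < #|F|)%N.
Proof. by rewrite (cardD1 0) (cardD1 1) !inE oner_eq0. Qed.

Lemma q_ge2 : 2 <= q.
Proof. by rewrite ler_nat card_field_gt1. Qed.

Lemma q_gt1 : 1 < q.
Proof. by rewrite ltr1n card_field_gt1. Qed.

Lemma q_gt0 : 0 < q.
Proof. exact: lt_trans ltr01 q_gt1. Qed.

Lemma qX_gt0 n : 0 < q ^+ n.
Proof. by rewrite exprn_gt0// q_gt0. Qed.

(* The sum of 1/|E| over the common monic divisors E of Q and D; N bounds the size of E only to make
   the index type finite. *)
Definition divisor_sum N Q D : R :=
  \sum_(E : {poly_N F} | [&& (E : {poly F}) \is monic, (E : {poly F}) %| Q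
                           & (E : {poly F}) %| D]) (q ^+ pdeg E)^-1.

Lemma divisor_sum_ge0 N Q D : 0 <= divisor_sum N Q D.
Proof. by apply: sumr_ge0 => E _; rewrite invr_ge0 ltW ?qX_gt0. Qed.

Lemma divisor_sum_dvd N Q Q' D : Q' %| Q -> divisor_sum N Q' D <= divisor_sum N Q D.
Proof.
move=> Q'Q; rewrite /divisor_sum [leRHS]big_mkcond [leLHS]big_mkcond/=.
apply: ler_sum => E _; case: ifP => [/and3P[-> EQ ->]|_].
  by rewrite (dvdp_trans EQ Q'Q).
by case: ifP => // _; rewrite invr_ge0 ltW ?qX_gt0.
Qed.

(** Each common divisor E of [Q] and [D] yields two common divisors of [p * Q] and [D]: E and p E.
    As [p] does not divide [Q] there is no repetition, and the term of p E is that of E divided by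
    |p|. The bound [N] leaves room for p E in the index type. *)
Lemma divisor_sum_mul_irred N p Q D : p \is monic -> irreducible_poly p -> Q != 0 ->
  ~~ (p %| Q) -> p %| D -> (size (p * Q)%R <= N)%N ->
  (1 + (q ^+ pdeg p)^-1) * divisor_sum N Q D <= divisor_sum N (p * Q) D.
Proof.
move=> p_monic p_irr Q0 pQ pD pQN; have p0 := irredp_neq0 p_irr.
rewrite mulrDl mul1r {3}/divisor_sum.
rewrite (bigID (fun E : {poly_N F} => (E : {poly F}) %| Q))/=; apply: lerD.
  rewrite /divisor_sum [leRHS]big_mkcond [leLHS]big_mkcond/=.
  apply: ler_sum => E _; case: ifP => [/and3P[-> EQ ->]|_].
    by rewrite EQ dvdp_mull.
  by case: ifP => // _; rewrite invr_ge0 ltW ?qX_gt0.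
pose f (E : {poly_N F}) : {poly_N F} := npolyp N (p * (E : {poly F})).
pose A := [set E : {poly_N F} | [&& (E : {poly F}) \is monic, (E : {poly F}) %| Q
                           & (E : {poly F}) %| D]].
have fE (E : {poly_N F}) : E \in A -> (f E : {poly F}) = p * (E : {poly F}).
  rewrite inE => /and3P[Em EQ _]; rewrite npolypK//.
  by rewrite (leq_trans _ pQN)// dvdp_leq ?mulf_neq0// dvdp_mul2l.
have f_inj : {in A &, injective f}.
  move=> E E' EA E'A ff; apply/val_inj/(mulfI p0) => /=.
  by rewrite -fE// ff fE.
rewrite {1}/divisor_sum mulr_sumr.
rewrite [leLHS](_ : _ = \sum_(E in A) (q ^+ pdeg (f E))^-1); last first.
  apply: eq_big => [E|E /and3P[Em EQ ED]]; first by rewrite inE.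
  by rewrite fE ?inE ?Em ?EQ// pdegM ?monic_neq0// exprD invfM.
rewrite -(big_imset (fun E : {poly_N F} => (q ^+ pdeg (E : {poly F}))^-1) f_inj)/=.
rewrite [leRHS]big_mkcond [leLHS]big_mkcond/=.
apply: ler_sum => E _; case: ifP; last first.
  by case: ifP => // _; rewrite invr_ge0 ltW ?qX_gt0.
move=> /imsetP[E' E'A ->]; rewrite fE//.
have := E'A; rewrite inE => /and3P[Em EQ ED].
rewrite monicMl// Em dvdp_mul2l// EQ/=.
have pE : coprimep p (E' : {poly F}).
  by rewrite irreducible_poly_coprime//; apply: contra pQ => pE; exact: dvdp_trans pE EQ.
rewrite Gauss_dvdp// pD ED/= ifT//; apply: contra pQ; apply: dvdp_trans.
exact: dvdp_mulr.
Qed.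

(* Peel off an irreducible factor p of Q.  With x = |p|, the factors contributed by p satisfy
   x (x - 2) <= (x - 1)^2 if p does not divide D and x <= (x - 1) (1 + 1/x)^2 otherwise. *)
Lemma ptotient2_le N Q D : Q != 0 -> (size Q <= N)%N ->
  (ptotient2 Q D)%:R * q ^+ pdeg Q <= (ptotient Q)%:R ^+ 2 * divisor_sum N Q D ^+ 2 :> R.
Proof.
elim/ltn_ind: {Q}(size Q) {-2}Q (erefl (size Q)) => s IH Q Qs Q0 QN.
(* For constant [Q] there is a single residue, and the common divisor 1 alone makes [divisor_sum] at
   least 1. *)
case: (posnP (pdeg Q)) => [Q1|Q1].
  have /size_poly1P[c c0 Qc] : size Q == 1%N by rewrite size_pdeg// Q1.
  have cQ P : coprimep P Q by rewrite Qc -[c%:P]mulr1 mul_polyC coprimepZr// coprimep1.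
  have cnt S : S =1 xpredT -> npcount (pdeg Q) S = 1%N.
    by move=> ST; rewrite (eq_npcount _ ST) Q1 -(expn0 #|F|) -card_npoly.
  rewrite /ptotient2 /ptotient !cnt; try by move=> P; rewrite /cop2 ?cQ.
  rewrite Q1 expr0 !mulr1 expr1n mul1r expr_ge1 ?divisor_sum_ge0//.
  have N0 : (size (1%R : {poly F}) <= N)%N.
    by rewrite size_poly1 (leq_trans _ QN)// size_pdeg.
  rewrite /divisor_sum (bigD1 (NPoly N0))/=; last by rewrite monic1 !dvd1p.
  rewrite {1}/pdeg size_poly1 expr0 invr1 lerDl; apply: sumr_ge0 => E _.
  by rewrite invr_ge0 ltW ?qX_gt0.
have [p [p_irr p_monic /dvdpP[Q' QE]]] := irreducible_factor Q1.
rewrite mulrC in QE; have p0 := irredp_neq0 p_irr.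
have Q'0 : Q' != 0 by apply: contraNneq Q0 => Q'0; rewrite QE Q'0 mulr0.
have pdeg_p : (0 < pdeg p)%N by have := p_irr.1; rewrite size_pdeg.
have Q's : (size Q' < s)%N.
  by rewrite -Qs !size_pdeg// QE pdegM// ltnS -addn1 addnC leq_add2r.
have Q'N : (size Q' <= N)%N by rewrite (leq_trans _ QN)// Qs ltnW.
have {}IH := IH _ Q's _ erefl Q'0 Q'N.
rewrite -ptotient2_0 in IH; rewrite -ptotient2_0.
pose x : R := q ^+ pdeg p.
have x2 : 2 <= x.
  by rewrite (le_trans q_ge2)// -[leLHS]expr1 ler_weXn2l// ltW// q_gt1.
have x0 : x != 0 by rewrite gt_eqF// (lt_le_trans _ x2).
have sig0 := divisor_sum_ge0 N Q' D.
have sig := @divisor_sum_dvd N Q Q' D; rewrite QE dvdp_mull// in sig; have {}sig := sig isT.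
rewrite QE pdegM// exprD -/x.
(* If [p] already divides [Q'], no new condition appears: both sides gain the factor |p|^2, and the
   divisor sum can only grow. *)
case: (boolP (p %| Q')) => pQ'.
  rewrite !ptotient2_dvd// !natrM !natrX -/x.
  set a := (ptotient2 Q' D)%:R in IH *; set b := (ptotient2 Q' 0)%:R in IH *.
  have -> : x * a * (x * q ^+ pdeg Q') = x ^+ 2 * (a * q ^+ pdeg Q') by ring.
  rewrite [leRHS](_ : _ = x ^+ 2 * (b ^+ 2 * divisor_sum N (p * Q') D ^+ 2)); last by ring.
  rewrite ler_wpM2l ?sqr_ge0// (le_trans IH)// ler_wpM2l ?sqr_ge0//.
  by rewrite lerXn2r// nnegrE divisor_sum_ge0.
have cpQ' : coprimep p Q' by rewrite irreducible_poly_coprime.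
have xle : (2 <= #|F| ^ pdeg p)%N by rewrite -(ler_nat R) natrX.
rewrite !ptotient2_coprime// !(ptotient2_irred _ p_irr) dvdp0 !natrM.
have hx1 : (#|F| ^ pdeg p - 1)%:R = x - 1 :> R by rewrite natrB ?(ltnW xle)// natrX.
have hx2 : (#|F| ^ pdeg p - 2)%:R = x - 2 :> R by rewrite natrB// natrX.
rewrite hx1.
set a := (ptotient2 Q' D)%:R in IH *; set b := (ptotient2 Q' 0)%:R in IH *.
have a0 : 0 <= a * q ^+ pdeg Q' by rewrite mulr_ge0// ltW// qX_gt0.
have IH' : x * (x - 1) * (a * q ^+ pdeg Q') <= x * (x - 1) * (b ^+ 2 * divisor_sum N Q' D ^+ 2).
  by rewrite ler_wpM2l// mulr_ge0//; lra.
case: ifP => pD.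
  rewrite hx1.
  have sg := divisor_sum_mul_irred p_monic p_irr Q'0 pQ' pD.
  rewrite -QE in sg; have {}sg := sg N QN; rewrite -/x QE in sg.
  rewrite [leLHS](_ : _ = x * (x - 1) * (a * q ^+ pdeg Q')); last by ring.
  apply: (le_trans IH').
  have sg2 : ((1 + x^-1) * divisor_sum N Q' D) ^+ 2 <= divisor_sum N (p * Q') D ^+ 2.
    rewrite lerXn2r// nnegrE ?divisor_sum_ge0// mulr_ge0// addr_ge0// invr_ge0; lra.
  rewrite [leLHS](_ : _ = b ^+ 2 * (x * (x - 1) * divisor_sum N Q' D ^+ 2)); last by ring.
  rewrite [leRHS](_ : _ = b ^+ 2 * ((x - 1) ^+ 2 * divisor_sum N (p * Q') D ^+ 2)); last by ring.
  apply: ler_wpM2l; first by rewrite sqr_ge0.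
  apply: le_trans (ler_wpM2l _ sg2); last by rewrite sqr_ge0.
  rewrite exprMn [leRHS]mulrA; apply: ler_wpM2r; first by rewrite sqr_ge0.
  have -> : (x - 1) ^+ 2 * (1 + x^-1) ^+ 2 = (x - 1) ^+ 2 * (x + 1) ^+ 2 / x ^+ 2.
    by field.
  rewrite ler_pdivlMr; last by rewrite exprn_gt0//; lra.
  nra.
rewrite hx2.
rewrite [leLHS](_ : _ = x * (x - 2) * (a * q ^+ pdeg Q')); last by ring.
apply: (@le_trans _ _ ((x - 1) ^+ 2 * (a * q ^+ pdeg Q'))).
  by apply: ler_wpM2r => //; nra.
rewrite [leRHS](_ : _ = (x - 1) ^+ 2 * (b ^+ 2 * divisor_sum N (p * Q') D ^+ 2)); last by ring.
apply: ler_wpM2l; first by rewrite sqr_ge0.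
apply: (le_trans IH); apply: ler_wpM2l; first by rewrite sqr_ge0.
by rewrite lerXn2r// nnegrE divisor_sum_ge0.
Qed.

End DivisorSum.
End PolyCount.

(** * Averaging the correlations over the shift *)

Section PolyAverage.
Variables (F : finFieldType) (R : rcfType).
Implicit Types (P Q D A B p E : {poly F}).
Local Notation q := (#|F|%:R : R).

Lemma size_XnDp k (p : {poly_k F}) : size ('X^k + (p : {poly F})) = k.+1.
Proof.
by rewrite size_polyDl size_polyXn// ltnS size_npoly.
Qed.

Lemma monic_XnDp k (p : {poly_k F}) : 'X^k + (p : {poly F}) \is monic.
Proof.
by rewrite monicE lead_coefDl ?lead_coefXn// size_polyXn ltnS size_npoly.
Qed.

Lemma monic_subXn Q : Q \is monic -> (size (Q - 'X^(pdeg Q))%R <= pdeg Q)%N.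
Proof.
move=> Qm; apply/leq_sizeP => j; rewrite leq_eqVlt coefB coefXn => /predU1P[<-|kj].
  by rewrite eqxx -[Q`__]/(lead_coef Q) (monicP Qm) subrr.
by rewrite gtn_eqF// subr0 nth_default// size_pdeg// monic_neq0.
Qed.

Lemma sum_monic_npoly (V : nmodType) (f : {poly F} -> V) N :
  \sum_(E : {poly_N F} | (E : {poly F}) \is monic) f E =
  \sum_(k < N) \sum_(p : {poly_k F}) f ('X^k + (p : {poly F})).
Proof.
case: N => [|N].
  rewrite big_ord0 big1// => E Em; have := size_npoly E.
  by rewrite size_pdeg ?monic_neq0.
have Elt (E : {poly_N.+1 F}) : (E : {poly F}) \is monic -> (pdeg E < N.+1)%N.
  by move=> Em; rewrite -size_pdeg ?monic_neq0// size_npoly.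
rewrite (partition_big (fun E : {poly_N.+1 F} => inord (pdeg E) : 'I_N.+1) xpredT)//=.
apply: eq_bigr => k _.
pose h (p : {poly_k F}) := npolyp N.+1 ('X^k + (p : {poly F})).
pose h' (E : {poly_N.+1 F}) := npolyp k ((E : {poly F}) - 'X^k).
have hE (p : {poly_k F}) : (h p : {poly F}) = 'X^k + (p : {poly F}).
  by rewrite npolypK// size_XnDp.
rewrite (reindex_onto h h') => [|E /andP[Em /eqP kE]]; last first.
  have {}kE : k = pdeg E :> nat by rewrite -kE inordK ?Elt.
  by apply/val_inj => /=; rewrite hE npolypK ?kE ?monic_subXn// addrC subrK.
apply: eq_big => [p|p _]; last by rewrite hE.
rewrite hE monic_XnDp /pdeg size_XnDp/= inord_val eqxx/=.
apply/eqP/val_inj => /=; rewrite npolypK hE addrC addKr//.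

Qed.

(** The cofactors have size at most [h - pdeg E]. The multiple 0 is left out because it would break
    the bound when E has degree above [h]. *)
Lemma card_multiples h E : E != 0 ->
  (#|[pred D : {poly_h F} | ((D : {poly F}) != 0) && (E %| (D : {poly F}))]|%:R : R)
   <= q ^+ h / q ^+ pdeg E.
Proof.
move=> E0; rewrite ler_pdivlMr ?qX_gt0// -natrX -natrX -natrM ler_nat.
have [Eh|hE] := leqP (pdeg E) h; last first.
  rewrite eq_card0// => D; rewrite !inE; apply/negbTE/negP => /andP[D0 ED].
  have := dvdp_leq D0 ED; rewrite (size_pdeg E0) leqNgt ltnS.
  by rewrite (leq_trans (size_npoly D))// ltnW.
rewrite -[in leqRHS](subnK Eh) expnD leq_mul2r.
apply/orP; right; rewrite -card_npoly.
pose f (C : {poly_(h - pdeg E) F}) := npolyp h ((C : {poly F}) * E).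
rewrite -(card_codom (f := f)); last first.
  move=> C C' /(congr1 val) /=.
  have fE (B : {poly_(h - pdeg E) F}) : (f B : {poly F}) = (B : {poly F}) * E.
    rewrite npolypK//; have [->|B0] := eqVneq (B : {poly F}) 0.
      by rewrite mul0r size_poly0.
    rewrite size_pdeg ?mulf_neq0// pdegM// -addSn -size_pdeg//.
    by rewrite addnC -leq_subRL ?size_npoly.
  by rewrite !fE => /(mulIf E0) /val_inj.
apply: subset_leq_card; apply/fintype.subsetP => D; rewrite !inE => /andP[D0 /dvdpP[C DE]].
have C0 : C != 0 by apply: contraNneq D0 => C0; rewrite DE C0 mul0r.
have sC : (size C <= h - pdeg E)%N.
  rewrite leq_subRL// size_pdeg// addnS addnC -pdegM// -size_pdeg ?mulf_neq0//.
  by rewrite -DE size_npoly.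
apply/codomP; exists (NPoly sC); apply/val_inj => /=.
by rewrite npolypK -DE// size_npoly.
Qed.

Local Notation s := (Num.sqrt q).

Lemma sqrtq_gt1 : 1 < s.
Proof. by rewrite -[ltLHS]sqrtr1 ltr_sqrt ?q_gt0 ?q_gt1. Qed.

Lemma sqrtq_gt0 : 0 < s.
Proof. exact: lt_trans ltr01 sqrtq_gt1. Qed.

Lemma sqrtqX_gt0 n : 0 < s ^+ n.
Proof. by rewrite exprn_gt0// sqrtq_gt0. Qed.

(** Geometric mean of the bounds for multiples of [E1] and of [E2]. It is cruder than a count
    through the least common multiple, but it separates the two variables. *)
Lemma card_common_multiples h E1 E2 : E1 != 0 -> E2 != 0 ->
  (#|[pred D : {poly_h F} | [&& (D : {poly F}) != 0, E1 %| (D : {poly F})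
                              & E2 %| (D : {poly F})]]|%:R : R)
   <= q ^+ h / (s ^+ pdeg E1 * s ^+ pdeg E2).
Proof.
move=> E10 E20; have rhs_ge0 : 0 <= q ^+ h / (s ^+ pdeg E1 * s ^+ pdeg E2).
  by apply: divr_ge0; [exact/ltW/qX_gt0|apply: mulr_ge0; exact/ltW/sqrtqX_gt0].
rewrite -ler_sqr ?nnegrE ?ler0n//.
have -> : (q ^+ h / (s ^+ pdeg E1 * s ^+ pdeg E2)) ^+ 2 =
    (q ^+ h / q ^+ pdeg E1) * (q ^+ h / q ^+ pdeg E2).
  have sE n : (s ^+ n) ^+ 2 = q ^+ n.
    by rewrite -exprM mulnC exprM sqr_sqrtr// ltW// q_gt0.
  by rewrite expr_div_n exprMn !sE invfM [RHS]mulrACA -expr2.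
rewrite expr2; apply: ler_pM => //; try exact: ler0n.
  apply: le_trans (card_multiples h E10); rewrite ler_nat subset_leq_card//.
  by apply/fintype.subsetP => D; rewrite !inE => /and3P[-> ->].
apply: le_trans (card_multiples h E20); rewrite ler_nat subset_leq_card//.
by apply/fintype.subsetP => D; rewrite !inE => /and3P[-> _ ->].
Qed.

(** The q^k monic E of degree k contribute s^-k altogether, which leaves a partial geometric
    series. *)
Lemma sum_monic_le N :
  \sum_(E : {poly_N F} | (E : {poly F}) \is monic) (q ^+ pdeg E * s ^+ pdeg E)^-1
   <= s / (s - 1).
Proof.
rewrite (sum_monic_npoly (fun E => (q ^+ pdeg E * s ^+ pdeg E)^-1)).
rewrite (eq_bigr (fun k : 'I_N => s^-1 ^+ k)) => [|k _]; last first.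
  rewrite (eq_bigr (fun=> (q ^+ k * s ^+ k)^-1)) => [|p _]; last first.
    by rewrite /pdeg size_XnDp.
  rewrite sumr_const card_npoly invfM -[LHS]mulr_natl natrX mulrA.
  by rewrite divff ?mul1r ?exprVn// gt_eqF// qX_gt0.
have s1 : s - 1 != 0 by rewrite subr_eq0 gt_eqF// sqrtq_gt1.
have s0 : s != 0 by rewrite gt_eqF// sqrtq_gt0.
have := subrX1 s^-1 N; set S := \sum_(i < N) _ => SE.
have s1' : s^-1 - 1 = - ((s - 1) / s) by field.
have {}SE : (s - 1) / s * S = 1 - s^-1 ^+ N.
  by move: SE; rewrite s1' mulNr => SE; rewrite -[LHS]opprK -SE opprB.
have -> : S = s / (s - 1) * (1 - s^-1 ^+ N) by rewrite -SE; field; rewrite s1 s0.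
have K_gt0 : 0 < s / (s - 1) by rewrite divr_gt0 ?subr_gt0 ?sqrtq_gt1 ?sqrtq_gt0.
by rewrite ger_pMr// gerBl exprn_ge0// invr_ge0 ltW// sqrtq_gt0.
Qed.

(** Expand the square, drop the condition that the divisors divide [Q], and sum over D first. The
    bound on common multiples turns the double sum over divisors into the square of a bounded
    sum. *)
Lemma sum_divisor_sum_sqr h N Q :
  \sum_(D : {poly_h F} | (D : {poly F}) != 0) divisor_sum R N Q D ^+ 2
   <= (s / (s - 1)) ^+ 2 * q ^+ h.
Proof.
pose m (E : {poly_N F}) := (E : {poly F}) \is monic.
pose g (E : {poly_N F}) : R := (q ^+ pdeg E)^-1.
have g0 (E : {poly_N F}) : 0 <= g E by rewrite invr_ge0 ltW ?qX_gt0.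
pose b (E D : {poly F}) : R := (E %| D)%R%:R.
have sigle D : divisor_sum R N Q D ^+ 2 <=
    \sum_(E1 : {poly_N F} | m E1) \sum_(E2 : {poly_N F} | m E2)
      g E1 * g E2 * (b E1 D * b E2 D).
  apply: (@le_trans _ _ ((\sum_(E : {poly_N F} | m E) g E * b E D) ^+ 2)).
    rewrite lerXn2r ?nnegrE ?divisor_sum_ge0//.
      by apply: sumr_ge0 => E _; rewrite mulr_ge0// ler0n.
    rewrite /divisor_sum [leLHS]big_mkcond [leRHS]big_mkcond; apply: ler_sum => E _.
    rewrite /m /b; case: ifP => [/and3P[-> _ ->]|_]; first by rewrite mulr1.
    by case: ifP => // _; rewrite mulr_ge0// ler0n.
  rewrite expr2 mulr_suml; apply: ler_sum => E1 _; rewrite mulr_sumr.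
  by apply: ler_sum => E2 _; rewrite mulrACA.
apply: (@le_trans _ _ (\sum_(D : {poly_h F} | (D : {poly F}) != 0)
    \sum_(E1 : {poly_N F} | m E1) \sum_(E2 : {poly_N F} | m E2)
      g E1 * g E2 * (b E1 D * b E2 D))).
  by apply: ler_sum => D _; exact: sigle.
rewrite exchange_big/=.
apply: (@le_trans _ _ (\sum_(E1 : {poly_N F} | m E1) \sum_(E2 : {poly_N F} | m E2)
   q ^+ h * ((q ^+ pdeg E1 * s ^+ pdeg E1)^-1 * (q ^+ pdeg E2 * s ^+ pdeg E2)^-1))).
  apply: ler_sum => E1 E1m; rewrite exchange_big/=; apply: ler_sum => E2 E2m.
  rewrite -mulr_sumr.
  have -> : \sum_(D : {poly_h F} | (D : {poly F}) != 0) b E1 D * b E2 D =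
    #|[pred D : {poly_h F} | [&& (D : {poly F}) != 0, (E1 : {poly F}) %| (D : {poly F})
                              & (E2 : {poly F}) %| (D : {poly F})]]|%:R.
    rewrite -sumr_const big_mkcond [RHS]big_mkcond; apply: eq_bigr => D _.
    rewrite !inE /b; case: ifP => //=.
    by case: (_ %| _)%R; case: (_ %| _)%R; rewrite ?mulr1 ?mulr0.
  have := card_common_multiples h (monic_neq0 E1m) (monic_neq0 E2m).
  move=> /(ler_wpM2l (mulr_ge0 (g0 E1) (g0 E2))) /le_trans; apply.
  by rewrite /g !invfM le_eqVlt; apply/orP; left; apply/eqP; ring.
rewrite [leRHS]mulrC.
under eq_bigr do rewrite -mulr_sumr -mulr_sumr.
rewrite -mulr_sumr -mulr_suml -expr2.
apply: ler_wpM2l; first exact/ltW/qX_gt0.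
rewrite lerXn2r ?sum_monic_le// nnegrE.
  by apply: sumr_ge0 => E _; rewrite invr_ge0 mulr_ge0// ltW ?qX_gt0 ?sqrtqX_gt0.
by rewrite divr_ge0 ?subr_ge0 ?(ltW sqrtq_gt1) ?(ltW sqrtq_gt0).
Qed.

(** Bound, uniform in Q, for the mean of the squared divisor sums over nonzero shifts D. *)
Definition Kq : R := (s / (s - 1)) ^+ 2.

(** The shift D = 0 is kept apart: it gives [ptotient Q] exactly, whereas the pointwise correlation
    bound is averaged over the other shifts. *)
Lemma sum_totient2_le Q h : Q != 0 ->
  \sum_(D : {poly_h F}) (ptotient2 Q D)%:R * q ^+ pdeg Q
   <= (ptotient Q)%:R * q ^+ pdeg Q + Kq * (ptotient Q)%:R ^+ 2 * q ^+ h.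
Proof.
move=> Q0; rewrite (bigD1 0)//= ptotient2_0 lerD2l.
rewrite -mulrA mulrCA.
apply: (@le_trans _ _ (\sum_(D : {poly_h F} | (D : {poly F}) != 0)
    (ptotient Q)%:R ^+ 2 * divisor_sum R (size Q) Q D ^+ 2)).
  by apply: ler_sum => D _; exact: ptotient2_le.
by rewrite -mulr_sumr ler_wpM2l ?sqr_ge0// sum_divisor_sum_sqr.
Qed.

End PolyAverage.

(** * Blocks that contain a coprime residue *)

Section CoprimeBlocks.
Variables (F : finFieldType) (R : rcfType).
Implicit Types (P Q D A B p E : {poly F}).
Local Notation q := (#|F|%:R : R).

(** Cauchy-Schwarz against the constant 1, obtained by summing 2 a b <= a^2 + b^2 over all pairs. *)
Lemma sqr_sum_leq (I : finType) (A : {set I}) (N : I -> nat) :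
  ((\sum_(i in A) N i) ^ 2 <= #|A| * \sum_(i in A) N i ^ 2)%N.
Proof.
rewrite -(leq_pmul2l (isT : 0 < 2)%N) -mulnn big_distrl/= big_distrr/=.
have -> : (2 * (#|A| * \sum_(i in A) N i ^ 2) =
    \sum_(i in A) \sum_(j in A) (N i ^ 2 + N j ^ 2))%N.
  transitivity (\sum_(i in A) (#|A| * N i ^ 2 + \sum_(j in A) N j ^ 2))%N.
    by rewrite big_split/= -big_distrr/= sum_nat_const mul2n addnn.
  by apply: eq_bigr => i _; rewrite big_split/= sum_nat_const.
apply: leq_sum => i _; rewrite big_distrr/= big_distrr/=.
by apply: leq_sum => j _; exact: nat_Cauchy.
Qed.

(** Cauchy-Schwarz for the sizes of the fibres of [f]: they add up to the size of [A], and their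
    squares count the pairs with a common image. *)
Lemma sqr_card_leq_imset (I J : finType) (f : I -> J) (A : {set I}) :
  (#|A| ^ 2 <= #|f @: A| * #|[set p : I * I | [&& p.1 \in A, p.2 \in A & f p.1 == f p.2]]|)%N.
Proof.
pose N j := #|[set i in A | f i == j]|.
have cA : #|A| = (\sum_(j in f @: A) N j)%N.
  rewrite -sum1_card (partition_big f (mem (f @: A)))/=; last first.
    by move=> i iA; exact: imset_f.
  by apply: eq_bigr => j _; rewrite /N -sum1_card; apply: eq_bigl => i; rewrite !inE.
have cP : #|[set p : I * I | [&& p.1 \in A, p.2 \in A & f p.1 == f p.2]]| =
    (\sum_(j in f @: A) N j ^ 2)%N.
  rewrite -sum1_card (partition_big (fun p : I * I => f p.1) (mem (f @: A)))/=; last first.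
    by move=> p; rewrite !inE => /and3P[pA _ _]; exact: imset_f.
  apply: eq_bigr => j _; rewrite /N -mulnn -cardsX -sum1_card; apply: eq_bigl => -[a b].
  rewrite !inE/=; apply/idP/idP.
    by move=> /andP[/and3P[-> -> /eqP <-] /eqP ->]; rewrite eqxx.
  by move=> /andP[/andP[-> /eqP ->] /andP[-> /eqP ->]]; rewrite !eqxx.
rewrite {1}cA cP; exact: sqr_sum_leq.
Qed.

Definition coprime_set Q : {set {poly_(pdeg Q) F}} :=
  [set P : {poly_(pdeg Q) F} | coprimep (P : {poly F}) Q].

(* Indexes the block of q^h consecutive polynomials that contains P. *)
Definition trunc_div n h (P : {poly_n F}) : {poly_n F} :=
  npolyp n ((P : {poly F}) %/ 'X^h).

Lemma trunc_divE n h (P : {poly_n F}) :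
  (trunc_div h P : {poly F}) = (P : {poly F}) %/ 'X^h.
Proof. by rewrite npolypK// (leq_trans (leq_divp _ _))// size_npoly. Qed.

Lemma divp_Xn_eq h P P' : P %/ 'X^h = P' %/ 'X^h -> (size (P' - P)%R <= h)%N.
Proof.
move=> PP'; rewrite (divp_eq P 'X^h) (divp_eq P' 'X^h) PP' opprD addrACA subrr add0r.
rewrite -modpN -modpD -ltnS -(size_polyXn F h) ltn_modp.
by rewrite -size_poly_gt0 size_polyXn.
Qed.

Lemma card_coprime_set Q : #|coprime_set Q| = ptotient Q.
Proof. by rewrite cardsE. Qed.

(** Two members of a block differ by some D of size at most [h], and for a given D the first member
    determines the pair. *)
Lemma close_pairs_leq Q h :
  (#|[set p : {poly_(pdeg Q) F} * {poly_(pdeg Q) F} |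
      [&& p.1 \in coprime_set Q, p.2 \in coprime_set Q
        & trunc_div h p.1 == trunc_div h p.2]]|
   <= \sum_(D : {poly_h F}) ptotient2 Q D)%N.
Proof.
pose n := pdeg Q.
pose f (p : {poly_n F} * {poly_n F}) : {poly_h F} := npolyp h ((p.2 : {poly F}) - p.1).
set A := [set p | _].
have fE (p : {poly_n F} * {poly_n F}) : p \in A -> (f p : {poly F}) = (p.2 : {poly F}) - p.1.
  rewrite inE => /and3P[_ _ /eqP /(congr1 val)/=]; rewrite !trunc_divE => pp.
  by rewrite npolypK// divp_Xn_eq.
rewrite -sum1_card (partition_big f xpredT)//=; apply: leq_sum => D _.
rewrite sum1_card -(card_in_imset (f := fst)); last first.
  move=> p p'; rewrite !unfold_in => /andP[pA /eqP pD] /andP[p'A /eqP p'D] pp'.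
  apply/pair_eqP; rewrite /pair_eq pp' eqxx/=; apply/eqP/val_inj => /=.
  apply: (@addIr _ (- (p.1 : {poly F}))).
  by rewrite {2}pp' -!fE// pD p'D.
apply: subset_leq_card; apply/fintype.subsetP => P /imsetP[p].
rewrite unfold_in => /andP[pA /eqP pD] ->; rewrite inE /cop2.
have := pA; rewrite inE !inE => /and3P[-> p2 _]/=.
by rewrite -pD fE// addrC subrK.
Qed.

Lemma ptotient_gt0 Q : Q != 0 -> (0 < ptotient Q)%N.
Proof.
move=> Q0; rewrite -card_coprime_set card_gt0; apply/set0Pn.
have [Q1|Q1] := posnP (pdeg Q); last first.
  have h : (size (1%R : {poly F}) <= pdeg Q)%N by rewrite size_poly1.
  by exists (NPoly h); rewrite inE/= coprime1p.
exists 0; rewrite inE/= coprime0p -size_poly_eq1.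
by rewrite size_pdeg// Q1.
Qed.

Lemma Kq_ge0 : 0 <= Kq F R.
Proof. exact: sqr_ge0. Qed.

(* Second moment method: Cauchy-Schwarz bounds the square of the number of residues coprime to Q by the
   number of blocks that contain one times the number of pairs of them in a common block. *)
Lemma card_blocks_ge Q h : Q != 0 ->
  (ptotient Q)%:R * q ^+ pdeg Q
   <= #|trunc_div h @: coprime_set Q|%:R * (q ^+ pdeg Q + Kq F R * (ptotient Q)%:R * q ^+ h) :> R.
Proof.
move=> Q0; have t0 : 0 < (ptotient Q)%:R :> R by rewrite ltr0n ptotient_gt0.
set B := #|_|.
rewrite -(ler_pM2l t0).
have := sqr_card_leq_imset (trunc_div h) (coprime_set Q); rewrite -/B card_coprime_set.
move=> /leq_trans /(_ (leq_mul (leqnn _) (close_pairs_leq Q h))).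
rewrite -(ler_nat R) natrX natrM => /(ler_wpM2r (ltW (qX_gt0 F R (pdeg Q)))).
set t := (ptotient Q)%:R; set S := (\sum_(D : {poly_h F}) ptotient2 Q D)%N => tS.
have -> : t * (t * q ^+ pdeg Q) = t ^+ 2 * q ^+ pdeg Q by ring.
apply: (le_trans tS).
have -> : t * (B%:R * (q ^+ pdeg Q + Kq F R * t * q ^+ h)) =
    B%:R * (t * q ^+ pdeg Q + Kq F R * t ^+ 2 * q ^+ h) by ring.
rewrite -mulrA; apply: ler_wpM2l; first exact: ler0n.
by rewrite /S natr_sum mulr_suml sum_totient2_le.
Qed.

(** Only the first factor X can cost anything: it multiplies the count by q - 1 instead of q when X
    does not divide [Q]. Every further one multiplies it by exactly q. *)
Lemma ptotient_mul_Xn Q m : Q != 0 -> (0 < m)%N ->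
  (ptotient Q)%:R * q ^+ m * (1 - q^-1) <= (ptotient ('X^m * Q))%:R :> R.
Proof.
move=> Q0; have X_irr : irreducible_poly ('X : {poly F}).
  by have := irredp_XsubC (0 : F); rewrite subr0.
have q0 : q != 0 by rewrite gt_eqF// q_gt0.
have q1 : 0 <= 1 - q^-1 by rewrite subr_ge0 invf_le1 ?q_gt0// ltW// q_gt1.
case: m => // m _; elim: m => [|m IH]; last first.
  have -> : 'X^(m.+2) * Q = 'X * ('X^(m.+1) * Q) by rewrite [in LHS]exprS mulrA.
  rewrite -(ptotient2_0 ('X * _)) ptotient2_dvd ?polyX_eq0 ?mulf_neq0 ?expf_neq0 ?polyX_eq0//; last first.
    by rewrite exprS -mulrA dvdp_mulr.
  rewrite ptotient2_0 /pdeg size_polyX/= expn1 natrM exprS mulrCA -mulrA.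
  by apply: ler_wpM2l; [exact: ler0n|exact: IH].
rewrite !expr1 -(ptotient2_0 ('X * Q)); case: (boolP ('X %| Q)) => XQ.
  rewrite ptotient2_dvd ?polyX_eq0// /pdeg size_polyX expn1 natrM ptotient2_0.
  by rewrite [_ * q]mulrC ler_piMr ?mulr_ge0 ?ler0n// gerBl invr_ge0 ltW// q_gt0.
rewrite ptotient2_coprime ?polyX_eq0// ?irreducible_poly_coprime//.
rewrite ptotient2_irred// dvdp0 ptotient2_0 /pdeg size_polyX expn1 natrM.
rewrite natrB ?(ltnW (card_field_gt1 F))// le_eqVlt; apply/orP; left; apply/eqP.
by field.
Qed.

End CoprimeBlocks.

(** * Balls and Haar measure *)

Local Open Scope classical_set_scope.
Local Open Scope ring_scope.

Section LaurentBall.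
Variable F : finFieldType.
Implicit Types (f g h c : laurent F) (P Q E : {poly F}) (k m n : int).
Local Notation iota := (@laurent_of_poly F).

Lemma lcoefD f g n : (f + g) n = f n + g n. Proof. by []. Qed.
Lemma lcoefN f n : (- f) n = - f n. Proof. by []. Qed.
Lemma lcoefB f g n : (f - g) n = f n - g n. Proof. by []. Qed.

Lemma lcoef_poly P n : iota P n = if n is Posz i then P`_i else 0. Proof. by []. Qed.

(** The ball |f| < q^k around 0, in terms of coefficients; [lball 0] is the set L. *)
Definition lball k : set (laurent F) := [set f | forall n, k <= n -> f n = 0].

Lemma lballD k f g : lball k f -> lball k g -> lball k (f + g).
Proof. by move=> hf hg n kn; rewrite lcoefD hf// hg// addr0. Qed.

Lemma lballN k f : lball k f -> lball k (- f).
Proof. by move=> hf n kn; rewrite lcoefN hf// oppr0. Qed.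

Lemma lballB k f g : lball k f -> lball k g -> lball k (f - g).
Proof. by move=> hf hg; apply: lballD => //; exact: lballN. Qed.

Lemma lballW k m f : k <= m -> lball k f -> lball m f.
Proof. by move=> km hf n mn; apply: hf; lia. Qed.

Lemma lball_poly (n : nat) P : lball n%:Z (iota P) <-> (size P <= n)%N.
Proof.
split=> [h|Pn [i|//] ni /=]; last by rewrite nth_default// (leq_trans Pn).
apply/leq_sizeP => j nj; exact: (h j%:Z).
Qed.

Lemma lball_poly0 P : lball 0 (iota P) -> P = 0.
Proof. by rewrite (lball_poly 0) leqn0 size_poly_eq0 => /eqP. Qed.

Lemma laurent_of_poly_neq0 P : P != 0 -> iota P != 0.
Proof. by apply: contra => /eqP P0; apply/eqP/lball_poly0; rewrite P0. Qed.

Lemma ldeg_lt f k : (ldeg f < k%:E)%E <-> lball k f.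
Proof.
have [->|f0] := eqVneq f 0; first by split=> // _; rewrite /ldeg eqxx ltNyr.
have [A [fA hA]] := laurent_lead f0; rewrite (ldegE fA hA) lte_fin.
split=> [Ak n kn|h]; first by apply: hA; lia.
by rewrite ltNge; apply: contra fA => /h ->.
Qed.

Lemma lball_lead f A k : f A != 0 -> bounded_by A f -> lball k f <-> A < k.
Proof.
move=> fA hA; split=> [h|Ak n kn]; last by apply: hA; lia.
by rewrite ltNge; apply: contra fA => /h ->.
Qed.

Lemma lmul_lead f g A B : bounded_by A f -> bounded_by B g ->
  (f * g) (A + B) = f A * g B.
Proof.
move=> hA hB; have := mul_coefE 0 hA hB.
by rewrite big_ord_recl big_ord0 !subr0 addr0.
Qed.

Lemma lballM f g A k : f A != 0 -> bounded_by A f ->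
  lball (k + A) (f * g) <-> lball k g.
Proof.
move=> fA hA; have [->|g0] := eqVneq g 0; first by rewrite mulr0.
have [B [gB hB]] := laurent_lead g0.
rewrite (lball_lead _ gB hB) (@lball_lead _ (A + B)) ?lmul_lead ?mulf_neq0//.
  by split; lia.
exact: mul_coef_gt.
Qed.

Lemma lfloor_exists f : exists P, lball 0 (f - iota P).
Proof.
have [A hA] := laurent_bound f.
exists (\poly_(i < `|A|.+1) f i%:Z) => -[n|//] _; rewrite lcoefB/= coef_poly.
by case: ifPn => [_|nA]; rewrite ?subrr// hA ?subr0//; lia.
Qed.

(** The polynomial part of f. *)
Definition lfloor f : {poly F} := sval (cid (lfloor_exists f)).

Lemma lfloorP f : lball 0 (f - iota (lfloor f)).
Proof. exact: svalP (cid (lfloor_exists f)). Qed.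

Variable R : realType.
Local Notation q := (#|F|%:R : R).
Local Notation labs := (labs R).

Lemma qz_gt0 n : 0 < q ^ n.
Proof. by rewrite exprz_gt0// q_gt0. Qed.

Lemma q_neq0 : q != 0.
Proof. by rewrite gt_eqF// q_gt0. Qed.

Lemma labs0 : labs (0 : laurent F) = 0.
Proof. by rewrite /Defs.labs /ldeg eqxx. Qed.

Lemma labsE f n : f n != 0 -> bounded_by n f -> labs f = q ^ n.
Proof. by move=> fn hn; rewrite /Defs.labs (ldegE fn hn). Qed.

Lemma labs_gt0 f : f != 0 -> 0 < labs f.
Proof. by move=> /laurent_lead[A [fA hA]]; rewrite (labsE fA hA) qz_gt0. Qed.

Lemma labs_ge0 f : 0 <= labs f.
Proof. by have [->|/labs_gt0/ltW//] := eqVneq f 0; rewrite labs0. Qed.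

Lemma labs_lt f k : labs f < q ^ k <-> lball k f.
Proof.
have [->|f0] := eqVneq f 0; first by split => // _; rewrite labs0 qz_gt0.
rewrite -ldeg_lt; have [A [fA hA]] := laurent_lead f0.
rewrite (labsE fA hA) (ldegE fA hA) lte_fin.
by rewrite ltr_eXz2l// q_gt1.
Qed.

Lemma labsM f g : labs (f * g) = labs f * labs g.
Proof.
have [->|f0] := eqVneq f 0; first by rewrite mul0r labs0 mul0r.
have [->|g0] := eqVneq g 0; first by rewrite mulr0 labs0 mulr0.
have [A [fA hA]] := laurent_lead f0; have [B [gB hB]] := laurent_lead g0.
rewrite (labsE fA hA) (labsE gB hB) -expfzDr ?q_neq0//.
apply: labsE; last exact: mul_coef_gt.
by rewrite lmul_lead// mulf_neq0.
Qed.

Lemma labs_poly P : P != 0 -> labs (iota P) = q ^ (pdeg P)%:Z.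
Proof.
by move=> P0; rewrite /Defs.labs ldeg_poly.
Qed.

Lemma lballM_labs f g n k : labs f = q ^ n -> lball (k + n) (f * g) <-> lball k g.
Proof.
move=> fn; rewrite -labs_lt -labs_lt labsM fn expfzDr ?q_neq0// mulrC.
by rewrite ltr_pM2r ?qz_gt0.
Qed.

(** Nonzero absolute values are powers of q, so the radius may be rounded up to the least q^k above
    or equal to [r]. *)
Lemma exists_lball (r : R) : 0 < r ->
  exists k, [/\ q ^ (k - 1) < r, r <= q ^ k & forall f, labs f < r <-> lball k f].
Proof.
move=> r0.
have pow_ge (x : R) : exists n : nat, x <= q ^+ n.
  have [n xn] : exists n : nat, x <= n%:R.
    by exists (Num.bound `|x|); rewrite (le_trans (ler_norm _))// ltW// archi_boundP.
  exists n; rewrite (le_trans xn)// -natrX ler_nat.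
  exact/ltnW/ltn_expl/card_field_gt1.
have [m rm] := pow_ge r^-1; have [n0 rn0] := pow_ge r.
(* The least exponent is searched among naturals shifted down by m + 1; since 1/r <= q^m, the index
   0 fails. *)
pose Pn (i : nat) := `[< r <= q ^ (i%:Z - m.+1%:Z) >].
have ex : exists i, Pn i.
  exists (n0 + m.+1)%N; apply/asboolP.
  by rewrite (_ : _ - _ = n0%:Z)//; lia.
case: (ex_minnP ex) => n /asboolP rn n_min.
have rlt : q ^ (n%:Z - m.+1%:Z - 1) < r.
  rewrite ltNge; apply/negP => rle; case: n rn n_min rle => [|n] rn n_min rle.
    move: rn; rewrite sub0r leNgt => /negP; apply.
    rewrite -invr_expz -invf_plt ?posrE ?qz_gt0// (le_lt_trans rm)//.
    by rewrite -exprnP ltr_eXn2l// q_gt1.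
  have /n_min : Pn n by apply/asboolP; rewrite (_ : _ - _ = n.+1%:Z - m.+1%:Z - 1)//; lia.
  by rewrite ltnn.
exists (n%:Z - m.+1%:Z); split=> // f; split=> [fr|].
  by rewrite -labs_lt (lt_le_trans fr).
have [->|f0] := eqVneq f 0; first by rewrite labs0.
have [A [fA hA]] := laurent_lead f0.
move=> h; rewrite (labsE fA hA) (le_lt_trans _ rlt)// ler_eXz2l ?q_gt1//.
suff : ~~ (n%:Z - m.+1%:Z <= A) by lia.
by apply: contra fA => /h ->.
Qed.

(** Numerators of any degree may be used. If P is not reduced modulo [Q] and f lies in L, then |f Q
    - P| is at least |Q|, while the reduced numerator stays below |Q|. *)
Lemma approx_setE (Psi : {poly F} -> R) Q f : Q != 0 ->
  approx_set Psi Q f <->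
  lball 0 f /\ exists2 P, coprimep P Q & labs (f * iota Q - iota P) < Psi Q.
Proof.
move=> Q0; have iQ : 0 < labs (iota Q) by rewrite labs_poly// qz_gt0.
have iQ0 : iota Q != 0 by apply: contraTneq iQ => ->; rewrite labs0 ltxx.
have quo P : labs (f - iota P / iota Q) < Psi Q / labs (iota Q) =
    (labs (f * iota Q - iota P) < Psi Q).
  by rewrite ltr_pdivlMr// -labsM mulrBl divfK.
split=> [[P [sP cP] [fL]]|[fL [P cP fP]]].
  by rewrite quo => fP; split; [exact/ldeg_lt|exists P].
have h1 : lball (pdeg Q)%:Z (f * iota Q - iota (P %% Q)).
  apply: lballB; last by apply/lball_poly; exact: size_modp_pred.
  by rewrite mulrC -[_%:Z]add0r (lballM_labs _ _ (labs_poly Q0)).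
exists (P %% Q); first by split; [rewrite /= ltn_modp|rewrite coprimep_modpl].
split; first exact/ldeg_lt.
rewrite quo; have [A0|A0] := eqVneq (P %/ Q) 0.
  by move: fP; rewrite {1}(divp_eq P Q) A0 mul0r add0r.
apply: le_lt_trans fP; rewrite leNgt; apply/negP => lt1.
have : lball (pdeg Q)%:Z (f * iota Q - iota P).
  by rewrite -(labs_lt _ (pdeg Q)%:Z); apply: (lt_trans lt1); exact/labs_lt.
move=> /(lballB h1).
rewrite opprB addrC addrA subrK {1}(divp_eq P Q) rmorphD/= addrK.
rewrite lball_poly; apply/negP; rewrite -ltnNge size_pdeg ?mulf_neq0//.
by rewrite pdegM// ltnS leq_addl.
Qed.

End LaurentBall.

(** * Balls generate the Borel sets *)

Section LaurentMeasurable.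
Variable F : finFieldType.
Implicit Types (f g h c : laurent F) (P Q E : {poly F}) (k m n : int).
Local Notation iota := (@laurent_of_poly F).
Local Notation X := (iota 'X).

Definition cball c k : set (laurent F) := [set f | lball k (f - c)].

Lemma lballX (m : nat) k f : lball (k + m%:Z) (X ^+ m * f) <-> lball k f.
Proof.
rewrite -rmorphXn; apply: lballM.
  by rewrite lcoef_poly coefXn eqxx oner_neq0.
by move=> [n|//] mn; rewrite lcoef_poly coefXn; case: eqP => //; lia.
Qed.

Lemma cball_open c k : open (cball c k).
Proof.
move=> f fc; exists k => g; rewrite ldeg_lt => gf.
by rewrite /cball/= -(subrKA f); apply: lballD.
Qed.

Lemma measurable_open (U : set (laurent F)) : open U -> measurable U.
Proof. exact: (@sub_sigma_algebra _ setT [set V : set (laurent F) | open V]). Qed.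

Lemma measurable_cball c k : measurable (cball c k).
Proof. by apply: measurable_open; exact: cball_open. Qed.

Lemma measurable_lball k : measurable (@lball F k).
Proof.
have -> : lball k = cball 0 k by apply/seteqP; split=> f; rewrite /cball/= subr0.
exact: measurable_cball.
Qed.

Definition cballs : set (set (laurent F)) :=
  [set B | exists c, exists k, B = cball c k].

(** Second countability: an open set is the union of the balls of radius q^-m around P / X^m that it
    contains, and the pairs (m, P) are countable. *)
Lemma measurable_laurentE : @measurable _ (laurent F) = <<s cballs >>.
Proof.
apply/seteqP; split; apply: smallest_sub.
- exact: smallest_sigma_algebra.
- move=> U oU.
  pose B (z : nat * {poly F}) := cball (iota z.2 / X ^+ z.1) (- z.1%:Z).
  pose G z := if `[< B z `<=` U >] then B z else set0.
  have -> : U = \bigcup_z G z.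
    apply/seteqP; split=> [f Uf|f [z _]]; last by rewrite /G; case: asboolP => // BU /BU.
    have [n Un] := oU f Uf.
    pose j := `|n|%N; pose z := (j, lfloor (X ^+ j * f)).
    have fB : B z f.
      rewrite /B /cball/= -(lballX j) addNr mulrBr mulrCA divff ?mulr1.
        exact: lfloorP.
      by rewrite expf_neq0// laurent_of_poly_neq0// polyX_eq0.
    exists z => //; rewrite /G ifT//; apply/asboolP => g gB.
    apply: Un; apply/ldeg_lt; apply: (@lballW _ (- j%:Z)); first by rewrite /j; lia.
    rewrite -(subrKA (iota z.2 / X ^+ z.1)); apply: lballD => //.
    by rewrite -opprB; exact: lballN.
  apply: (@countable_bigcupT_measurable _ (g_sigma_algebraType cballs)).
    exact: countableP.
  move=> z; rewrite /G; case: ifP => _; last exact: measurable0.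
  by apply: sub_sigma_algebra; exists (iota z.2 / X ^+ z.1), (- z.1%:Z).
- exact: smallest_sigma_algebra.
- by move=> _ [c [k ->]]; exact: measurable_cball.
Qed.

Definition lmono_coef (a : F) k : int -> F := fun n => if n == k then a else 0.

Lemma lmono_bounded (a : F) k : lmono_coef a k \in @bounded_above F.
Proof.
by apply/bounded_aboveP; exists k => n kn; rewrite /lmono_coef gt_eqF.
Qed.

Definition lmono (a : F) k : laurent F := Laurent (lmono_bounded a k).

Lemma lball_mono k f (a : F) : lball (k + 1) f -> lball k (f - lmono a k) <-> a = f k.
Proof.
move=> hf; split=> [/(_ k)|->].
  rewrite lcoefB /= /lmono_coef eqxx lexx => /(_ isT) /eqP.
  by rewrite subr_eq0 => /eqP.
move=> n kn; rewrite lcoefB/= /lmono_coef; case: eqP => [->|nk]; first by rewrite subrr.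
by rewrite subr0 hf//; lia.
Qed.

Lemma lball_mono_self k (a : F) : lball (k + 1) (lmono a k).
Proof. by move=> n kn; rewrite /= /lmono_coef ifF//; lia. Qed.

End LaurentMeasurable.

Section FiniteUnions.
Context d (T : measurableType d) (R : realType) (mu : {measure set T -> \bar R}).
Variable I : finType.
Local Open Scope ereal_scope.

Lemma fsbig_finType (P : pred I) (f : I -> \bar R) :
  \sum_(i \in [set i | P i]) f i = \sum_(i | P i) f i.
Proof.
rewrite (@fsbigE _ _ _ _ _ (enum P)) ?enum_uniq//=.
- rewrite big_enum_cond/=; apply: eq_bigl => i.
  by apply/andP/idP => [[]//|Pi]; split=> //; rewrite mem_setE.
- by move=> i/=; rewrite mem_enum.
- by move=> i Pi; rewrite mem_enum /in_mem/= Pi.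
Qed.

Lemma measure_finType (P : pred I) (A : I -> set T) :
  (forall i, P i -> measurable (A i)) ->
  (forall i j x, P i -> P j -> A i x -> A j x -> i = j) ->
  mu (\bigcup_(i in [set i | P i]) A i) = \sum_(i | P i) mu (A i).
Proof.
move=> mA dA; rewrite (measure_fin_bigcup mu finite_finset) ?fsbig_finType//.
by move=> i j Pi Pj [x [Aix Ajx]]; exact: dA Aix Ajx.
Qed.

Lemma le_measure_finType (P : pred I) (A : I -> set T) (B : set T) :
  (forall i, P i -> measurable (A i)) -> measurable B ->
  B `<=` \bigcup_(i in [set i | P i]) A i -> mu B <= \sum_(i | P i) mu (A i).
Proof. by move=> mA mB BA; rewrite -fsbig_finType content_sub_fsum//; exact: finite_finset. Qed.

End FiniteUnions.

Section HaarBall.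
Variables (R : realType) (F : finFieldType) (nu : {measure set (laurent F) -> \bar R}).
Hypotheses (hnu : haar_measure nu) (hnu1 : nu (@open_unit_ball F) = 1%E).
Local Notation q := (#|F|%:R : R).
Local Open Scope ereal_scope.

Lemma haar_cball c k : nu (cball c k) = nu (@lball F k).
Proof.
have [inv _ _] := hnu; rewrite -(inv c _ (measurable_lball _)).
congr (nu _); apply/seteqP; split=> [f fc|_ [g kg <-]].
  by exists (f - c)%R => //; rewrite addrC subrK.
by rewrite /cball/= addrC addKr.
Qed.

(** The larger ball is the disjoint union of the q translates of the smaller one by the monomials a
    X^k. *)
Lemma haar_lballS k : nu (@lball F (k + 1)) = q%:E * nu (@lball F k).
Proof.
have -> : @lball F (k + 1) = \bigcup_(a in [set a : F | xpredT a]) cball (lmono a k) k.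
  apply/seteqP; split=> [f kf|f [a _ fa]]; first by exists (f k) => //; exact/lball_mono.
  rewrite -(subrK (lmono a k) f); apply: lballD; last exact: lball_mono_self.
  by apply: lballW fa; rewrite lerDl.
rewrite (measure_finType nu (P := xpredT)).
- rewrite (eq_bigr (fun=> nu (@lball F k))) => [|a _]; last exact: haar_cball.
  by rewrite sumr_const mule_natl.
- by move=> a _; exact: measurable_cball.
- move=> a b f _ _ fa fb.
  have kf : lball (k + 1) f.
    rewrite -(subrK (lmono a k) f); apply: lballD; last exact: lball_mono_self.
    by apply: lballW fa; rewrite lerDl.
  by rewrite (lball_mono a kf).1// (lball_mono b kf).1.
Qed.

Lemma haar_lball k : nu (@lball F k) = (q ^ k)%:E.
Proof.
have q0 := q_neq0 F R.
have h0 : nu (@lball F 0) = 1.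
  rewrite -hnu1; congr (nu _); apply/seteqP.
  by split=> f; rewrite /open_unit_ball/= ldeg_lt.
have hS (n : nat) : nu (@lball F n%:Z) = (q ^+ n)%:E.
  elim: n => [|n IH]; first by rewrite h0.
  by rewrite -addn1 PoszD haar_lballS IH -EFinM -exprS addn1.
have hN (n : nat) : nu (@lball F (- n%:Z)) = (q ^- n)%:E.
  elim: n => [|n IH]; first by rewrite oppr0 h0 invr1.
  have := haar_lballS (- n.+1%:Z); rewrite (_ : - n.+1%:Z + 1 = - n%:Z)%R; last by lia.
  rewrite IH => /(congr1 (fun x => (q^-1)%:E * x)).
  by rewrite muleA -!EFinM mulVf// mul1e exprS invfM => <-.
by case: k => n; [exact: hS|rewrite NegzE hN -exprnN].
Qed.

End HaarBall.

(** * The product measure on cylinders *)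

Section Cylinders.
Variables (F : finFieldType) (d : nat).
Implicit Types (f g h c : laurent F) (P Q E : {poly F}).
Local Notation iota := (@laurent_of_poly F).
Local Notation X := (iota 'X).
Local Notation T := (d.-tuple (laurent F)).
Implicit Types (x y : T) (m k : nat).

Lemma X_neq0 : X != 0.
Proof. by rewrite laurent_of_poly_neq0// polyX_eq0. Qed.

Lemma measurable_box (A : 'I_d -> set (laurent F)) :
  (forall i, measurable (A i)) -> measurable [set x : T | forall i, A i (tnth x i)].
Proof.
move=> mA.
have -> : [set x : T | forall i, A i (tnth x i)] =
    ~` \bigcup_i [set x | (~` A i) (tnth x i)].
  apply/seteqP; split=> [x xA [i _ nA]|x xA i]; first exact: nA (xA i).
  by apply: contrapT => nA; apply: xA; exists i.
apply: measurableC; apply: countable_bigcupT_measurable; first exact: countableP.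
move=> i; rewrite -[X in measurable X]setTI.
by apply: (measurable_tnth i) => //; exact: measurableC.
Qed.

Definition unit_cube : set T := [set x | forall i, lball 0 (tnth x i)].

Lemma measurable_unit_cube : measurable unit_cube.
Proof. by apply: (@measurable_box (fun=> @lball F 0)) => i; exact: measurable_lball. Qed.

(* In each coordinate the ball a_i / X^m + X^-m L; these partition L^d for a given level m. *)
Definition cyl m (a : {ffun 'I_d -> {poly_m F}}) : set T :=
  [set x | forall i, lball 0 (X ^+ m * tnth x i - iota (a i))].

Lemma lballX_ball m f c : lball 0 (X ^+ m * f - c) <-> cball (c / X ^+ m) (- m%:Z) f.
Proof.
rewrite /cball/= -(lballX m (- m%:Z)) addNr mulrBr [in X in _ <-> X]mulrCA divff ?mulr1//.
by rewrite expf_neq0// X_neq0.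
Qed.

Lemma measurable_cyl m (a : {ffun 'I_d -> {poly_m F}}) : measurable (cyl a).
Proof.
have -> : cyl a = [set x | forall i, cball (iota (a i) / X ^+ m) (- m%:Z) (tnth x i)].
  by apply/seteqP; split=> x xa i; apply/lballX_ball; exact: xa.
by apply: (@measurable_box (fun i => cball _ _)) => i; exact: measurable_cball.
Qed.

Lemma cyl_unit_cube m (a : {ffun 'I_d -> {poly_m F}}) : cyl a `<=` unit_cube.
Proof.
move=> x xa i; rewrite -(lballX m) add0r -(subrK (iota (a i)) (X ^+ m * _)).
apply: lballD; first by apply: lballW (xa i).
by apply/lball_poly; exact: size_npoly.
Qed.

Definition cyl_of m x : {ffun 'I_d -> {poly_m F}} :=
  [ffun i => npolyp m (lfloor (X ^+ m * tnth x i))].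

Lemma cyl_ofP m x : unit_cube x -> cyl (cyl_of m x) x.
Proof.
move=> xU i; rewrite ffunE; have fP := lfloorP (X ^+ m * tnth x i).
rewrite npolypK//; apply/lball_poly.
rewrite -(subrK (X ^+ m * tnth x i) (iota _)); apply: lballD.
  by rewrite -opprB; apply: lballN; apply: lballW fP.
by rewrite -[m%:Z]add0r lballX; exact: xU.
Qed.

Lemma cyl_inj m (a b : {ffun 'I_d -> {poly_m F}}) x : cyl a x -> cyl b x -> a = b.
Proof.
move=> xa xb; apply/ffunP => i; apply/val_inj/eqP; rewrite -subr_eq0 /=; apply/eqP.
apply: lball_poly0; rewrite rmorphB/=.
have := lballB (xb i) (xa i); rewrite opprB addrC addrA subrK.
by [].
Qed.

(** By the ultrametric inequality cylinders that meet are nested; this makes [cube_traces] stable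
    under intersection. *)
Lemma cyl_sub m m' (a : {ffun 'I_d -> {poly_m F}}) (b : {ffun 'I_d -> {poly_m' F}}) x :
  (m <= m')%N -> cyl a x -> cyl b x -> cyl b `<=` cyl a.
Proof.
move=> mm' xa xb y yb i; rewrite (_ : _ - _ = (X ^+ m * tnth x i - iota (a i)) -
   X ^+ m * (tnth x i - tnth y i)); last by rewrite mulrBr; ring.
apply: lballB; first exact: xa.
rewrite -[0](addNr m%:Z) lballX; apply: (@lballW _ (- m'%:Z)); first by lia.
rewrite -(lballX m') addNr mulrBr.
rewrite (_ : _ - _ = (X ^+ m' * tnth x i - iota (b i)) -
  (X ^+ m' * tnth y i - iota (b i))); last by ring.
by apply: lballB; [exact: xb|exact: yb].
Qed.

Lemma cyl_diff m (a : {ffun 'I_d -> {poly_m F}}) x y i : cyl a x -> cyl a y ->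
  lball (- m%:Z) (tnth y i - tnth x i).
Proof.
move=> xa ya; rewrite -(lballX m) addNr.
rewrite (_ : _ * _ = (X ^+ m * tnth y i - iota (a i)) -
  (X ^+ m * tnth x i - iota (a i))); last by ring.
by apply: lballB; [exact: ya|exact: xa].
Qed.

(* Only the trace on the unit cube is prescribed: in this way the sigma-algebra generated on the whole
   space is the product one. *)
Definition cube_traces : set (set T) :=
  [set Y | measurable Y /\ (Y `&` unit_cube = set0 \/
     exists m (a : {ffun 'I_d -> {poly_m F}}), Y `&` unit_cube = cyl a)].

Lemma cyl0E (a : {ffun 'I_d -> {poly_0 F}}) : cyl a = unit_cube.
Proof.
apply/seteqP; split; first exact: cyl_unit_cube.
move=> x xU; have := cyl_ofP 0 xU; congr (cyl _ x); apply/ffunP => i; apply/val_inj.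
have z (p : {poly_0 F}) : (p : {poly F}) = 0.
  by apply/eqP; rewrite -size_poly_eq0 -leqn0 size_npoly.
by rewrite /= !z.
Qed.

Lemma setI_closed_cube_traces : setI_closed cube_traces.
Proof.
move=> Y Z [mY tY] [mZ tZ]; split; first exact: measurableI.
have -> : Y `&` Z `&` unit_cube = (Y `&` unit_cube) `&` (Z `&` unit_cube).
  by rewrite setIACA setIid.
case: tY => [->|[m [a ->]]]; first by rewrite set0I; left.
case: tZ => [->|[m' [b ->]]]; first by rewrite setI0; left.
have [->|/set0P[x [xa xb]]] := eqVneq (cyl a `&` cyl b) set0; first by left.
right; case: (leqP m m') => mm'.
  exists m', b; apply/setIidPr; exact: cyl_sub xa xb.
exists m, a; apply/setIidPl; apply: cyl_sub xb xa; exact: ltnW.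
Qed.

(** It is enough that the coordinates are measurable for the generated sigma-algebra. The preimage
    of a ball splits into a part outside the cube, whose trace is empty, and a finite union of
    cylinders. *)
Lemma sigma_cube_traces (V : set T) : measurable V -> <<s cube_traces >> V.
Proof.
suff mtnth i : measurable_fun setT
    (fun x : g_sigma_algebraType cube_traces => tnth (x : T) i).
  move: V; apply: smallest_sub; first exact: smallest_sigma_algebra.
  move=> V; rewrite -bigcup_seq/= => -[i _ [B mB <-]].
  exact: (mtnth i measurableT B mB).
apply: (@measurability _ _ _ _ _ _ (@cballs F)); first exact: measurable_laurentE.
move=> _ [_ [c [k ->]] <-]; rewrite setTI.
set Y := (Y in measurable Y).
have mY : measurable (Y : set T).
  by rewrite -[X in measurable X]setTI; apply: measurable_tnth => //; exact: measurable_cball.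
(* This level gives q^-m <= q^k, so a cylinder that meets the preimage lies inside it. *)
pose m := `|k|%N.
have -> : Y = (Y `\` unit_cube) `|` \bigcup_(a in [set a : {ffun 'I_d -> {poly_m F}} | cyl a `<=` Y]) cyl a.
  apply/seteqP; split=> x; last by move=> [[]//|[a aY] /aY].
  move=> Yx; case: (pselect (unit_cube x)) => [xU|]; last by left.
  right; exists (cyl_of m x); last exact: cyl_ofP.
  move=> y ya; rewrite /Y/= /cball/= -(subrKA (tnth x i)); apply: lballD => //.
  by apply: lballW (cyl_diff _ (cyl_ofP m xU) ya); rewrite /m; lia.
apply: measurableU.
  apply: sub_sigma_algebra; split; last by left; rewrite setDE -setIA setICl setI0.
  by apply: measurableD => //; exact: measurable_unit_cube.
apply: fin_bigcup_measurable => [|a _]; first exact: finite_finset.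
apply: sub_sigma_algebra; split; first exact: measurable_cyl.
right; exists m, a; apply/setIidPl; exact: cyl_unit_cube.
Qed.

(** Uniqueness of finite measures on an intersection-stable generator, applied to the restrictions
    of both measures to the cube. *)
Lemma cyl_measure_unique (R : realType) (mu1 mu2 : {measure set T -> \bar R}) :
  (mu1 unit_cube < +oo)%E ->
  (forall m (a : {ffun 'I_d -> {poly_m F}}), mu1 (cyl a) = mu2 (cyl a)) ->
  forall V, measurable V -> V `<=` unit_cube -> mu1 V = mu2 V.
Proof.
move=> fin_mu1 mu12 V mV VU.
have mU := measurable_unit_cube.
have VE (mu : {measure set T -> \bar R}) : mrestr mu mU V = mu V.
  by rewrite /mrestr (setIidl VU).
rewrite -(VE mu1) -(VE mu2).
apply: (@g_sigma_algebra_measure_unique _ R T cube_traces _ (fun=> setT) _ _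
  _ _ setI_closed_cube_traces) => //; last exact: sigma_cube_traces.
- by move=> Y [].
- move=> _; split; first exact: measurableT.
  right; exists 0%N, [ffun=> 0]; rewrite setTI cyl0E//.
- by apply/seteqP; split=> // x _; exists 0%N.
- move=> Y [mY [Ya|[m [a Ya]]]]; rewrite /= /mrestr Ya; last exact: mu12.
  by rewrite !measure0.
- by move=> _; rewrite /= /mrestr setTI.
Qed.

End Cylinders.

(** * Affine maps and a zero-one criterion *)

Section ProductMeasure.
Variables (R : realType) (F : finFieldType) (d : nat).
Variables (nu : {measure set (laurent F) -> \bar R})
  (nud : {measure set (d.-tuple (laurent F)) -> \bar R}).
Hypotheses (hnu : haar_measure nu) (hnu1 : nu (@open_unit_ball F) = 1%E)
  (hnud : product_measure_of nu nud).
Local Notation iota := (@laurent_of_poly F).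
Local Notation X := (iota 'X).
Local Notation T := (d.-tuple (laurent F)).
Local Notation q := (#|F|%:R : R).
Local Notation cube := (@unit_cube F d).
Implicit Types (V A : set T) (M : {poly F}).

Lemma nud_box (c : 'I_d -> laurent F) (k : int) :
  nud [set x | forall i, cball (c i) k (tnth x i)] = ((q ^ k) ^+ d)%:E.
Proof.
rewrite (hnud (A := fun i => cball (c i) k)) => [|i]; last exact: measurable_cball.
rewrite (eq_bigr (fun=> (q ^ k)%:E)) => [|i _]; last by rewrite haar_cball// haar_lball.
by rewrite prodEFin prodr_const card_ord.
Qed.

Lemma nud_cyl (m : nat) (a : {ffun 'I_d -> {poly_m F}}) :
  nud (cyl a) = ((q ^- m) ^+ d)%:E.
Proof.
rewrite exprnN -(nud_box (fun i => iota (a i) / X ^+ m)); congr (nud _).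
by apply/seteqP; split=> x xa i; apply/lballX_ball; exact: xa.
Qed.

Lemma nud_cube : nud cube = 1%E.
Proof.
by rewrite -(cyl0E [ffun=> 0]) nud_cyl expr0 invr1 expr1n.
Qed.

Lemma nud_le1 V : measurable V -> V `<=` cube -> (nud V <= 1)%E.
Proof.
move=> mV VU; rewrite -nud_cube; apply: le_measure => //; rewrite inE//.
exact: measurable_unit_cube.
Qed.

Lemma nud_fin V : measurable V -> V `<=` cube -> nud V \is a fin_num.
Proof.
move=> mV VU; rewrite ge0_fin_numE//; apply: le_lt_trans (nud_le1 mV VU) _.
exact: ltry.
Qed.

Definition aff M (b : 'I_d -> laurent F) (x : T) : T :=
  [tuple iota M * tnth x i + b i | i < d].

Lemma lballM_poly M (k : int) (f : laurent F) : M != 0 ->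
  lball (k + (pdeg M)%:Z) (iota M * f) <-> lball k f.
Proof.
move=> M0; apply: lballM.
  by rewrite lcoef_poly -[M`__]/(lead_coef M) lead_coef_eq0.
by move=> [n|//] Mn; rewrite lcoef_poly nth_default// size_pdeg.
Qed.

Lemma cball_aff M b (k : int) c x i : M != 0 ->
  cball c (k + (pdeg M)%:Z) (tnth (aff M b x) i) <->
  cball ((c - b i) / iota M) k (tnth x i).
Proof.
move=> M0; rewrite /cball/= tnth_mktuple -(lballM_poly k _ M0).
rewrite mulrBr (mulrC _ ((c - b i) / _)) divfK; last exact: laurent_of_poly_neq0.
by rewrite opprB addrA addrAC.
Qed.

Lemma measurable_aff M b : M != 0 -> measurable_fun setT (aff M b).
Proof.
move=> M0; apply/measurable_fun_tnthP => i.
apply: (@measurability _ _ _ _ _ _ (@cballs F)); first exact: measurable_laurentE.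
move=> _ [_ [c [k ->]] <-]; rewrite setTI.
have -> : ((fun x : T => tnth x i) \o aff M b) @^-1` cball c k =
    (fun x : T => tnth x i) @^-1` cball ((c - b i) / iota M) (k - (pdeg M)%:Z).
  by apply/seteqP; split=> x; rewrite /= -cball_aff// subrK.
rewrite -[X in measurable X]setTI; apply: measurable_tnth => //.
exact: measurable_cball.
Qed.

Lemma aff_cyl M b (m : nat) (a : {ffun 'I_d -> {poly_m F}}) : M != 0 ->
  aff M b @^-1` cyl a = [set x | forall i,
    cball ((iota (a i) / X ^+ m - b i) / iota M) (- m%:Z - (pdeg M)%:Z) (tnth x i)].
Proof.
move=> M0; apply/seteqP; split=> x xa i.
  by apply/cball_aff => //; rewrite subrK; apply/lballX_ball; exact: xa.
apply/lballX_ball; rewrite -[- m%:Z](subrK (pdeg M)%:Z).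
by apply/cball_aff => //; exact: xa.
Qed.

(** The preimage of a cylinder is a box whose sides are shorter by the factor |M|. The pushforward
    and the scaled measure thus agree on cylinders, hence on all measurable subsets of the cube. *)
Lemma nud_aff M b V : M != 0 -> measurable V -> V `<=` cube ->
  nud (aff M b @^-1` V) = (((q ^- pdeg M) ^+ d)%:E * nud V)%E.
Proof.
move=> M0 mV VU; have mM := measurable_aff b M0.
have K0 : 0 <= (q ^- pdeg M) ^+ d :> R by rewrite exprn_ge0// invr_ge0 ltW// qX_gt0.
have nud_aff_cyl (m : nat) (a : {ffun 'I_d -> {poly_m F}}) :
    nud (aff M b @^-1` cyl a) = (((q ^- pdeg M) ^+ d)%:E * nud (cyl a))%E.
  rewrite aff_cyl// nud_box nud_cyl -EFinM -exprMn; congr (_ ^+ _)%:E.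
  by rewrite expfzDr ?q_neq0// !exprnN mulrC.
have := @cyl_measure_unique F d R (pushforward nud (aff M b)) (mscale (NngNum K0) nud).
rewrite /pushforward/mscale/=; apply => //.
rewrite /pushforward -(cyl0E [ffun=> 0]) nud_aff_cyl nud_cyl -EFinM; exact: ltry.
Qed.

Lemma sum_cyl A (m : nat) : measurable A -> A `<=` cube ->
  nud A = (\sum_(a : {ffun 'I_d -> {poly_m F}}) nud (A `&` cyl a))%E.
Proof.
move=> mA AU; rewrite -(measure_finType nud (P := xpredT)).
- congr (nud _); apply/seteqP; split=> x; last by move=> [a _ []].
  by move=> Ax; exists (cyl_of m x) => //; split => //; apply: cyl_ofP; exact: AU.
- by move=> a _; apply: measurableI => //; exact: measurable_cyl.
- by move=> a b x _ _ [_ xa] [_ xb]; exact: cyl_inj xa xb.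
Qed.

Lemma card_cyl (m : nat) : #|{ffun 'I_d -> {poly_m F}}| = ((#|F| ^ m) ^ d)%N.
Proof. by rewrite card_ffun card_ord card_npoly. Qed.

(* Summing over the cylinders of a given level turns the inequalities into equalities: A is independent
   of all cylinders, hence of itself. *)
Lemma nud_zero_one A : measurable A -> A `<=` cube ->
  (forall m (a : {ffun 'I_d -> {poly_m F}}),
     (nud A * nud (cyl a) <= nud (A `&` cyl a))%E) ->
  nud A = 0%E \/ nud A = 1%E.
Proof.
move=> mA AU Acyl; have fA := nud_fin mA AU.
have mI (m : nat) (a : {ffun 'I_d -> {poly_m F}}) : measurable (A `&` cyl a).
  by apply: measurableI => //; exact: measurable_cyl.
have fI (m : nat) (a : {ffun 'I_d -> {poly_m F}}) : nud (A `&` cyl a) \is a fin_num.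
  by apply: nud_fin => // x [/AU].
pose al := fine (nud A); have al0 : 0 <= al by rewrite fine_ge0.
have alE : nud A = al%:E by rewrite fineK.
have Acyl_eq (m : nat) (a : {ffun 'I_d -> {poly_m F}}) :
    nud (A `&` cyl a) = (al%:E * nud (cyl a))%E.
  pose ka : R := (q ^- m) ^+ d.
  pose f (c : {ffun 'I_d -> {poly_m F}}) := fine (nud (A `&` cyl c)) - al * ka.
  have f0 c : 0 <= f c.
    have := Acyl m c; rewrite nud_cyl alE -EFinM -[leRHS]fineK// lee_fin.
    by rewrite subr_ge0.
  have sf : \sum_c f c = 0.
    rewrite sumrB sumr_const card_cyl -mulr_natr -mulrA.
    rewrite (_ : ka * _ = 1) ?mulr1; last first.
      by rewrite /ka natrX -exprMn natrX mulVf ?expr1n// gt_eqF// qX_gt0.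
    apply/eqP; rewrite subr_eq0; apply/eqP/EFin_inj.
    rewrite -sumEFin -alE (sum_cyl m mA AU); apply: eq_bigr => c _.
    by rewrite fineK.
  have /eqP := sf; rewrite psumr_eq0// => /allP /(_ a).
  rewrite mem_index_enum => /(_ isT)/= /eqP /eqP; rewrite subr_eq0 => /eqP fa.
  by rewrite nud_cyl -EFinM -fa fineK.
(* Independence passes from the cylinders to all measurable subsets of the cube; for A itself it
   reads al = al^2. *)
have : mrestr nud mA A = mscale (NngNum al0) nud A.
  apply: cyl_measure_unique => // [|m a]; rewrite /= /mrestr /mscale/=.
    by rewrite setIC (setIidl AU) alE ltry.
  by rewrite setIC.
rewrite /mrestr /mscale/= setIid alE.
rewrite -EFinM => -[] /eqP; rewrite -subr_eq0 -{1}[al]mulr1 -mulrBr mulf_eq0.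
by rewrite subr_eq0 => /orP[/eqP->|/eqP <-]; [left|right].
Qed.

End ProductMeasure.

(** * The measure of the approximation sets *)

Section ApproxMeasure.
Variables (R : realType) (F : finFieldType) (d : nat).
Variables (nu : {measure set (laurent F) -> \bar R})
  (nud : {measure set (d.-tuple (laurent F)) -> \bar R}).
Hypotheses (hnu : haar_measure nu) (hnu1 : nu (@open_unit_ball F) = 1%E)
  (hnud : product_measure_of nu nud).
Local Notation iota := (@laurent_of_poly F).
Local Notation q := (#|F|%:R : R).
Implicit Types (Psi : {poly F} -> R) (P Q : {poly F}).

Lemma lball_frac Q (P : {poly_(pdeg Q) F}) : Q != 0 -> lball 0 (iota P / iota Q).
Proof.
move=> Q0; rewrite -(lballM_poly _ _ Q0) add0r mulrCA divff ?laurent_of_poly_neq0//.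
by rewrite mulr1; apply/lball_poly; exact: size_npoly.
Qed.

Lemma approx_set_ball Psi Q : Q != 0 -> 0 < Psi Q ->
  exists k : int, [/\ q ^ (k - 1) < Psi Q / labs R (iota Q),
    Psi Q / labs R (iota Q) <= q ^ k &
    approx_set Psi Q = \bigcup_(P in [set P : {poly_(pdeg Q) F} | coprimep (P : {poly F}) Q])
      (@lball F 0 `&` cball (iota P / iota Q) k)].
Proof.
move=> Q0 Psi0.
have r0 : 0 < Psi Q / labs R (iota Q).
  by rewrite divr_gt0// labs_gt0// laurent_of_poly_neq0.
have [k [k1 k2 kP]] := exists_lball F r0; exists k; split=> //.
apply/seteqP; split=> f.
  move=> [P [sP cP] [fL /kP fP]].
  have sP' : (size P <= pdeg Q)%N by rewrite -ltnS -size_pdeg.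
  by exists (NPoly sP') => //; split=> //; exact/ldeg_lt.
move=> [P cP [fL fP]]; exists (P : {poly F}).
  by split=> //=; rewrite (size_pdeg Q0) ltnS size_npoly.
by split; [exact/ldeg_lt|exact/kP].
Qed.

Lemma approx_set_eq0 Psi Q : Psi Q <= 0 -> approx_set Psi Q = set0.
Proof.
move=> Psi0; apply/seteqP; split=> // f [P _ [_]].
apply/negP; rewrite -leNgt (le_trans _ (labs_ge0 _ _))//.
by rewrite mulr_le0_ge0// invr_ge0 labs_ge0.
Qed.

Lemma measurable_approx_set Psi Q : Q != 0 -> measurable (approx_set Psi Q).
Proof.
move=> Q0; have [Psi0|Psi0] := leP (Psi Q) 0.
  by rewrite approx_set_eq0//; exact: measurable0.
have [k [_ _ ->]] := approx_set_ball Q0 Psi0.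
apply: fin_bigcup_measurable => [|P _]; first exact: finite_finset.
by apply: measurableI; [exact: measurable_lball|exact: measurable_cball].
Qed.

Lemma approx_set_lball Psi Q : approx_set Psi Q `<=` @lball F 0.
Proof. by move=> f [P _ [fL _]]; exact/ldeg_lt. Qed.

Lemma approx_pow_cube Psi Q : approx_pow d Psi Q `<=` @unit_cube F d.
Proof. by move=> x xQ i; exact: approx_set_lball (xQ i). Qed.

Lemma measurable_approx_pow Psi Q : Q != 0 -> measurable (approx_pow d Psi Q).
Proof.
move=> Q0; apply: (@measurable_box F d (fun=> approx_set Psi Q)) => i.
exact: measurable_approx_set.
Qed.

(** One residue is kept per block. If two of the balls met, their numerators would differ by less
    than q^h and lie in one block. The condition [k <= 0] keeps the balls inside L. *)
Lemma approx_blocks_le Psi Q (k : int) (h : nat) : Q != 0 -> k <= 0 ->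
  k + (pdeg Q)%:Z <= h%:Z ->
  approx_set Psi Q = \bigcup_(P in [set P : {poly_(pdeg Q) F} | coprimep (P : {poly F}) Q])
      (@lball F 0 `&` cball (iota P / iota Q) k) ->
  ((#|trunc_div h @: coprime_set Q|%:R * q ^ k)%:E <= nu (approx_set Psi Q))%E.
Proof.
move=> Q0 k0 kh kE; have iQ0 := laurent_of_poly_neq0 Q0.
pose n := pdeg Q.
pose rep (B : {poly_n F}) := odflt 0 [pick P in coprime_set Q | trunc_div h P == B].
have repP B : B \in trunc_div h @: coprime_set Q ->
    rep B \in coprime_set Q /\ trunc_div h (rep B) = B.
  move=> /imsetP[P PQ ->]; rewrite /rep; case: pickP => [P' /andP[P'Q /eqP]//|].
  by move=> /(_ P); rewrite /= PQ eqxx.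
pose A B := cball (iota (rep B) / iota Q) k.
have <- : nu (\bigcup_(B in [set B | B \in trunc_div h @: coprime_set Q]) A B) =
    (#|trunc_div h @: coprime_set Q|%:R * q ^ k)%:E.
  rewrite (measure_finType nu (P := fun B => B \in trunc_div h @: coprime_set Q)).
  - rewrite (eq_bigr (fun=> (q ^ k)%:E)) => [|B _]; last first.
      by rewrite haar_cball// haar_lball.
    by rewrite sumEFin sumr_const mulr_natl.
  - by move=> B _; exact: measurable_cball.
  - move=> B B' f /repP[_ BE] /repP[_ B'E] fB fB'.
    apply/val_inj => /=; rewrite -BE -B'E !trunc_divE.
    have : lball h%:Z (iota (rep B' - rep B)).
      rewrite rmorphB/=; apply: lballW kh _.
      have -> : iota (rep B') - iota (rep B) =
          iota Q * ((f - iota (rep B) / iota Q) - (f - iota (rep B') / iota Q)).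
        by field.
      by apply/lballM_poly => //; exact: lballB.
    rewrite lball_poly -ltnS -(size_polyXn F h) => /divp_small D0.
    by rewrite -[RHS](subrK ((rep B : {poly F}) %/ 'X^h)) -divpN -divpD D0 add0r.
apply: le_measure; rewrite ?inE.
- by apply: fin_bigcup_measurable => [|B _]; [exact: finite_finset|exact: measurable_cball].
- exact: measurable_approx_set.
- rewrite kE => f [B /repP[repQ _] fB]; exists (rep B); first by move: repQ; rewrite inE.
  split=> //; rewrite -(subrK (iota (rep B) / iota Q) f); apply: lballD.
    by apply: lballW fB.
  exact: lball_frac.
Qed.

Lemma card_trunc_div0 Q : #|trunc_div 0 @: coprime_set Q| = ptotient Q.
Proof.
rewrite card_in_imset ?card_coprime_set// => P P' _ _ /(congr1 val)/=.
by rewrite !trunc_divE expr0 !divp1 => /val_inj.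
Qed.

(** If [0 <= k], a single ball covers L. Otherwise let y be the sum of the measures of all the
    balls, overlaps counted repeatedly. Counting blocks gives the lower bound y / (1 + K y), where K
    is [Kq], and this is at least min(y, 1) / (1 + K). *)
Lemma haar_approx_ge Psi Q : Q != 0 -> 0 <= Psi Q ->
  ((Num.min (Psi Q * (ptotient Q)%:R / labs R (iota Q)) 1 / (1 + Kq F R))%:E
    <= nu (approx_set Psi Q))%E.
Proof.
move=> Q0; rewrite le_eqVlt => /predU1P[Psi0|Psi0].
  by rewrite -Psi0 !mul0r min_l ?ler01// mul0r.
have K0 := Kq_ge0 F R; have K1 : 0 < 1 + Kq F R by rewrite ltr_wpDr.
have [k [_ k2 kE]] := approx_set_ball Q0 Psi0.
have t0 : 0 < (ptotient Q)%:R :> R by rewrite ltr0n ptotient_gt0.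
have [k0|k0] := leP 0 k.
  suff -> : nu (approx_set Psi Q) = 1%E.
    rewrite lee_fin ler_pdivrMr// mul1r; apply: (@le_trans _ _ 1); last by rewrite lerDl.
    by rewrite ge_min lexx orbT.
  rewrite -[RHS](haar_lball hnu hnu1 0); congr (nu _); rewrite kE.
  apply/seteqP; split=> f; first by move=> [P _ []].
  move=> fL; have : (0 < #|coprime_set Q|)%N by rewrite card_coprime_set ptotient_gt0.
  move=> /card_gt0P[P]; rewrite inE => PQ; exists P => //; split=> //.
  by apply: lballW k0 _; apply: lballB => //; exact: lball_frac.
set x := Psi Q * _ / _.
pose y := (ptotient Q)%:R * q ^ k.
have xy : x <= y by rewrite /x mulrAC mulrC ler_pM2l.
have y0 : 0 <= y by rewrite mulr_ge0// ltW// qz_gt0.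
have [h kh BK] : exists2 h : nat, k + (pdeg Q)%:Z <= h%:Z &
    y <= #|trunc_div h @: coprime_set Q|%:R * q ^ k * (1 + Kq F R * y).
  (* For k + deg Q < 0 the balls are disjoint: h = 0 puts each residue in a block of its own.
     Otherwise h = k + deg Q. *)
  have [kn|kn] := leP 0 (k + (pdeg Q)%:Z); last first.
    exists 0%N; first exact: ltW.
    by rewrite card_trunc_div0 -/y ler_peMr// lerDl mulr_ge0.
  have hE : (absz (k + (pdeg Q)%:Z) : int) = k + (pdeg Q)%:Z by lia.
  exists (absz (k + (pdeg Q)%:Z)); first by rewrite hE.
  have := card_blocks_ge R (absz (k + (pdeg Q)%:Z)) Q0.
  have -> : q ^+ absz (k + (pdeg Q)%:Z) = q ^ k * q ^+ pdeg Q.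
    by rewrite [LHS]exprnP hE expfzDr// q_neq0.
  move=> Bge; rewrite -(ler_pM2r (qX_gt0 F R (pdeg Q))) /y.
  move: Bge => /(ler_wpM2r (ltW (qz_gt0 F R k))) H.
  rewrite mulrAC; apply: (le_trans H).
  by rewrite le_eqVlt; apply/orP; left; apply/eqP; ring.
apply: le_trans (approx_blocks_le Q0 (ltW k0) kh kE); rewrite lee_fin.
rewrite ler_pdivrMr//.
apply: (@le_trans _ _ (Num.min y 1)); first by rewrite le_min !ge_min xy lexx orbT.
move: BK; set B : R := #|trunc_div h @: _|%:R => BK.
have B0 : 0 <= B * q ^ k by rewrite mulr_ge0 ?ler0n// ltW// qz_gt0.
have [y1|y1] := leP y 1.
  by apply: (le_trans BK); apply: ler_wpM2l => //; rewrite lerD2l ler_piMr.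
rewrite -(ler_pM2r (lt_trans ltr01 y1)) mul1r; apply: (le_trans BK).
rewrite -[leRHS]mulrA; apply: ler_wpM2l => //.
by rewrite mulrDl mul1r lerD2r ltW.
Qed.

(** Union bound; the factor q pays for rounding the radius up to a power of q. *)
Lemma haar_approx_le Psi Q : Q != 0 -> 0 <= Psi Q ->
  (nu (approx_set Psi Q) <= (q * (Psi Q * (ptotient Q)%:R / labs R (iota Q)))%:E)%E.
Proof.
move=> Q0; rewrite le_eqVlt => /predU1P[Psi0|Psi0].
  by rewrite approx_set_eq0 -?Psi0// measure0 !mul0r mulr0.
have [k [k1 k2 kE]] := approx_set_ball Q0 Psi0.
apply: (@le_trans _ _ (\sum_(P : {poly_(pdeg Q) F} | coprimep (P : {poly F}) Q)
    nu (cball (iota P / iota Q)%R k))%E).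
  apply: le_measure_finType => [P _||]; first exact: measurable_cball.
    exact: measurable_approx_set.
  by rewrite kE; apply: subset_bigcup => P _ f [].
rewrite (eq_bigr (fun=> (q ^ k)%:E)) => [|P _]; last by rewrite haar_cball// haar_lball.
rewrite sumEFin sumr_const lee_fin -[leLHS]mulr_natl.
rewrite [leRHS](_ : _ = (ptotient Q)%:R * (q * (Psi Q / labs R (iota Q)))); last first.
  by rewrite [Psi Q * _]mulrC -mulrA mulrCA.
apply: ler_wpM2l; first exact: ler0n.
rewrite -[k](subrK 1) addrC expfzDr ?q_neq0// expr1z ler_pM2l ?q_gt0//.
exact: ltW.
Qed.

Definition approx_weight Psi Q : R :=
  (Psi Q * (poly_totient Q)%:R / labs R (iota Q)) ^+ d.

Lemma approx_weight_ge0 Psi Q : 0 <= Psi Q -> 0 <= approx_weight Psi Q.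
Proof.
by move=> Psi0; rewrite exprn_ge0// divr_ge0 ?labs_ge0// mulr_ge0.
Qed.

Lemma nu_approx_fin Psi Q : Q != 0 -> nu (approx_set Psi Q) \is a fin_num.
Proof.
move=> Q0; rewrite ge0_fin_numE//; apply: (@le_lt_trans _ _ (nu (@lball F 0))).
  apply: le_measure; rewrite ?inE//; last exact: approx_set_lball.
    exact: measurable_approx_set.
  exact: measurable_lball.
by rewrite haar_lball// ltry.
Qed.

Lemma nud_approx_pow Psi Q : Q != 0 ->
  nud (approx_pow d Psi Q) = (fine (nu (approx_set Psi Q)) ^+ d)%:E.
Proof.
move=> Q0; rewrite (hnud (A := fun=> approx_set Psi Q)) => [|i]; last first.
  exact: measurable_approx_set.
rewrite (eq_bigr (fun=> (fine (nu (approx_set Psi Q)))%:E)) => [|i _]; last first.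
  by rewrite fineK// nu_approx_fin.
by rewrite prodEFin prodr_const card_ord.
Qed.

Lemma nud_approx_le Psi Q : Q != 0 -> 0 <= Psi Q ->
  (nud (approx_pow d Psi Q) <= (q ^+ d * approx_weight Psi Q)%:E)%E.
Proof.
move=> Q0 Psi0; rewrite nud_approx_pow// lee_fin -exprMn lerXn2r ?nnegrE ?fine_ge0//.
  by rewrite mulr_ge0 ?(ltW (q_gt0 _ _))// divr_ge0 ?labs_ge0// mulr_ge0.
by rewrite -lee_fin fineK ?nu_approx_fin// haar_approx_le.
Qed.

(** The constant c of the comparison v_Q >= c min(t_Q, 1). *)
Definition approx_const : R := (1 + Kq F R) ^- d.

Lemma approx_const_gt0 : 0 < approx_const.
Proof. by rewrite invr_gt0 exprn_gt0// ltr_wpDr// Kq_ge0. Qed.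

Lemma nud_approx_ge Psi Q : Q != 0 -> 0 <= Psi Q ->
  ((approx_const * Num.min (approx_weight Psi Q) 1)%:E <= nud (approx_pow d Psi Q))%E.
Proof.
move=> Q0 Psi0; rewrite nud_approx_pow// lee_fin.
have K1 : 0 < 1 + Kq F R by rewrite ltr_wpDr// Kq_ge0.
set x := Psi Q * (ptotient Q)%:R / labs R (iota Q).
have x0 : 0 <= x by rewrite divr_ge0 ?labs_ge0// mulr_ge0.
apply: (@le_trans _ _ ((Num.min x 1 / (1 + Kq F R)) ^+ d)).
  rewrite expr_div_n mulrC /approx_const ler_wpM2r// ?invr_ge0 ?exprn_ge0 ?(ltW K1)//.
  have [x1|x1] := leP x 1; first by rewrite ge_min lexx.
  by rewrite expr1n ge_min lexx orbT.
rewrite lerXn2r ?nnegrE ?fine_ge0//.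
  by rewrite divr_ge0 ?(ltW K1)// le_min x0 ler01.
by rewrite -lee_fin fineK ?nu_approx_fin// haar_approx_ge.
Qed.

End ApproxMeasure.

(** * Series over monic polynomials, sorted by degree *)

Section DegreeSums.
Variables (R : realType) (F : finFieldType).
Implicit Types (S : nat -> R) (P Q : {poly F}).

(** For nonnegative terms this is divergence of the series, stated with real partial sums. *)
Definition unbounded S := forall M, exists N, M <= \sum_(0 <= n < N) S n.

(** The ['X^n + p] with p of size at most n are the monic polynomials of degree n. *)
Definition degree_sum (f : {poly F} -> R) (n : nat) : R :=
  \sum_(p : {poly_n F}) f ('X^n + (p : {poly F})).

Lemma pdeg_XnDp n (p : {poly_n F}) : pdeg ('X^n + (p : {poly F})) = n.
Proof. by rewrite /pdeg size_XnDp. Qed.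

Lemma degree_sum_ge0 (f : {poly F} -> R) n : (forall Q, 0 <= f Q) -> 0 <= degree_sum f n.
Proof. by move=> f0; apply: sumr_ge0. Qed.

Lemma le_degree_sum (f g : {poly F} -> R) n :
  (forall Q, pdeg Q = n -> Q \is monic -> f Q <= g Q) -> degree_sum f n <= degree_sum g n.
Proof. by move=> fg; apply: ler_sum => p _; rewrite fg ?pdeg_XnDp ?monic_XnDp. Qed.

Lemma esum_monic (f : {poly F} -> R) : (forall Q, Q \is monic -> 0 <= f Q) ->
  (\esum_(Q in [set Q : {poly F} | Q \is monic]) (f Q)%:E =
   \sum_(0 <= n <oo) (degree_sum f n)%:E)%E.
Proof.
move=> f0.
(* Truncation at 0 makes the terms nonnegative at every Q, not only at the monic ones. *)
pose g Q := Num.max (f Q) 0.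
have g0 Q : (0 <= (g Q)%:E)%E by rewrite lee_fin le_max lexx orbT.
rewrite (eq_esum (b := fun Q => (g Q)%:E)) => [|Q Qm]; last by rewrite /g max_l// f0.
pose J (n : nat) := [set Q : {poly F} | Q \is monic /\ pdeg Q = n].
have -> : [set Q : {poly F} | Q \is monic] = \bigcup_n J n.
  by apply/seteqP; split=> Q /=; [exists (pdeg Q)|case=> n _ []].
rewrite nneseries_sum_bigcup//; last first.
  by move=> i j _ _ [Q [[_ <-] [_ <-]]].
apply: eq_eseriesr => n _.
have -> : J n = (fun p : {poly_n F} => 'X^n + (p : {poly F})) @` setT.
  apply/seteqP; split=> [Q [Qm Qn]|_ [p _ <-]]; last first.
    by split; [exact: monic_XnDp|exact: pdeg_XnDp].
  have sQ := monic_subXn Qm; rewrite Qn in sQ.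
  by exists (NPoly sQ) => //=; rewrite addrC subrK.
rewrite esum_image; last first.
  by move=> p p' _ _ /addrI /val_inj.
rewrite esum_fset//; last exact: finite_finset.
have -> : [set: {poly_n F}] = [set p | xpredT p] by apply/seteqP.
rewrite fsbig_finType sumEFin; congr (_%:E).
by apply: eq_bigr => p _; rewrite /g max_l// f0 ?monic_XnDp.
Qed.

Lemma nneseries_unbounded S : (forall n, 0 <= S n) ->
  (\sum_(0 <= n <oo) (S n)%:E = +oo)%E <-> unbounded S.
Proof.
move=> S0; split=> [Soo M|unb].
  apply: contrapT => nex.
  suff : (\sum_(0 <= n <oo) (S n)%:E <= M%:E)%E by rewrite Soo.
  apply: lime_le; first by apply: is_cvg_nneseries => n _ _; rewrite lee_fin.
  apply: nearW => N; rewrite sumEFin lee_fin leNgt; apply/negP => /ltW MN.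
  by apply: nex; exists N.
apply/eqP; rewrite -leye_eq leNgt; apply/negP => lt_oo.
set s := (\sum_(0 <= n <oo) _)%E in lt_oo.
have sfin : s \is a fin_num.
  by rewrite ge0_fin_numE// nneseries_ge0// => n _ _; rewrite lee_fin.
have [N] := unb (fine s + 1); apply/negP; rewrite -ltNge.
apply: (@le_lt_trans _ _ (fine s)); last by rewrite ltrDl.
rewrite -lee_fin fineK// -sumEFin; apply: nneseries_lim_ge => n _ _.
by rewrite lee_fin.
Qed.

Lemma le_unbounded S S' : (forall n, S n <= S' n) -> unbounded S -> unbounded S'.
Proof.
move=> SS' unb M; have [N MN] := unb M; exists N; apply: (le_trans MN).
by apply: ler_sum => n _.
Qed.

Lemma unboundedZ S (c : R) : 0 < c -> unbounded (fun n => c * S n) -> unbounded S.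
Proof.
move=> c0 unb M; have [N MN] := unb (c * M); exists N.
by move: MN; rewrite -mulr_sumr ler_pM2l.
Qed.

Lemma sum_nat_mono S (N N' : nat) : (forall n, 0 <= S n) -> (N <= N')%N ->
  \sum_(0 <= n < N) S n <= \sum_(0 <= n < N') S n.
Proof.
by move=> S0 NN'; rewrite [leRHS](big_cat_nat (leq0n N) NN')/= lerDl sumr_ge0.
Qed.

Lemma unbounded_tail S (n0 : nat) M : (forall n, 0 <= S n) -> unbounded S ->
  exists2 N, (n0 <= N)%N & M <= \sum_(n0 <= n < N) S n.
Proof.
move=> S0 unb; have [N MN] := unb (\sum_(0 <= n < n0) S n + M).
exists (maxn n0 N); first exact: leq_maxl.
rewrite -(lerD2l (\sum_(0 <= n < n0) S n)) -big_cat_nat ?leq_maxl//=.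
by apply: (le_trans MN); apply: sum_nat_mono => //; exact: leq_maxr.
Qed.

(** Consecutive blocks, each of sum at least [a], carry the partial sums past any multiple of
    [a]. *)
Lemma unboundedP S (a : R) : 0 < a -> (forall n, 0 <= S n) ->
  (forall n0, exists N, a <= \sum_(n0 <= n < N) S n) -> unbounded S.
Proof.
move=> a0 S0 tail M.
have step (j : nat) : exists N, a *+ j <= \sum_(0 <= n < N) S n.
  elim: j => [|j [N IH]]; first by exists 0%N; rewrite mulr0n big_geq.
  have [N' aN'] := tail N; exists N'; rewrite mulrS addrC.
  have [NN'|N'N] := leqP N N'.
    by rewrite (big_cat_nat (leq0n N) NN')/=; apply: lerD.
  by move: aN'; rewrite big_geq ?(ltnW N'N)// leNgt a0.
have [N aN] := step (Num.bound `|M / a|); exists N; apply: le_trans aN.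
rewrite -mulr_natl -ler_pdivrMr// (le_trans (ler_norm _))// ltW//.
by rewrite archi_boundP.
Qed.

End DegreeSums.

(** * Unions, limsup sets and their sums *)

Section ApproxUnion.
Variables (R : realType) (F : finFieldType) (d : nat).
Hypothesis d_gt0 : (0 < d)%N.
Variables (nu : {measure set (laurent F) -> \bar R})
  (nud : {measure set (d.-tuple (laurent F)) -> \bar R}).
Hypotheses (hnu : haar_measure nu) (hnu1 : nu (@open_unit_ball F) = 1%E)
  (hnud : product_measure_of nu nud).
Implicit Types (Psi : {poly F} -> R) (P Q : {poly F}).
Local Notation T := (d.-tuple (laurent F)).

Definition approx_union Psi (n : nat) : set T :=
  \bigcup_(Q in [set Q : {poly F} | Q \is monic /\ (n <= (size Q).-1)%N]) approx_pow d Psi Q.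

Lemma measurable_approx_union Psi n : measurable (approx_union Psi n).
Proof.
rewrite /approx_union bigcup_mkcond; apply: countable_bigcupT_measurable.
  exact: countableP.
move=> Q; case: ifPn => [|_]; last exact: measurable0.
by rewrite inE => -[/monic_neq0 Q0 _]; exact: measurable_approx_pow.
Qed.

Lemma approx_union_cube Psi n : approx_union Psi n `<=` @unit_cube F d.
Proof. by move=> x [Q _ xQ]; exact: approx_pow_cube xQ. Qed.

Lemma approx_unionW Psi m n : (m <= n)%N -> approx_union Psi n `<=` approx_union Psi m.
Proof. by move=> mn x [Q [Qm nQ] xQ]; exists Q => //; split=> //; exact: leq_trans nQ. Qed.

Lemma approx_union0 Psi :
  approx_union Psi 0 = \bigcup_(Q in [set Q : {poly F} | Q \is monic]) approx_pow d Psi Q.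
Proof. by apply/seteqP; split=> x [Q]; [case=> Qm _|move=> Qm] => xQ; exists Q. Qed.

(** The unions decrease with n, so admitting n = 0 does not change the intersection. *)
Lemma limsup_approxE Psi : limsup_approx d Psi = \bigcap_n approx_union Psi n.
Proof.
apply/seteqP; split=> x xW n; last by move=> _; exact: xW.
by move=> _; apply: (approx_unionW (leqnSn n)); exact: xW.
Qed.

Lemma measurable_limsup_approx Psi : measurable (limsup_approx d Psi).
Proof.
rewrite limsup_approxE; apply: bigcapT_measurable => n.
exact: measurable_approx_union.
Qed.

Lemma limsup_approx_cube Psi : limsup_approx d Psi `<=` @unit_cube F d.
Proof.
by rewrite limsup_approxE => x /(_ 0%N I) xU; exact: approx_union_cube xU.
Qed.

(** Continuity from above, available because the cube has finite measure. *)
Lemma nud_bigcap_ge (A : nat -> set T) (c : \bar R) :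
  (forall n, measurable (A n)) -> (forall n, A n `<=` @unit_cube F d) ->
  (forall m n, (m <= n)%N -> A n `<=` A m) ->
  (forall n, c <= nud (A n))%E -> (c <= nud (\bigcap_n A n))%E.
Proof.
move=> mA AU Adec cA.
have cv : nud \o A @ \oo --> nud (\bigcap_n A n).
  apply: nonincreasing_cvg_mu => //.
  - by have := nud_fin hnu hnu1 hnud (mA 0%N) (AU 0%N); rewrite ge0_fin_numE.
  - exact: bigcapT_measurable.
  - by move=> m n mn; apply/subsetPset; exact: Adec.
rewrite -(cvg_lim _ cv)//; apply: lime_ge; first by apply/cvg_ex; eexists; exact: cv.
by apply: nearW => n; exact: cA.
Qed.

Lemma nud_limsup_ge Psi (c : \bar R) : (forall n, c <= nud (approx_union Psi n))%E ->
  (c <= nud (limsup_approx d Psi))%E.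
Proof.
move=> cA; rewrite limsup_approxE; apply: nud_bigcap_ge => //.
- by move=> n; exact: measurable_approx_union.
- by move=> n; exact: approx_union_cube.
- by move=> m n; exact: approx_unionW.
Qed.

Lemma le_approx_set Psi Psi' Q : Psi Q <= Psi' Q ->
  approx_set Psi Q `<=` approx_set Psi' Q.
Proof.
move=> le f [P PQ [fL fP]]; exists P => //; split=> //; apply: (lt_le_trans fP).
by rewrite ler_wpM2r// invr_ge0 labs_ge0.
Qed.

Lemma le_approx_pow Psi Psi' Q : Psi Q <= Psi' Q ->
  approx_pow d Psi Q `<=` approx_pow d Psi' Q.
Proof. by move=> le x xQ i; apply: le_approx_set (xQ i). Qed.

Lemma approx_pow_eq0 Psi Q : Psi Q <= 0 -> approx_pow d Psi Q = set0.
Proof.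
move=> Psi0; apply/seteqP; split=> // x xQ.
by have := xQ (Ordinal d_gt0); rewrite approx_set_eq0.
Qed.

Definition dweight Psi := degree_sum (approx_weight d Psi).
Definition dmeasure Psi := degree_sum (fun Q => fine (nud (approx_pow d Psi Q))).

Lemma dweight_ge0 Psi n : (forall Q, 0 <= Psi Q) -> 0 <= dweight Psi n.
Proof. by move=> Psi0; apply: degree_sum_ge0 => Q; exact: approx_weight_ge0. Qed.

Lemma dmeasure_ge0 Psi n : 0 <= dmeasure Psi n.
Proof. by apply: degree_sum_ge0 => Q; rewrite fine_ge0. Qed.

Lemma esum_weight Psi : (forall Q, 0 <= Psi Q) ->
  (\esum_(Q in [set Q : {poly F} | Q \is monic]) (approx_weight d Psi Q)%:E =
   \sum_(0 <= n <oo) (dweight Psi n)%:E)%E.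
Proof. by move=> Psi0; rewrite esum_monic// => Q _; exact: approx_weight_ge0. Qed.

Lemma nud_approx_fin Psi Q : Q \is monic -> nud (approx_pow d Psi Q) \is a fin_num.
Proof.
move=> /monic_neq0 Q0; apply: (nud_fin hnu hnu1 hnud); last exact: approx_pow_cube.
exact: measurable_approx_pow.
Qed.

Lemma esum_measure Psi :
  (\esum_(Q in [set Q : {poly F} | Q \is monic]) nud (approx_pow d Psi Q) =
   \sum_(0 <= n <oo) (dmeasure Psi n)%:E)%E.
Proof.
rewrite -esum_monic => [|Q Qm]; last by rewrite fine_ge0.
by apply: eq_esum => Q Qm; rewrite fineK// nud_approx_fin.
Qed.

Lemma esum_measure_unbounded Psi :
  (\esum_(Q in [set Q : {poly F} | Q \is monic]) nud (approx_pow d Psi Q) = +oo)%E <->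
  unbounded (dmeasure Psi).
Proof.
by rewrite esum_measure nneseries_unbounded// => n; exact: dmeasure_ge0.
Qed.

Lemma dmeasure_le Psi n : (forall Q, 0 <= Psi Q) ->
  dmeasure Psi n <= #|F|%:R ^+ d * dweight Psi n.
Proof.
move=> Psi0; rewrite /dweight /degree_sum mulr_sumr; apply: ler_sum => p _.
rewrite -lee_fin fineK ?nud_approx_fin ?monic_XnDp//.
by apply: (nud_approx_le hnu) => //; exact/monic_neq0/monic_XnDp.
Qed.

(** Truncation at 1 is subadditive; this carries the lower bound for a single Q over to sums. *)
Lemma minr_sum_le (I : Type) (r : seq I) (f : I -> R) : (forall i, 0 <= f i) ->
  Num.min (\sum_(i <- r) f i) 1 <= \sum_(i <- r) Num.min (f i) 1.
Proof.
move=> f0; elim: r => [|i r IH]; first by rewrite !big_nil ge_min lexx.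
rewrite !big_cons; apply: (@le_trans _ _ (Num.min (f i) 1 + Num.min (\sum_(j <- r) f j) 1)).
  have s0 : 0 <= \sum_(j <- r) f j by exact: sumr_ge0.
  have := f0 i; move: (f i) (\sum_(j <- r) f j) s0 => a b b0 a0.
  by case: (leP a 1) => a1; case: (leP b 1) => b1; case: (leP (a + b) 1) => ab; lra.
by rewrite lerD2l.
Qed.

Lemma dmeasure_ge Psi n : (forall Q, 0 <= Psi Q) ->
  approx_const R F d * Num.min (dweight Psi n) 1 <= dmeasure Psi n.
Proof.
move=> Psi0; have c0 := approx_const_gt0 R F d.
apply: (@le_trans _ _ (approx_const R F d *
    \sum_(p : {poly_n F}) Num.min (approx_weight d Psi ('X^n + (p : {poly F}))) 1)).
  rewrite ler_pM2l//; apply: minr_sum_le => p; exact: approx_weight_ge0.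
rewrite mulr_sumr; apply: ler_sum => p _.
rewrite -lee_fin fineK ?nud_approx_fin ?monic_XnDp//.
by apply: (nud_approx_ge hnu) => //; exact/monic_neq0/monic_XnDp.
Qed.

Lemma sum_dmeasure_ge Psi (m n : nat) : (forall Q, 0 <= Psi Q) ->
  approx_const R F d * Num.min (\sum_(m <= i < n) dweight Psi i) 1 <=
  \sum_(m <= i < n) dmeasure Psi i.
Proof.
move=> Psi0; have c0 := approx_const_gt0 R F d.
apply: (@le_trans _ _ (approx_const R F d *
    \sum_(m <= i < n) Num.min (dweight Psi i) 1)).
  rewrite ler_pM2l//; apply: minr_sum_le => i; exact: dweight_ge0.
by rewrite mulr_sumr; apply: ler_sum => i _; exact: dmeasure_ge.
Qed.

End ApproxUnion.

(** * From the zero-one statement to the quantitative bound *)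

Section Dilation.
Variables (R : realType) (F : finFieldType) (d : nat).
Hypothesis d_gt0 : (0 < d)%N.
Variables (nu : {measure set (laurent F) -> \bar R})
  (nud : {measure set (d.-tuple (laurent F)) -> \bar R}).
Hypotheses (hnu : haar_measure nu) (hnu1 : nu (@open_unit_ball F) = 1%E)
  (hnud : product_measure_of nu nud).
Implicit Types (Psi : {poly F} -> R) (P Q : {poly F}).
Local Notation T := (d.-tuple (laurent F)).
Local Notation iota := (@laurent_of_poly F).
Local Notation q := (#|F|%:R : R).

Definition dilate (m : nat) Psi Q : R :=
  if ('X^m %| Q)%R then Psi (Q %/ 'X^m) else 0.

Lemma Xn_neq0 (m : nat) : 'X^m != 0 :> {poly F}.
Proof. by rewrite expf_neq0 ?polyX_eq0. Qed.

Lemma dilate_mul m Psi Q : dilate m Psi ('X^m * Q) = Psi Q.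
Proof. by rewrite /dilate dvdp_mulr// mulKp// Xn_neq0. Qed.

Lemma dilate_ge0 m Psi : (forall Q, 0 <= Psi Q) -> forall Q, 0 <= dilate m Psi Q.
Proof. by move=> Psi0 Q; rewrite /dilate; case: ifP. Qed.

Definition dilate_const : R := (1 - q^-1) ^+ d.

Lemma dilate_const_gt0 : 0 < dilate_const.
Proof. by rewrite exprn_gt0// subr_gt0 invf_lt1 ?q_gt0 ?q_gt1. Qed.

Lemma approx_weight_dilate m Psi Q : (0 < m)%N -> Q != 0 -> 0 <= Psi Q ->
  dilate_const * approx_weight d Psi Q <= approx_weight d (dilate m Psi) ('X^m * Q).
Proof.
move=> m0 Q0 Psi0; have XQ0 : 'X^m * Q != 0 by rewrite mulf_neq0 ?Xn_neq0.
have q1 : 0 <= 1 - q^-1 by rewrite subr_ge0 invf_le1 ?q_gt0// ltW// q_gt1.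
rewrite /approx_weight dilate_mul !labs_poly// pdegM ?Xn_neq0// -exprMn.
rewrite lerXn2r ?nnegrE//.
- by rewrite mulr_ge0// divr_ge0 ?(ltW (qz_gt0 _ _ _))// mulr_ge0.
- by rewrite divr_ge0 ?(ltW (qz_gt0 _ _ _))// mulr_ge0.
rewrite [pdeg 'X^m]/pdeg size_polyXn/= PoszD expfzDr ?q_neq0//.
have := ptotient_mul_Xn R Q0 m0.
rewrite -[poly_totient Q]/(ptotient Q) -[poly_totient _]/(ptotient ('X^m * Q)).
move: (ptotient Q)%:R (ptotient ('X^m * Q))%:R => t t' tt'.
rewrite ler_pdivlMr ?mulr_gt0 ?qz_gt0//.
have qn := qz_gt0 F R (pdeg Q); have qm := qX_gt0 F R m.
rewrite [leLHS](_ : _ = Psi Q * (t * q ^+ m * (1 - q^-1))); first exact: ler_wpM2l.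
rewrite -!exprnP; field.
by rewrite q_neq0 gt_eqF.
Qed.

(** Multiplication by X^m maps the monic polynomials of degree n injectively into those of degree m
    + n, and the remaining terms there are nonnegative. *)
Lemma dweight_dilate m Psi n : (0 < m)%N -> (forall Q, 0 <= Psi Q) ->
  dilate_const * dweight d Psi n <= dweight d (dilate m Psi) (m + n).
Proof.
move=> m0 Psi0.
pose f (p : {poly_n F}) : {poly_(m + n) F} := npolyp (m + n) ('X^m * (p : {poly F})).
have fE (p : {poly_n F}) : (f p : {poly F}) = 'X^m * (p : {poly F}).
  have [p0|p0] := eqVneq (p : {poly F}) 0.
    by rewrite npolypK p0 mulr0// size_poly0.
  rewrite npolypK// size_pdeg ?mulf_neq0 ?Xn_neq0// pdegM ?Xn_neq0//.
  rewrite {1}/pdeg size_polyXn/= -addnS leq_add2l -size_pdeg//.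
have f_inj : injective f.
  by move=> p p' /(congr1 val)/=; rewrite !fE => /(mulfI (Xn_neq0 m)) /val_inj.
rewrite /dweight /degree_sum mulr_sumr.
apply: (@le_trans _ _ (\sum_(p' in f @: setT)
    approx_weight d (dilate m Psi) ('X^(m + n) + (p' : {poly F})))).
  rewrite big_imset/=; last by move=> p p' _ _ /f_inj.
  rewrite [leRHS]big_mkcond/=.
  apply: ler_sum => p _; rewrite in_setT fE exprD -mulrDr.
  by apply: approx_weight_dilate => //; exact/monic_neq0/monic_XnDp.
rewrite [leRHS](bigID (mem (f @: setT)))/= lerDl; apply: sumr_ge0 => p _.
exact/approx_weight_ge0/dilate_ge0.
Qed.

(* An approximation of x by P / (X^m Q) gives one of X^m x modulo F[X] by P / Q, and multiplication by
   X^m modulo F[X] preserves the measure. *)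
Lemma nud_union_dilate m Psi :
  (nud (approx_union (dilate m Psi) 0) <= nud (approx_union Psi 0))%E.
Proof.
(* On the cylinder of [a], reducing X^m x modulo F[X] amounts to subtracting [a], so the reduction
   is given piecewise by the maps [aff 'X^m (b a)]. *)
pose b (a : {ffun 'I_d -> {poly_m F}}) (i : 'I_d) := - iota (a i).
have mU := @measurable_approx_union R F d Psi 0.
have UC := @approx_union_cube R F d Psi 0.
have uE : nud (approx_union Psi 0) = (fine (nud (approx_union Psi 0)))%:E.
  by rewrite fineK// (nud_fin hnu hnu1 hnud).
apply: (@le_trans _ _ (\sum_(a : {ffun 'I_d -> {poly_m F}})
   nud (aff 'X^m (b a) @^-1` approx_union Psi 0))%E).
  apply: (le_measure_finType nud (P := xpredT)).
  - move=> a _; rewrite -[X in measurable X]setTI.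
    by apply: measurable_aff => //; exact: Xn_neq0.
  - exact: measurable_approx_union.
  move=> x [Q [Qm _] xQ]; exists (cyl_of m x) => //=.
  have xC := approx_pow_cube xQ; have yC := cyl_ofP m xC.
  have [XQ|XQ] := boolP ('X^m %| Q)%R; last first.
    by move: xQ; rewrite approx_pow_eq0// /dilate (negbTE XQ).
  move: XQ => /dvdpP[Q']; rewrite mulrC => QE.
  have Q0 := monic_neq0 Qm; have Q'0 : Q' != 0.
    by apply: contraNneq Q0 => Q'0; rewrite QE Q'0 mulr0.
  exists Q'; first by split => //; move: Qm; rewrite QE monicMl ?monicXn.
  move=> i; apply/approx_setE => //; rewrite tnth_mktuple.
  have := xQ i; rewrite approx_setE// QE dilate_mul => -[_ [P]].
  rewrite coprimepMr => /andP[_ PQ'] xP.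
  split; first by rewrite rmorphXn; exact: yC.
  exists (P - (cyl_of m x i : {poly F}) * Q').
    by rewrite -coprimep_modpl modpD modpN modp_mull oppr0 addr0 coprimep_modpl.
  rewrite rmorphB !rmorphM/= in xP *.
  rewrite (_ : _ - _ = tnth x i * (iota 'X^m * iota Q') - iota P)//.
  by rewrite /b; ring.
(* There are q^(m d) cylinders and each map scales the measure by q^(-m d): the factors cancel. *)
rewrite (eq_bigr (fun=> (((q ^- m) ^+ d)%:E * nud (approx_union Psi 0))%E)); last first.
  move=> a _; rewrite (nud_aff hnu hnu1 hnud) ?Xn_neq0//.
  by rewrite /pdeg size_polyXn.
rewrite uE -EFinM sumEFin lee_fin sumr_const card_cyl -[leLHS]mulr_natl mulrA.
rewrite natrX natrX -exprMn mulfV ?expr1n ?mul1r//.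
by rewrite gt_eqF// qX_gt0.
Qed.

End Dilation.

(** * Many copies of a function that violates the bound *)

Section Copies.
Variables (R : realType) (F : finFieldType) (d : nat).
Hypothesis d_gt0 : (0 < d)%N.
Variables (nu : {measure set (laurent F) -> \bar R})
  (nud : {measure set (d.-tuple (laurent F)) -> \bar R}).
Hypotheses (hnu : haar_measure nu) (hnu1 : nu (@open_unit_ball F) = 1%E)
  (hnud : product_measure_of nu nud).
Implicit Types (Psi : {poly F} -> R) (P Q : {poly F}).
Local Notation T := (d.-tuple (laurent F)).
Local Notation c0 := (dilate_const R F d).

Definition glue (n : nat) Psi1 Psi2 Q : R := if (pdeg Q < n)%N then Psi1 Q else Psi2 Q.

Lemma glue_ge0 n Psi1 Psi2 : (forall Q, 0 <= Psi1 Q) -> (forall Q, 0 <= Psi2 Q) ->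
  forall Q, 0 <= glue n Psi1 Psi2 Q.
Proof. by move=> h1 h2 Q; rewrite /glue; case: ifP. Qed.

Lemma dweight_glue n Psi1 Psi2 i :
  dweight d (glue n Psi1 Psi2) i = if (i < n)%N then dweight d Psi1 i else dweight d Psi2 i.
Proof.
rewrite /dweight /degree_sum; case: ifP => i_n; apply: eq_bigr => p _;
  by rewrite /approx_weight /glue pdeg_XnDp i_n.
Qed.

Lemma nud_union_fine Psi n :
  nud (approx_union Psi n) = (fine (nud (approx_union Psi n)))%:E.
Proof.
rewrite fineK// (nud_fin hnu hnu1 hnud)//; last exact: approx_union_cube.
exact: measurable_approx_union.
Qed.

Lemma nud_union_glue n Psi1 Psi2 :
  (nud (approx_union (glue n Psi1 Psi2) 0) <=
   nud (approx_union Psi1 0) + nud (approx_union Psi2 0))%E.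
Proof.
have mU Psi := @measurable_approx_union R F d Psi 0.
apply: le_trans (measureU2 _ (mU Psi1) (mU Psi2)).
apply: le_measure; rewrite ?inE; [exact: mU|by apply: measurableU|].
move=> x [Q [Qm _] xQ]; have [Qn|Qn] := ltnP (pdeg Q) n; [left|right];
  by exists Q; [split|apply: le_approx_pow xQ; rewrite /glue ?Qn// ltnNge Qn].
Qed.

(* The copies of Psi0 on the multiples of X^m, for suitable large m, have disjoint ranges of degrees. *)
Lemma exists_copies Psi0 (D N n0 : nat) : (forall Q, 0 <= Psi0 Q) ->
  exists Psi n1, [/\ forall Q, 0 <= Psi Q,
    forall Q, (pdeg Q < n0)%N -> Psi Q = 0, (n0 <= n1)%N,
    N%:R * (c0 * \sum_(0 <= i < D) dweight d Psi0 i) <= \sum_(0 <= i < n1) dweight d Psi i &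
    (nud (approx_union Psi 0) <= (N%:R * fine (nud (approx_union Psi0 0)))%:E)%E].
Proof.
move=> Psi00; elim: N => [|N [Psi [n1 [Psi_ge0 Psi_eq0 n01 IH1 IH2]]]].
  exists (fun=> 0), n0; split=> //.
    by rewrite mul0r sumr_ge0// => i _; exact: dweight_ge0.
  rewrite mul0r (_ : approx_union _ _ = set0) ?measure0//.
  by apply/seteqP; split=> // x [Q _]; rewrite approx_pow_eq0.
have sge0 := @dilate_ge0 R F n1.+1 Psi0 Psi00.
(* The exponent n1 + 1 is positive and moves the [D] degrees that count to the range from n1 + 1 to
   n1 + D, beyond those already used. *)
exists (glue n1 Psi (dilate n1.+1 Psi0)), (n1.+1 + D)%N; split.
- exact: glue_ge0.
- by move=> Q Qn; rewrite /glue (leq_trans Qn n01) Psi_eq0.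
- exact: leq_trans n01 (ltnW (leq_addr D n1.+1)).
- rewrite (big_cat_nat (leq0n n1) (ltnW (leq_addr D n1.+1)))/=.
  rewrite -natr1 mulrDl mul1r; apply: lerD.
    apply: (le_trans IH1); rewrite !big_nat; apply: ler_sum => i /andP[_ i1].
    by rewrite dweight_glue i1.
  rewrite (big_cat_nat (leqnSn n1) (leq_addr D n1.+1))/=.
  apply: ler_wpDl.
    by apply: sumr_ge0 => i _; apply: dweight_ge0; exact: glue_ge0.
  rewrite -{1}[n1.+1]add0n big_addn addKn mulr_sumr.
  apply: ler_sum => i _; rewrite dweight_glue ifN; last first.
    by rewrite -leqNgt addnS (leq_trans _ (leqnSn _))// leq_addl.
  by rewrite addnC; exact: dweight_dilate.
- apply: (le_trans (nud_union_glue _ _ _)).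
  rewrite -natr1 mulrDl mul1r EFinD; apply: leeD => //.
  apply: (le_trans (nud_union_dilate d_gt0 hnu hnu1 hnud _ _)).
  by rewrite {1}nud_union_fine.
Qed.

(** Statement (ii). *)
Definition strong_bound := exists C : R, 0 < C /\
  forall Psi : {poly F} -> R, (forall Q, 0 <= Psi Q) ->
    (C%:E * Order.min
      (\esum_(Q in [set Q : {poly F} | Q \is monic]) (approx_weight d Psi Q)%:E) 1
      <= nud (\bigcup_(Q in [set Q : {poly F} | Q \is monic]) approx_pow d Psi Q))%E.

(** If the bound with constant [C] held for all partial sums, it would pass to the whole series; so
    finitely many degrees already witness its failure. *)
Lemma strong_bound_fails C : ~ strong_bound -> 0 < C ->
  exists Psi (D : nat), [/\ forall Q, 0 <= Psi Q &
    fine (nud (approx_union Psi 0)) < C * Num.min (\sum_(0 <= i < D) dweight d Psi i) 1].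
Proof.
move=> nsb C0; apply: contrapT => nex; apply: nsb; exists C; split=> // Psi Psi0.
rewrite esum_weight// -approx_union0 nud_union_fine.
set u := fine _.
have hD (D : nat) : C * Num.min (\sum_(0 <= i < D) dweight d Psi i) 1 <= u.
  by rewrite leNgt; apply/negP => uD; apply: nex; exists Psi, D.
have [[D sD]|small] := pselect (exists D, 1 <= \sum_(0 <= i < D) dweight d Psi i).
  apply: (@le_trans _ _ C%:E); last first.
    by rewrite lee_fin (le_trans _ (hD D))// min_r// mulr1.
  by rewrite -[leRHS]mule1 lee_pmul2l// ge_min lexx orbT.
have hs (D : nat) : \sum_(0 <= i < D) dweight d Psi i <= u / C.
  rewrite ler_pdivlMr// mulrC; apply: le_trans (hD D).
  rewrite min_l// leNgt; apply/negP => sD; apply: small; exists D; exact: ltW.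
have : (\sum_(0 <= n <oo) (dweight d Psi n)%:E <= (u / C)%:E)%E.
  apply: lime_le; first by apply: is_cvg_nneseries => n _ _; rewrite lee_fin dweight_ge0.
  by apply: nearW => D; rewrite sumEFin lee_fin.
move=> le_u; apply: (@le_trans _ _ (C%:E * (u / C)%:E)%E).
  by rewrite lee_pmul2l// (le_trans _ le_u)// ge_min lexx.
by rewrite -EFinM mulrC divfK// gt_eqF.
Qed.

(** The bound fails with constant e / 2, at a truncated sum s. With N copies, N >= 1/s makes the
    total weight at least [c0], and N <= 2/s keeps the measure of the union below (2/s)(e/2) s =
    e. *)
Lemma strong_bound_fails_tail (e : R) (n0 : nat) : ~ strong_bound -> 0 < e ->
  exists Psi n1, [/\ forall Q, 0 <= Psi Q,
    forall Q, (pdeg Q < n0)%N -> Psi Q = 0,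
    c0 <= \sum_(0 <= i < n1) dweight d Psi i &
    (nud (approx_union Psi 0) <= e%:E)%E].
Proof.
move=> nsb e0; have e2 : 0 < e / 2 by rewrite divr_gt0.
have [Psi0 [D [Psi00 uD]]] := strong_bound_fails nsb e2.
set s := Num.min _ _ in uD; set u := fine _ in uD.
have u0 : 0 <= u by rewrite fine_ge0.
have s0 : 0 < s by rewrite -(pmulr_rgt0 _ e2) (le_lt_trans u0).
have s1 : s <= 1 by rewrite ge_min lexx orbT.
have si0 : 0 <= s^-1 by rewrite invr_ge0 ltW.
pose N := (Num.Def.trunc s^-1).+1.
have sN : s^-1 <= N%:R by rewrite ltW// truncnS_gt.
have Ns : N%:R <= s^-1 + 1 by rewrite /N -natr1 lerD2r truncn_le.
have [Psi [n1 [h1 h2 _ h3 h4]]] := exists_copies D N n0 Psi00.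
exists Psi, n1; split=> //.
  apply: le_trans h3; rewrite mulrCA ler_peMr ?(ltW (dilate_const_gt0 R F d))//.
  apply: (@le_trans _ _ (N%:R * s)); first by rewrite -ler_pdivrMr// mul1r.
  by apply: ler_wpM2l => //; rewrite ge_min lexx.
apply: (le_trans h4); rewrite lee_fin -/u.
apply: (@le_trans _ _ (2 / s * (e / 2 * s))).
  apply: ler_pM => //; last exact: ltW.
  rewrite (le_trans Ns)// mulrDl mul1r lerD2l invf_ge1//.
rewrite le_eqVlt; apply/orP; left; apply/eqP; field.
by rewrite gt_eqF.
Qed.

(** The half of (i) from which (ii) is derived. *)
Definition divergence_implies_full := forall Psi : {poly F} -> R, (forall Q, 0 <= Psi Q) ->
  (\esum_(Q in [set Q : {poly F} | Q \is monic]) nud (approx_pow d Psi Q) = +oo)%E ->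
  nud (limsup_approx d Psi) = 1%E.

(** For each k there is a function supported on degrees at least k, of total weight at least [c0],
    with a union of measure at most 2^-(k+2). The maximum of these functions has a divergent sum but
    a limsup set of measure at most 1/2. *)
Lemma strong_bound_of_divergence : divergence_implies_full -> strong_bound.
Proof.
move=> div; apply: contrapT => nsb.
have /choice[Psi Psi_prop] : forall k : nat, exists Psi : {poly F} -> R,
    exists n1, [/\ forall Q, 0 <= Psi Q,
    forall Q, (pdeg Q < k)%N -> Psi Q = 0,
    c0 <= \sum_(0 <= i < n1) dweight d Psi i &
    (nud (approx_union Psi 0) <= (2^-1 / (2 ^ k.+1)%:R)%:E)%E].
  by move=> k; apply: strong_bound_fails_tail; rewrite // divr_gt0// ltr0n expn_gt0.
have Psi_ge0 k Q : 0 <= Psi k Q by have [n1 []] := Psi_prop k.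
(* The k-th function vanishes below degree k, so this finite maximum bounds all of them at Q. *)
pose Psi_max Q := \big[Num.max/0]_(k < (pdeg Q).+1) Psi k Q.
have max_ge0 Q : 0 <= Psi_max Q.
  by rewrite /Psi_max; elim/big_ind : _ => // x y x0 y0; rewrite le_max x0.
have max_ge k Q : Psi k Q <= Psi_max Q.
  have [kQ|Qk] := leqP k (pdeg Q); last first.
    by have [n1 [_ -> //]] := Psi_prop k.
  rewrite /Psi_max (bigD1 (Ordinal (kQ : (k < (pdeg Q).+1)%N)))//=.
  by rewrite le_max lexx.
have unb : unbounded (dmeasure nud Psi_max).
  have a0 := approx_const_gt0 R F d; have c00 := dilate_const_gt0 R F d.
  apply: (@unboundedP _ _ (approx_const R F d * Num.min c0 1)).
  - by rewrite mulr_gt0// lt_min c00 ltr01.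
  - exact: dmeasure_ge0.
  - move=> k; have [n1 [_ Psik0 c0n1 _]] := Psi_prop k.
    exists n1; apply: (@le_trans _ _ (\sum_(k <= i < n1) dmeasure nud (Psi k) i)); last first.
      apply: ler_sum => i _; apply: le_degree_sum => Q _ Qm.
      apply: fine_le; try exact: (nud_approx_fin hnu hnu1 hnud).
      apply: le_measure; rewrite ?inE.
      + by apply: measurable_approx_pow; exact: monic_neq0.
      + by apply: measurable_approx_pow; exact: monic_neq0.
      + exact: le_approx_pow.
    apply: le_trans (sum_dmeasure_ge hnu hnu1 hnud k n1 (Psi_ge0 k)).
    rewrite ler_pM2l// le_min !ge_min lexx orbT andbT.
    have Psik_eq0 i : (i < k)%N -> dweight d (Psi k) i = 0.
      move=> ik; rewrite /dweight /degree_sum big1// => p _.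
      by rewrite /approx_weight Psik0 ?pdeg_XnDp// !mul0r expr0n gtn_eqF.
    have [kn|nk] := leqP k n1.
      move: c0n1; rewrite (big_cat_nat (leq0n k) kn)/= big_nat big1 ?add0r.
        by move=> ->.
      by move=> i /andP[_ ik]; exact: Psik_eq0.
    move: c0n1; rewrite big_nat big1 ?leNgt ?c00// => i /andP[_ i1].
    by rewrite Psik_eq0// (ltn_trans i1).
have := div Psi_max max_ge0; rewrite (esum_measure_unbounded hnu hnu1 hnud) => /(_ unb) W1.
suff : (nud (limsup_approx d Psi_max) <= 2^-1%:E)%E.
  by rewrite W1 lee_fin; lra.
(* The maximum is attained at each Q, so even the full union for [Psi_max] is covered by the unions
   for the single functions. *)
apply: (@le_trans _ _ (\sum_(0 <= k <oo) nud (approx_union (Psi k) 0))%E).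
  apply: (measure_sigma_subadditive nud) => [k||].
  - exact: measurable_approx_union.
  - exact: measurable_limsup_approx.
  rewrite limsup_approxE => x /(_ 0%N I) [Q [Qm _] xQ].
  have [k kQ] : exists k, Psi_max Q <= Psi k Q.
    rewrite /Psi_max; elim/big_ind : _ => [|a b [k ak] [l bl]|k _]; last by exists k.
      by exists 0%N.
    by case: (leP a b) => ab; [exists l|exists k].
  by exists k => //; exists Q => //; apply: le_approx_pow xQ.
apply: le_trans (@epsilon_trick0 R 2^-1 xpredT _); last by rewrite invr_ge0.
by apply: lee_nneseries => // k _; have [n1 []] := Psi_prop k.
Qed.

End Copies.

(** * From the quantitative bound to the zero-one statement *)

Section ZeroOneArgument.
Variables (R : realType) (F : finFieldType) (d : nat).
Hypothesis d_gt0 : (0 < d)%N.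
Variables (nu : {measure set (laurent F) -> \bar R})
  (nud : {measure set (d.-tuple (laurent F)) -> \bar R}).
Hypotheses (hnu : haar_measure nu) (hnu1 : nu (@open_unit_ball F) = 1%E)
  (hnud : product_measure_of nu nud).
Implicit Types (Psi : {poly F} -> R) (P Q : {poly F}).
Local Notation T := (d.-tuple (laurent F)).
Local Notation iota := (@laurent_of_poly F).
Local Notation X := (iota 'X).
Local Notation q := (#|F|%:R : R).
Local Notation cube := (@unit_cube F d).

(** Borel-Cantelli with the Q grouped by degree: if the sum is finite, the limsup of the sets [G n]
    is null, and it contains the limsup set of [Psi]. *)
Lemma unbounded_of_limsup Psi : nud (limsup_approx d Psi) = 1%E ->
  unbounded (dmeasure nud Psi).
Proof.
move=> W1; have m0 n := dmeasure_ge0 nud Psi n.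
rewrite -nneseries_unbounded//; apply: contrapT => noo.
pose G n : set T :=
  \bigcup_(p in [set p : {poly_n F} | xpredT p]) approx_pow d Psi ('X^n + (p : {poly F})).
have mp n (p : {poly_n F}) : measurable (approx_pow d Psi ('X^n + (p : {poly F}))).
  by apply: measurable_approx_pow; exact/monic_neq0/monic_XnDp.
have mG n : measurable (G n).
  by apply: fin_bigcup_measurable => [|p _]; [exact: finite_finset|exact: mp].
have Gle n : (nud (G n) <= (dmeasure nud Psi n)%:E)%E.
  have := le_measure_finType nud (P := xpredT) (fun p _ => mp n p) (mG n) (@subset_refl _ _).
  move=> /le_trans; apply.
  rewrite /dmeasure /degree_sum -sumEFin; apply: lee_sum => p _.
  by rewrite fineK// (nud_approx_fin hnu hnu1 hnud)// monic_XnDp.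
have : nud (lim_sup_set G) = 0%E.
  apply: lim_sup_set_cvg0 => //.
  apply: (@le_lt_trans _ _ (\sum_(0 <= n <oo) (dmeasure nud Psi n)%:E)%E).
    by apply: lee_nneseries => // n _; exact: Gle.
  by rewrite ltey; apply/eqP => oo; apply: noo.
move=> G0; suff : (nud (limsup_approx d Psi) <= 0)%E by rewrite W1 lee_fin ler10.
rewrite -G0; apply: le_measure; rewrite ?inE.
- exact: measurable_limsup_approx.
- by apply: bigcapT_measurable => n; apply: bigcup_measurable => k _.
rewrite limsup_approxE => x xW n _; have [Q [Qm nQ] xQ] := xW n I.
have sQ := monic_subXn Qm; exists (pdeg Q) => //.
by exists (NPoly sQ) => //=; rewrite addrC subrK.
Qed.

Section Bound.
Variable C : R.
Hypothesis C_gt0 : 0 < C.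
Hypothesis C_bound : forall Psi : {poly F} -> R, (forall Q, 0 <= Psi Q) ->
  (C%:E * Order.min
    (\esum_(Q in [set Q : {poly F} | Q \is monic]) (approx_weight d Psi Q)%:E) 1
    <= nud (\bigcup_(Q in [set Q : {poly F} | Q \is monic]) approx_pow d Psi Q))%E.

(** The bound is applied to [Psi] set to 0 below degree [n0]; only sets from [approx_union Psi n0]
    then remain. *)
Lemma nud_union_ge Psi (n0 N : nat) (a : R) : (forall Q, 0 <= Psi Q) ->
  a <= 1 -> a <= \sum_(n0 <= i < N) dweight d Psi i ->
  ((C * a)%:E <= nud (approx_union Psi n0))%E.
Proof.
move=> Psi0 a1 aN.
pose Psi' := glue n0 (fun=> 0) Psi.
have Psi'0 : forall Q, 0 <= Psi' Q by exact: glue_ge0.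
apply: (@le_trans _ _ (nud (approx_union Psi' 0))); last first.
  apply: le_measure; rewrite ?inE; try exact: measurable_approx_union.
  move=> x [Q [Qm _] xQ]; have [Qn|nQ] := ltnP (pdeg Q) n0.
    by move: xQ; rewrite approx_pow_eq0// /Psi' /glue Qn.
  by exists Q => //; apply: le_approx_pow xQ; rewrite /Psi' /glue ltnNge nQ.
rewrite approx_union0; apply: le_trans (C_bound Psi'0); rewrite EFinM.
rewrite lee_pmul2l// le_min lee_fin a1 andbT esum_weight//.
apply: (@le_trans _ _ (\sum_(0 <= i < N) (dweight d Psi' i)%:E)%E); last first.
  by apply: nneseries_lim_ge => i _ _; rewrite lee_fin dweight_ge0.
rewrite sumEFin lee_fin (le_trans aN)//.
have tE i : (n0 <= i)%N -> dweight d Psi i = dweight d Psi' i.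
  by move=> ni; rewrite dweight_glue ltnNge ni.
have [nN|Nn] := leqP n0 N; last first.
  by rewrite big_geq ?(ltnW Nn)// sumr_ge0// => i _; exact: dweight_ge0.
rewrite [leRHS](big_cat_nat (leq0n n0) nN)/= ler_wpDl//.
  by apply: sumr_ge0 => i _; exact: dweight_ge0.
by rewrite !big_nat; apply: ler_sum => i /andP[ni _]; rewrite tE.
Qed.

Lemma nud_limsup_ge_of_tails Psi (a : R) : (forall Q, 0 <= Psi Q) -> a <= 1 ->
  (forall n0, exists N, a <= \sum_(n0 <= i < N) dweight d Psi i) ->
  ((C * a)%:E <= nud (limsup_approx d Psi))%E.
Proof.
move=> Psi0 a1 tails; apply: (nud_limsup_ge hnu hnu1 hnud) => n.
by have [N aN] := tails n; exact: nud_union_ge aN.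
Qed.

Lemma nud_limsup_ge_of_unbounded Psi : (forall Q, 0 <= Psi Q) ->
  unbounded (dweight d Psi) -> (C%:E <= nud (limsup_approx d Psi))%E.
Proof.
move=> Psi0 unb; rewrite -[C]mulr1; apply: nud_limsup_ge_of_tails => // n0.
have [||N _ aN] := @unbounded_tail _ (dweight d Psi) n0 1; last by exists N.
- by move=> n; exact: dweight_ge0.
- exact: unb.
Qed.

Lemma X_irreducible : irreducible_poly ('X : {poly F}).
Proof. by have := irredp_XsubC (0 : F); rewrite subr0. Qed.

Lemma coprimep_subM (A B Q : {poly F}) : coprimep (A - B * Q) Q = coprimep A Q.
Proof.
by rewrite -coprimep_modpl modpD modpN modp_mull oppr0 addr0 coprimep_modpl.
Qed.

(* For a = 0 the translation by X^0 would not be one by an element of L, and none is needed. *)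
Definition Xinv (a : nat) : laurent F := if a == 0%N then 0 else X ^- a.

Lemma lball_Xinv a : lball 0 (Xinv a).
Proof.
case: a => [|a]; rewrite /Xinv//=; rewrite -(lballX a.+1) add0r.
rewrite mulfV ?expf_neq0 ?X_neq0// -(rmorph1 iota).
by apply/lball_poly; rewrite size_poly1.
Qed.

(* If P is coprime to Q = X^a Q' with X and Q' coprime and 0 < a, then so is X^m P + Q', the numerator of
   X^m P / Q + X^-a. *)
Lemma approx_pow_expand (a m : nat) Psi Psi' Q (a0 : {ffun 'I_d -> {poly_m F}}) x :
  (0 < m)%N -> 'X^a %| Q -> ~~ ('X^(a.+1) %| Q) -> Q != 0 -> q ^+ m * Psi Q <= Psi' Q ->
  cyl a0 x -> approx_pow d Psi Q x ->
  approx_pow d Psi' Q (aff 'X^m (fun i => Xinv a - iota (a0 i)) x).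
Proof.
move=> m0 aQ aSQ Q0 PsiPsi' xa0 xQ i.
have [xL [P PQ xP]] := (approx_setE _ _ Q0).1 (xQ i).
apply/(approx_setE _ _ Q0); rewrite tnth_mktuple.
move: aQ => /dvdpP[Q' QE]; rewrite mulrC in QE.
have XQ' : ~~ ('X %| Q') by apply: contra aSQ => XQ'; rewrite QE exprSr dvdp_mul2l ?Xn_neq0.
pose e := if a == 0%N then 0 else Q'.
have eE : iota e = Xinv a * iota Q.
  rewrite /e /Xinv; case: eqP => _; first by rewrite rmorph0 mul0r.
  by rewrite QE rmorphM rmorphXn mulrA mulVf ?mul1r// expf_neq0 ?X_neq0.
split.
  rewrite rmorphXn addrCA addrC; apply: lballD; last exact: lball_Xinv.
  exact: xa0.
(* Subtracting [a0 i] brings the image back into L and changes the numerator by a multiple of Q,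
   which preserves coprimality. *)
exists ('X^m * P + e - (a0 i : {poly F}) * Q).
  rewrite coprimep_subM.
  have cX : coprimep 'X Q' by rewrite irreducible_poly_coprime//; exact: X_irreducible.
  have cXP : coprimep ('X^m * P) Q'.
    by move: PQ; rewrite QE coprimepMl coprimepMr coprimep_expl// => /andP[].
  rewrite QE coprimepMr /e; case: eqP => [->|/eqP an0].
    by rewrite expr0 coprimep1 addr0.
  rewrite -lt0n in an0; apply/andP; split.
    rewrite coprimep_expr// coprimep_sym irreducible_poly_coprime; last exact: X_irreducible.
    apply: contra XQ' => h; rewrite -(dvdp_addr _ (_ : 'X %| 'X^m * P))//.
    by rewrite dvdp_mulr// -{1}['X]expr1 dvdp_exp2l.
  by rewrite -[Q' in X in coprimep X _]opprK -[- Q']mulN1r coprimep_subM.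
rewrite rmorphB rmorphD !rmorphM/= eE.
rewrite [X in labs _ X](_ : _ = iota 'X^m * (tnth x i * iota Q - iota P)); last by ring.
apply: lt_le_trans PsiPsi'; rewrite labsM labs_poly ?Xn_neq0//.
by rewrite /pdeg size_polyXn/= -exprnP ltr_pM2l// qX_gt0.
Qed.

Lemma limsup_approx_full Psi (V : set T) : measurable V -> V `<=` limsup_approx d Psi ->
  nud V = 1%E -> nud (limsup_approx d Psi) = 1%E.
Proof.
move=> mV VW V1; apply/eqP; rewrite eq_le; apply/andP; split.
  apply: (nud_le1 hnu hnu1 hnud); last exact: limsup_approx_cube.
  exact: measurable_limsup_approx.
by rewrite -V1; apply: le_measure; rewrite ?inE//; exact: measurable_limsup_approx.
Qed.

Lemma nud_setD_cube (V : set T) : measurable V -> V `<=` cube ->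
  nud V = (1 - nud (cube `\` V))%E.
Proof.
move=> mV VC; have mC := @measurable_unit_cube F d.
have fC : (nud cube < +oo)%E by rewrite (nud_cube hnu hnu1 hnud) ltry.
rewrite measureD//= (setIidr VC) (nud_cube hnu hnu1 hnud).
by rewrite -(fineK (nud_fin hnu hnu1 hnud mV VC)) -!EFinB opprB addrCA subrr addr0.
Qed.

(* The maps aff 'X^m b are bijections from the cylinders to the unit cube, so the complement Z of V
   satisfies nud Z * nud (cyl a0) <= nud (Z `&` cyl a0). *)
Lemma full_of_expansion Psi (V : set T) : measurable V -> V `<=` limsup_approx d Psi ->
  (0 < nud V)%E ->
  (forall (m : nat) (a0 : {ffun 'I_d -> {poly_m F}}), (0 < m)%N ->
     exists2 b : 'I_d -> laurent F, forall i, lball 0 (b i + iota (a0 i)) &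
       forall x, cyl a0 x -> V x -> V (aff 'X^m b x)) ->
  nud (limsup_approx d Psi) = 1%E.
Proof.
move=> mV VW V0 Vexp; apply: (limsup_approx_full mV VW).
have VC : V `<=` cube by move=> x /VW; exact: limsup_approx_cube.
have mC := @measurable_unit_cube F d.
have mZ : measurable (cube `\` V) by exact: measurableD.
have ZC : cube `\` V `<=` cube by move=> x [].
rewrite (nud_setD_cube mV VC) in V0 *.
have [Z0|Z1] : nud (cube `\` V) = 0%E \/ nud (cube `\` V) = 1%E.
- apply: (nud_zero_one hnu hnu1 hnud) => // -[|m] a0.
    by rewrite cyl0E (nud_cube hnu hnu1 hnud) mule1 (setIidl ZC).
  have [b b0 Vb] := Vexp m.+1 a0 isT.
  have := nud_aff hnu hnu1 hnud b (Xn_neq0 F m.+1) mZ ZC.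
  rewrite /pdeg size_polyXn/= (nud_cyl hnu hnu1 hnud) muleC => <-.
  apply: le_measure; rewrite ?inE.
  + rewrite -[X in measurable X]setTI; apply: measurable_aff => //; exact: Xn_neq0.
  + by apply: measurableI => //; exact: measurable_cyl.
  (* Since [b + a0] has coordinates in L, a point mapped into the cube must come from the cylinder
     [a0]. *)
  + move=> x [xC xV]; have xa0 : cyl a0 x.
      move=> i; have := xC i; rewrite /= tnth_mktuple [iota _]rmorphXn => xi.
      have -> : X ^+ m.+1 * tnth x i - iota (a0 i) =
          (X ^+ m.+1 * tnth x i + b i) - (b i + iota (a0 i)) by ring.
      exact: lballB.
    split=> //; split; first exact: cyl_unit_cube xa0.
    by move=> Vx; apply: xV; exact: Vb.
- by rewrite Z0 sube0.
- by move: V0; rewrite Z1 subee// ltxx.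
Qed.

(** * Divergence at a fixed order at X *)

Section FixedOrder.
Variables (Psi : {poly F} -> R) (a : nat).
Hypotheses (Psi_ge0 : forall Q, 0 <= Psi Q)
  (Psi_ord : forall Q, Psi Q != 0 -> ('X^a %| Q) && ~~ ('X^(a.+1) %| Q))
  (Psi_unb : unbounded (dweight d Psi)).

Let s (n : nat) : R := \sum_(0 <= i < n.+1) dweight d Psi i.
(** The d-th root makes division of [Psi] by eta divide the weights of degree n by the partial sum
    [s n]. *)
Let eta (n : nat) : R := s n `^ (d%:R^-1).
Let Psi' Q : R := Psi Q / eta (pdeg Q).

Let s_ge0 n : 0 <= s n.
Proof. by apply: sumr_ge0 => i _; exact: dweight_ge0. Qed.

Let eta_ge0 n : 0 <= eta n. Proof. exact: powR_ge0. Qed.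

Let etaX n : eta n ^+ d = s n.
Proof.
by rewrite -powR_mulrn// -powRrM mulVf ?powRr1// pnatr_eq0 gtn_eqF.
Qed.

Let Psi'_ge0 Q : 0 <= Psi' Q. Proof. by rewrite divr_ge0. Qed.

Let dweight_Psi' n : dweight d Psi' n = dweight d Psi n / s n.
Proof.
rewrite /dweight /degree_sum mulr_suml; apply: eq_bigr => p _.
rewrite /approx_weight /Psi' pdeg_XnDp -(etaX n) -expr_div_n; congr (_ ^+ _).
by rewrite -!mulrA; congr (_ * _); rewrite mulrC -mulrA.
Qed.

(* Abel-Dini: dividing the terms of a divergent series by its partial sums preserves divergence. *)
Let tails_Psi' n0 : exists N, 2^-1 <= \sum_(n0 <= i < N) dweight d Psi' i.
Proof.
have w0 i : 0 <= dweight d Psi i by exact: dweight_ge0.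
set A := \sum_(0 <= i < n0) dweight d Psi i.
have A0 : 0 <= A by apply: sumr_ge0 => i _.
(* A block B >= A + 1 is more than half of A + B, and A + B bounds every partial sum used as a
   divisor in the block. *)
have [N nN AN] := @unbounded_tail _ (dweight d Psi) n0 (A + 1) w0 Psi_unb.
exists N; set B := \sum_(n0 <= i < N) _ in AN.
have AB : \sum_(0 <= i < N) dweight d Psi i = A + B by rewrite (big_cat_nat (leq0n n0) nN).
have B0 : 0 < A + B by lra.
apply: (@le_trans _ _ (B / (A + B))).
  by rewrite ler_pdivlMr//; lra.
have [D DE] : exists D, D = A + B by exists (A + B).
rewrite -DE in AB *; rewrite /B mulr_suml !big_nat; apply: ler_sum => i /andP[_ iN].
(* Where [s i] is 0 the weight vanishes as well, so the division by zero is harmless. *)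
rewrite dweight_Psi'; have [si0|si0] := eqVneq (s i) 0.
  have : dweight d Psi i <= s i by rewrite /s big_nat_recr//= lerDr sumr_ge0.
  rewrite si0 => wi; have -> : dweight d Psi i = 0 by apply/eqP; rewrite eq_le wi w0.
  by rewrite !mul0r.
have si_gt0 : 0 < s i by rewrite lt_def si0 s_ge0.
have sD : s i <= D by rewrite -AB; exact: sum_nat_mono.
apply: ler_wpM2l => //; rewrite lef_pV2 ?posrE//.
exact: lt_le_trans sD.
Qed.

(** The union over j absorbs the factor q^m by which an expanding map enlarges the radii. *)
Let V : set T := \bigcup_j limsup_approx d (fun Q => q ^+ j * Psi' Q).

Let measurable_V : measurable V.
Proof. by apply: bigcupT_measurable => j; exact: measurable_limsup_approx. Qed.

(** For fixed j, eta is at least q^j from some degree on, and then q^j [Psi'] <= [Psi]; lower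
    degrees do not affect a limsup set. *)
Let V_limsup : V `<=` limsup_approx d Psi.
Proof.
move=> x [j _]; rewrite !limsup_approxE => xW n _.
have [N sN] := Psi_unb ((q ^+ j) ^+ d).
have [Q [Qm nQ] xQ] := xW (maxn n N) I.
exists Q; first by split=> //; apply: leq_trans nQ; exact: leq_maxl.
apply: le_approx_pow xQ.
have NQ : (N <= pdeg Q)%N by apply: leq_trans nQ; exact: leq_maxr.
have qeta : q ^+ j <= eta (pdeg Q).
  have := ler_pXn2r d_gt0 (ltW (qX_gt0 F R j) : q ^+ j \is Num.nneg) (eta_ge0 (pdeg Q) : _ \is Num.nneg).
  move=> <-; rewrite etaX; apply: (le_trans sN).
  apply: sum_nat_mono; first by move=> i; exact: dweight_ge0.
  exact: leq_trans NQ _.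
rewrite /Psi' mulrCA ler_piMr// ler_pdivrMr ?mul1r//.
exact: lt_le_trans (qX_gt0 F R j) qeta.
Qed.

(** The tails of [Psi'] give V measure at least C / 2 through its piece j = 0, and an expanding map
    sends the piece j into the piece j + m. *)
Lemma limsup_full_of_fixed_order : nud (limsup_approx d Psi) = 1%E.
Proof.
apply: (full_of_expansion measurable_V V_limsup).
  apply: (@lt_le_trans _ _ (C * 2^-1)%:E).
    by rewrite lte_fin mulr_gt0// invr_gt0.
  apply: (@le_trans _ _ (nud (limsup_approx d Psi'))).
    apply: nud_limsup_ge_of_tails; [exact: Psi'_ge0| |exact: tails_Psi'].
    by rewrite invf_le1// ler1n.
  apply: le_measure; rewrite ?inE//; first exact: measurable_limsup_approx.
  move=> x xW; exists 0%N => //; move: xW; rewrite !limsup_approxE => xW n _.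
  have [Q Qn xQ] := xW n I; exists Q => //; apply: le_approx_pow xQ.
  by rewrite expr0 mul1r.
move=> m a0 m0; exists (fun i => Xinv a - iota (a0 i)).
  by move=> i; rewrite subrK; exact: lball_Xinv.
move=> x xa0 [j _ xW]; exists (j + m)%N => //; move: xW; rewrite !limsup_approxE => xW n _.
have [Q [Qm Qn] xQ] := xW n I; exists Q => //.
have Psi0 : Psi Q != 0.
  apply: contraPneq xQ => Psi0; rewrite approx_pow_eq0 ?/Psi' ?Psi0 ?mul0r ?mulr0//.
have /andP[aQ aSQ] := Psi_ord Psi0.
apply: (approx_pow_expand m0 aQ aSQ _ _ xa0 xQ); first exact: monic_neq0.
by rewrite mulrA -exprD addnC.
Qed.

End FixedOrder.

(** * Divergence over the multiples of every power of X *)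

Section UnboundedOrder.
Variable Psi : {poly F} -> R.
Hypothesis Psi_ge0 : forall Q, 0 <= Psi Q.
Let Psi_ (m : nat) Q : R := if ('X^m %| Q)%R then Psi Q else 0.
Hypothesis Psi_unb : forall m, unbounded (dweight d (Psi_ m)).

(** Intersecting over all m provides Q divisible by X^(m+1), as the translations by A / X^m require
    for every m. *)
Let W : set T := \bigcap_m limsup_approx d (Psi_ m).

Let Psi__ge0 m Q : 0 <= Psi_ m Q.
Proof. by rewrite /Psi_; case: ifP. Qed.

Let le_Psi_ m m' Q : (m <= m')%N -> Psi_ m' Q <= Psi_ m Q.
Proof.
move=> mm'; rewrite /Psi_; case: ifP => [mQ|_]; last by case: ifP.
by rewrite (dvdp_trans _ mQ)// dvdp_exp2l.
Qed.

Lemma le_limsup_approx Psi1 Psi2 : (forall Q, Psi1 Q <= Psi2 Q) ->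
  limsup_approx d Psi1 `<=` limsup_approx d Psi2.
Proof.
move=> le12 x; rewrite !limsup_approxE => xW n _.
by have [Q Qn xQ] := xW n I; exists Q => //; apply: le_approx_pow xQ.
Qed.

Let measurable_W : measurable W.
Proof. by apply: bigcapT_measurable => m; exact: measurable_limsup_approx. Qed.

Let W_cube : W `<=` cube.
Proof. by move=> x /(_ 0%N I); exact: limsup_approx_cube. Qed.

(* If X^(m+1) divides Q then Q and Q / X^m have the same prime factors, so that P and P - A Q / X^m are
   coprime to Q at the same time. *)
Let W_translate (m : nat) (a b : {ffun 'I_d -> {poly_m F}}) x :
  cyl b x -> W (aff 1 (fun i => (iota (a i) - iota (b i)) / X ^+ m) x) -> W x.
Proof.
move=> xb yW m' _; rewrite limsup_approxE => n _.
have := yW (maxn m' m.+1) I; rewrite limsup_approxE => /(_ n I)[Q [Qm Qn] yQ].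
exists Q => //; have Q0 := monic_neq0 Qm.
have xC := cyl_unit_cube xb.
have [XQ|XQ] := boolP ('X^(maxn m' m.+1) %| Q)%R; last first.
  by move: yQ; rewrite approx_pow_eq0// /Psi_ (negbTE XQ).
apply: (@le_approx_pow _ _ _ (Psi_ (maxn m' m.+1))); first exact/le_Psi_/leq_maxl.
have /dvdpP[Q' QE] : ('X^(m.+1) %| Q)%R by rewrite (dvdp_trans _ XQ)// dvdp_exp2l// leq_maxr.
move=> i; have [_ [P PQ]] := (approx_setE _ _ Q0).1 (yQ i); rewrite tnth_mktuple => xP.
apply/(approx_setE _ _ Q0); split; first exact: xC.
pose A := (a i : {poly F}) - (b i : {poly F}).
exists (P - A * (Q' * 'X)).
  have PX : coprimep (P - A * (Q' * 'X)) (Q' * 'X).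
    rewrite coprimep_subM; apply: coprimep_dvdl PQ.
    by rewrite QE; apply: dvdp_mul => //; rewrite exprS dvdp_mulr.
  move: PX; rewrite QE !coprimepMr => /andP[-> PX].
  by rewrite coprimep_expr.
rewrite [X in labs _ X](_ : _ = (iota 1 * tnth x i + (iota (a i) - iota (b i)) / X ^+ m) * iota Q - iota P)//.
have -> : iota Q = iota (Q' * 'X) * X ^+ m.
  by rewrite QE exprSr mulrA mulrAC [RHS]mulrC -rmorphXn -rmorphM mulrC mulrA.
have -> : iota (P - A * (Q' * 'X)) =
    iota P - (iota (a i) - iota (b i)) * iota (Q' * 'X).
  by rewrite [LHS]rmorphB/= [iota (A * _)]rmorphM/= [iota A]rmorphB.
rewrite rmorph1 mul1r; field.
by rewrite expf_neq0// X_neq0.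
Qed.

(** Translations show that no cylinder of a given level holds more of W than another. Summing over
    the level yields the hypothesis of the zero-one criterion, and nud W >= C > 0 excludes the value
    0. *)
Lemma limsup_full_of_unbounded_order : nud (limsup_approx d Psi) = 1%E.
Proof.
have W_limsup : W `<=` limsup_approx d Psi.
  move=> x /(_ 0%N I); apply: le_limsup_approx => Q.
  by rewrite /Psi_; case: ifP.
apply: (limsup_approx_full measurable_W W_limsup).
have CW : (C%:E <= nud W)%E.
  apply: (nud_bigcap_ge hnu hnu1 hnud).
  - by move=> m; exact: measurable_limsup_approx.
  - by move=> m; exact: limsup_approx_cube.
  - by move=> m m' mm'; apply: le_limsup_approx => Q; exact: le_Psi_.
  - by move=> m; apply: nud_limsup_ge_of_unbounded.
have [W0|//] : nud W = 0%E \/ nud W = 1%E.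
  apply: (nud_zero_one hnu hnu1 hnud) => // m b.
  have mWc c : measurable (W `&` @cyl F d m c).
    by apply: measurableI => //; exact: measurable_cyl.
  have le_b (a : {ffun 'I_d -> {poly_m F}}) : (nud (W `&` cyl a) <= nud (W `&` cyl b))%E.
    pose t i := (iota (a i) - iota (b i)) / X ^+ m.
    have := nud_aff hnu hnu1 hnud t (oner_neq0 _) (mWc a) (subset_trans (@subIsetl _ _ _) W_cube).
    rewrite /pdeg size_poly1 expr0 invr1 expr1n mul1e => <-.
    apply: le_measure; rewrite ?inE//.
      by rewrite -[X in measurable X]setTI; apply: measurable_aff => //; exact: oner_neq0.
    move=> x [xW xa].
    have xb : cyl b x.
      move=> i; have := xa i; rewrite tnth_mktuple rmorph1 mul1r mulrDr.
      rewrite [X ^+ m * (_ / _)]mulrCA mulfV ?expf_neq0 ?X_neq0// mulr1.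
      have -> : X ^+ m * tnth x i + (iota (a i) - iota (b i)) - iota (a i) =
        X ^+ m * tnth x i - iota (b i) by ring.
      by [].
    by split=> //; exact: W_translate xb xW.
  rewrite (sum_cyl nud m measurable_W W_cube).
  apply: (@le_trans _ _ ((\sum_(a : {ffun 'I_d -> {poly_m F}}) nud (W `&` cyl b)) * nud (cyl b))%E).
    by apply: lee_wpmul2r => //; apply: lee_sum => a _; exact: le_b.
  have fb : nud (W `&` cyl b) \is a fin_num.
    by apply: (nud_fin hnu hnu1 hnud) => // x [/W_cube].
  rewrite -(fineK fb) sumEFin (nud_cyl hnu hnu1 hnud) -EFinM lee_fin.
  move: (fine _) => v; rewrite sumr_const card_cyl -[v *+ _]mulr_natr -mulrA natrX natrX -exprMn mulfV ?expr1n ?mulr1//.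
  by rewrite gt_eqF// qX_gt0.
by move: CW; rewrite W0 lee_fin leNgt C_gt0.
Qed.

End UnboundedOrder.

(** Unless the sum over multiples of X^m diverges for all m, take the least m where it converges.
    With m = a + 1, the sum over multiples of X^a diverges, and so does its part of order exactly
    a. *)
Lemma limsup_full_of_unbounded Psi : (forall Q, 0 <= Psi Q) ->
  unbounded (dweight d Psi) -> nud (limsup_approx d Psi) = 1%E.
Proof.
move=> Psi0 unb.
pose Psi_ (m : nat) Q : R := if ('X^m %| Q)%R then Psi Q else 0.
have [all_unb|] := pselect (forall m, unbounded (dweight d (Psi_ m))).
  exact: limsup_full_of_unbounded_order.
move=> /existsNP nall.
have ex : exists m, `[< ~ unbounded (dweight d (Psi_ m)) >].
  by have [m nm] := nall; exists m; exact/asboolP.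
(* The least m is not 0, because every Q is a multiple of X^0. *)
case: (ex_minnP ex) => -[|a] /asboolP na a_min.
  exfalso; apply: na; apply: le_unbounded unb => n.
  by apply: le_degree_sum => Q _ _; rewrite /approx_weight /Psi_ expr0 dvd1p.
have a_unb : unbounded (dweight d (Psi_ a)).
  apply: contrapT => nu_a; have /a_min : `[< ~ unbounded (dweight d (Psi_ a)) >] by exact/asboolP.
  by rewrite ltnn.
pose Psia Q : R := if ('X^a %| Q)%R && ~~ ('X^(a.+1) %| Q)%R then Psi Q else 0.
have Psia0 Q : 0 <= Psia Q by rewrite /Psia; case: ifP.
have PsiaE n : dweight d (Psi_ a) n = dweight d (Psia) n + dweight d (Psi_ a.+1) n.
  rewrite /dweight /degree_sum -big_split/=; apply: eq_bigr => p _.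
  rewrite /approx_weight /Psia /Psi_; set Q := 'X^n + _.
  have z : (0 * (poly_totient Q)%:R / labs R (iota Q)) ^+ d = 0.
    by rewrite !mul0r expr0n gtn_eqF.
  have [aSQ|aSQ] := boolP ('X^(a.+1) %| Q)%R; last by rewrite andbT z addr0.
  by rewrite (dvdp_trans _ aSQ) ?dvdp_exp2l//= z add0r.
have Psia_unb : unbounded (dweight d Psia).
  move=> M; apply: contrapT => nex; apply: na => M'.
  have [N MN] := a_unb (M' + M); exists N.
  have : \sum_(0 <= n < N) dweight d Psia n < M.
    by rewrite ltNge; apply/negP => MN'; apply: nex; exists N.
  move: MN; rewrite (eq_bigr _ (fun n _ => PsiaE n)) big_split/=.
  by move=> h1 h2; rewrite -(lerD2r M) (le_trans h1)// addrC lerD2l ltW.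
have : nud (limsup_approx d Psia) = 1%E.
  apply: (@limsup_full_of_fixed_order Psia a) => // Q.
  by rewrite /Psia; case: ifP => //; rewrite eqxx.
apply: limsup_approx_full; first exact: measurable_limsup_approx.
by apply: le_limsup_approx => Q; rewrite /Psia; case: ifP.
Qed.

End Bound.
End ZeroOneArgument.

Unset Implicit Arguments.

Theorem theorem1p13 (R : realType) (F : finFieldType) (d : nat) (hd : (0 < d)%N)
    (nu : {measure set (laurent F) -> \bar R})
    (nud : {measure set (d.-tuple (laurent F)) -> \bar R})
    (hnu : haar_measure nu) (hnu1 : nu (@open_unit_ball F) = 1%E)
    (hnud : product_measure_of nu nud) :
  (forall Psi : {poly F} -> R, (forall Q, 0 <= Psi Q) ->
     nud (limsup_approx d Psi) = 1%E <->
     (\esum_(Q in [set Q : {poly F} | Q \is monic]) nud (approx_pow d Psi Q))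
       = +oo%E)
  <->
  (exists C : R, 0 < C /\
     forall Psi : {poly F} -> R, (forall Q, 0 <= Psi Q) ->
       (C%:E * Order.min
          (\esum_(Q in [set Q : {poly F} | Q \is monic])
             ((Psi Q * (poly_totient Q)%:R / labs R (laurent_of_poly Q)) ^+ d)%:E)
          1
        <= nud (\bigcup_(Q in [set Q : {poly F} | Q \is monic])
                  approx_pow d Psi Q))%E).
Proof.
split=> [zero_one|[C [C_gt0 C_bound]] Psi Psi_ge0].
  apply: (strong_bound_of_divergence hd hnu hnu1 hnud) => Psi Psi_ge0.
  exact: (zero_one Psi Psi_ge0).2.
rewrite (esum_measure_unbounded hnu hnu1 hnud); split.
  exact: (unbounded_of_limsup hnu hnu1 hnud).
move=> unb; apply: (limsup_full_of_unbounded hd hnu hnu1 hnud C_gt0 C_bound) => //.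
(* Divergence of the measures passes to the weights by v_Q <= q^d t_Q. *)
apply: (@unboundedZ _ _ (#|F|%:R ^+ d)); first exact: qX_gt0.
by apply: le_unbounded unb => n; exact: (dmeasure_le hnu hnu1 hnud).
Qed.
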